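(* Let $a,b\ge 0$ be integers and let $\Gamma_{a,b}$ be the Morrison spider. Then $\Gamma_{a,b}$ is abelian only when $(a,b)=(0,0)$ or $(a,b)=(1,1)$.
   Context: The Morrison spider $\Gamma_{a,b}$ is the following graph on $a+b+8$ vertices: take a $6$-cycle $h_0h_1h_2h_3h_4h_5$, a vertex $v$ joined to $h_0$, and a vertex $w$ joined to $v$; then attach a path with $a$ new vertices at $v$ and a path with $b$ new vertices at $h_3$. Its characteristic polynomial $P_{a,b}(x)$ satisfies $$\left(t-\tfrac1t\right)^2P_{a,b}\left(t+\tfrac1t\right)=F_{a,b}(t)+F_{a,b}(1/t),$$ $$F_{a,b}(t)=t^{a+b}\left(t^{-2}+2+2t^2-2t^4-2t^6-2t^8+t^{10}\right)+t^{a-b}\left(t^{-6}-2+t^6\right),$$ and only this characteristic polynomial matters for the statement. The Perron--Frobenius eigenvalue $\lambda$ of a finite graph is the largest real eigenvalue of its adjacency matrix; the graph is called abelian if $\mathbf{Q}(\lambda^2)$ is an abelian extension of $\mathbf{Q}$. *)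

(* Defs.v *)
From HB Require Import structures.
From mathcomp Require Import all_boot all_order all_algebra all_fingroup all_field.

Set Implicit Arguments.
Unset Strict Implicit.
Unset Printing Implicit Defensive.

Import Order.TTheory GRing.Theory Num.Theory.
Local Open Scope ring_scope.

(* A graph on n vertices is a relation e : rel 'I_n, symmetric and irreflexive
   in the intended use. *)

Definition adjacency (n : nat) (e : rel 'I_n) : 'M[algC]_n :=
  \matrix_(i, j) (e i j)%:R.

(* Eigenvalues of an integer matrix are algebraic, so nothing is lost by
   working in algC; <= on algC is only meaningful between real elements. *)
Definition is_perron_frobenius (n : nat) (e : rel 'I_n) (lambda : algC) : Prop :=
  [/\ lambda \is Num.real,
      eigenvalue (adjacency e) lambda
    & forall mu : algC, mu \is Num.real ->
        eigenvalue (adjacency e) mu -> mu <= lambda].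

(* Q(z) is realised as the subfield <<1; u>> of a number field L, where u is
   the preimage of z under an embedding of L in algC; since L is a splitting
   field over rat, such an L exists for every z, and the isomorphism class
   of <<1; u>> over rat depends only on z. *)
Definition generates_abelian_extension (z : algC) : Prop :=
  exists (L : splittingFieldType rat) (iota : {rmorphism L -> algC}) (u : L),
    [/\ iota u = z,
        galois 1%AS <<1; u>>%AS
      & abelian 'Gal(<<1; u>>%AS / 1%AS)].

Definition abelian_graph (n : nat) (e : rel 'I_n) : Prop :=
  exists2 lambda : algC,
    is_perron_frobenius e lambda & generates_abelian_extension (lambda ^+ 2).

(* Vertices: 0, ..., 5 are h_0, ..., h_5; 6 is v; 7 is w; 8, ..., 7 + a are the
   path attached at v, and 8 + a, ..., 7 + a + b the path attached at h_3, both
   listed starting from the vertex nearest the attachment point.  The guards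
   0 < a and 0 < b are needed because an empty path has no first vertex (for
   a = 0 the label 8 belongs to the other path). *)
Definition spider_arc (a b i j : nat) : bool :=
  [|| (i < 5) && (j == i.+1),
      (i == 5) && (j == 0),
      (i == 0) && (j == 6),
      (i == 6) && (j == 7),
      [&& 0 < a, i == 6 & j == 8],
      [&& 8 <= i, j == i.+1 & j < 8 + a],
      [&& 0 < b, i == 3 & j == 8 + a]
    | [&& 8 + a <= i, j == i.+1 & j < 8 + a + b]]%N.

Definition morrison_spider (a b : nat) : rel 'I_(a + b + 8) :=
  fun i j => spider_arc a b i j || spider_arc a b j i.
Arguments morrison_spider : clear implicits.

(* Main.v *)
(* Put A = a + 2, B = b + 2, lambda = t + 1/t with t > 1 and s = t^2.  The eigenvector
   equations give E(s) = 0 for E = (X^3 - 1)(X^A + 1)(X^B + 1) - 2X(X + 1)(X^(A+B) - 1), and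
   lambda^2 - 2 = s + 1/s =: beta.  In terms of z + 1/z the equation E(z) = 0 is of Herglotz
   type, so s and 1/s are the only roots of E off the unit circle and every conjugate of beta
   other than beta lies in [-2, 2].

   Suppose that Q(beta) is abelian of degree d, let p be a prime, M a prime ideal over p in the
   algebraic integers and T_p the Dickson polynomial, T_p = X^p mod p.  If inertia at M is
   trivial, a Frobenius element phi makes T_p(beta) - phi(beta) divisible by p; otherwise, for
   sigma <> 1 in the inertia group, which acts trivially modulo every prime over p because the
   group is abelian, T_p(beta) - T_p(sigma(beta)) is divisible by p^(min(p, d+1)/d).  These
   numbers are nonzero and only two of their conjugates are large, so comparing norms bounds d;
   running through suitable p gives d <= 27.

   By Kronecker's theorem a root z of E is a root of unity or has z + 1/z conjugate to beta.
   A 2-adic argument shows that the roots of unity satisfy z^24 = 1 or z^A = z^B = -1.  All roots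
   except possibly -1 are simple, whence A + B <= 77 + gcd(A, B).

   Each of the remaining pairs is excluded by a prime l modulo which E has, away from the roots
   of unity, a simple root with trace in F_l and another root with trace outside F_l: by the
   first, inertia is trivial and Frobenius fixes a conjugate of beta, hence is the identity, so
   that all conjugates of beta reduce into F_l, contradicting the second. *)

From HB Require Import structures.
From mathcomp Require Import all_boot all_order all_algebra all_fingroup all_field.
From mathcomp Require Import sesquilinear spectral.
From mathcomp Require Import ring zify.
From Stdlib Require Import Classical.
From Stdlib Require NArith.
Require Import Defs.

Set Implicit Arguments.
Unset Strict Implicit.
Unset Printing Implicit Defensive.

Import Order.TTheory GRing.Theory Num.Theory.
Local Open Scope ring_scope.

(** * Prime ideals of the ring of algebraic integers *)

Record ideal_Aint (I : algC -> Prop) : Prop := IdealAint {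
  ideal_sub : forall x, I x -> x \in Aint;
  ideal0 : I 0;
  idealD : forall x y, I x -> I y -> I (x + y);
  idealMl : forall a x, a \in Aint -> I x -> I (a * x) }.

Record prime_over (p : nat) (M : algC -> Prop) : Prop := PrimeOver {
  prime_ideal_of : ideal_Aint M;
  prime_over_p : M p%:R;
  prime_over_proper : ~ M 1;
  prime_over_mul : forall x y, x \in Aint -> y \in Aint ->
    M (x * y) -> M x \/ M y }.

Lemma Aint_div_nat (m n : nat) : n != 0%N ->
  (m%:R / n%:R \in Aint) = (n %| m)%N.
Proof.
move=> n0; apply/idP/idP; last first.
  case/dvdnP=> k ->; rewrite natrM mulfK ?pnatr_eq0 //.
  by rewrite (Aint_int k%:Z).
move=> h; have : (m%:R / n%:R : algC) \is a Num.int.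
  by apply: (Cint_rat_Aint _ h); rewrite rpred_div ?rpred_nat.
rewrite intrEge0 ?divr_ge0 ?ler0n // => /natrP[k /(canRL (mulfVK _))].
rewrite pnatr_eq0 => /(_ n0) /eqP; rewrite -natrM eqr_nat => /eqP ->.
exact: dvdn_mull.
Qed.

Lemma ideal_Aint_ext (I J : algC -> Prop) :
  ideal_Aint J -> (forall x, I x <-> J x) -> ideal_Aint I.
Proof.
case=> sJ J0 JD JM IJ; split=> [x /IJ||x y /IJ Jx /IJ Jy|a x aA /IJ Jx].
- exact: sJ.
- exact/IJ.
- exact/IJ/JD.
exact/IJ/JM.
Qed.

Section MaximalIdeal.

Variable p : nat.

Definition adjoin_ideal (I : algC -> Prop) (a x : algC) : Prop :=
  exists i b, [/\ I i, b \in Aint & x = i + a * b].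

Fixpoint ideal_chain (n : nat) (x : algC) : Prop :=
  if n isn't n'.+1 then exists2 b, b \in Aint & x = p%:R * b
  else let I := ideal_chain n' in let a := odflt 0 (unpickle n') in
    I x \/ [/\ a \in Aint, adjoin_ideal I a x & ~ adjoin_ideal I a 1].

Definition chain_union (x : algC) : Prop := exists n, ideal_chain n x.

Lemma adjoin_idealP I a : ideal_Aint I -> a \in Aint ->
  ideal_Aint (adjoin_ideal I a).
Proof.
case=> sI I0 ID IM aA; split.
- by move=> x [i [b [Ii bA ->]]]; rewrite rpredD ?rpredM // sI.
- by exists 0, 0; rewrite mulr0 addr0 rpred0.
- move=> x y [i [b [Ii bA ->]]] [j [c [Ij cA ->]]].
  by exists (i + j), (b + c); rewrite rpredD // mulrDr addrACA; split=> //; apply: ID.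
move=> c x cA [i [b [Ii bA ->]]]; exists (c * i), (c * b).
by rewrite rpredM // mulrDr mulrCA; split=> //; apply: IM.
Qed.

Lemma ideal_chainP n : ideal_Aint (ideal_chain n).
Proof.
elim: n => [|n IHn] /=.
  split.
  - by move=> x [b bA ->]; rewrite rpredM // (Aint_int p%:Z).
  - by exists 0; rewrite ?rpred0 ?mulr0.
  - by move=> x y [b bA ->] [c cA ->]; exists (b + c); rewrite ?rpredD ?mulrDr.
  by move=> a x aA [b bA ->]; exists (a * b); rewrite ?rpredM // mulrCA.
set a := odflt 0 _.
have [aA|/negP aA] := boolP (a \in Aint); last first.
  by apply: (ideal_Aint_ext IHn) => x; split=> [[|[]]|]; auto.
have adjI := adjoin_idealP IHn aA.
have sub x : ideal_chain n x -> adjoin_ideal (ideal_chain n) a x.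
  by exists x, 0; rewrite mulr0 addr0 rpred0.
case: (classic (adjoin_ideal (ideal_chain n) a 1)) => [imp|prp].
  by apply: (ideal_Aint_ext IHn) => x; split=> [[|[]]|]; auto.
apply: (ideal_Aint_ext adjI) => x; split=> [[/sub//|[]//]|ax].
by right.
Qed.

Lemma ideal_chain_proper n : prime p -> ~ ideal_chain n 1.
Proof.
move=> p_pr; elim: n => [|n IHn] /=; last by case=> // -[].
case=> b bA pb1; have p0 : p%:R != 0 :> algC.
  by rewrite pnatr_eq0 -lt0n prime_gt0.
have : 1%:R / p%:R \in Aint.
  by rewrite (_ : 1%:R = p%:R * b) // mulrAC divff // mul1r.
by rewrite Aint_div_nat ?gtn_eqF ?prime_gt0 // dvdn1 gtn_eqF ?prime_gt1.
Qed.

Lemma ideal_chain_mono m n x : (m <= n)%N -> ideal_chain m x -> ideal_chain n x.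
Proof. by move/subnK<-; elim: (n - m)%N => //= k IHk /IHk; left. Qed.

Lemma chain_unionP : ideal_Aint chain_union.
Proof.
split.
- by move=> x [n /(ideal_sub (ideal_chainP n))].
- by exists 0%N; apply: ideal0 (ideal_chainP _).
- move=> x y [m xm] [n yn]; exists (m + n)%N.
  apply: (idealD (ideal_chainP _)).
    exact: (ideal_chain_mono (leq_addr _ _) xm).
  exact: (ideal_chain_mono (leq_addl _ _) yn).
by move=> a x aA [n xn]; exists n; apply: (idealMl (ideal_chainP n)).
Qed.

Lemma chain_union_maximal a : a \in Aint -> ~ chain_union a ->
  adjoin_ideal chain_union a 1.
Proof.
move=> aA nMa; apply: NNPP => n1; apply: nMa; exists (pickle a).+1 => /=.
right; rewrite pickleK /=; split=> //.
  by exists 0, 1; rewrite add0r mulr1 rpred1; split=> //; apply: ideal0 (ideal_chainP _).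
case=> i [b [Ii bA e1]]; apply: n1; exists i, b; split=> //.
by exists (pickle a).
Qed.

End MaximalIdeal.

Lemma prime_over_exists (p : nat) : prime p -> exists M, prime_over p M.
Proof.
move=> p_pr; exists (chain_union p); have MI := chain_unionP p.
split=> //.
- by exists 0%N, 1; rewrite ?rpred1 ?mulr1.
- by case=> n; apply: ideal_chain_proper.
move=> x y xA yA Mxy; apply: NNPP => /not_or_and[nMx nMy].
have [i [b [Mi bA e1]]] := chain_union_maximal xA nMx.
apply: nMy; rewrite -[y]mulr1 e1 mulrDr.
apply: (idealD MI); first exact: (idealMl MI).
by rewrite mulrA mulrC [y * x]mulrC; apply: (idealMl MI).
Qed.

Section IdealTheory.

Variables (I : algC -> Prop) (II : ideal_Aint I).

Lemma idealN x : I x -> I (- x).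
Proof. by rewrite -mulN1r; apply: (idealMl II); rewrite rpredN rpred1. Qed.

Lemma idealB x y : I x -> I y -> I (x - y).
Proof. by move=> Ix /idealN; apply: (idealD II). Qed.

Lemma idealMr a x : a \in Aint -> I x -> I (x * a).
Proof. by rewrite mulrC; apply: (idealMl II). Qed.

Lemma ideal_sum (J : Type) (r : seq J) (P : pred J) (F : J -> algC) :
  (forall j, P j -> I (F j)) -> I (\sum_(j <- r | P j) F j).
Proof. by move=> IF; apply: big_ind => //; [apply: ideal0 | apply: idealD]. Qed.

Lemma ideal_lin a x b y : I (a - x) -> I (x - b) -> y = a - b -> I y.
Proof. by move=> h1 h2 ->; rewrite -(subrKA x); apply: (idealD II). Qed.

Lemma coef_prodXsubC_Aint (s : seq algC) i :
  {subset s <= Aint} -> (\prod_(z <- s) ('X - z%:P))`_i \in Aint.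
Proof.
elim: s i => [|z s IHs] i sA.
  by rewrite big_nil coefC; case: ifP; rewrite ?rpred1 ?rpred0.
have {}IHs j : (\prod_(z <- s) ('X - z%:P))`_j \in Aint.
  by apply: IHs => x xs; apply: sA; rewrite inE xs orbT.
rewrite big_cons mulrBl coefB coefXM coefCM.
by rewrite rpredB ?rpredM ?(sA z) ?mem_head //; case: ifP; rewrite ?rpred0.
Qed.

Lemma coef_prodXsubC_ideal (s : seq algC) i :
  (forall z, z \in s -> I z) -> (i < size s)%N ->
  I (\prod_(z <- s) ('X - z%:P))`_i.
Proof.
elim: s i => [|z s IHs] i sI // lti.
have sI' x : x \in s -> I x by move=> xs; apply: sI; rewrite inE xs orbT.
rewrite big_cons mulrBl coefB coefXM coefCM; apply: idealB.
  by case: i lti => [|i] /= lti; [apply: ideal0 | apply: IHs].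
apply: idealMr; last exact/sI/mem_head.
by apply: coef_prodXsubC_Aint => x /sI' /(ideal_sub II).
Qed.

End IdealTheory.

Section PrimeTheory.

Variables (p : nat) (M : algC -> Prop).
Hypotheses (p_pr : prime p) (PM : prime_over p M).

Let MI : ideal_Aint M := prime_ideal_of PM.

Lemma prime_over_pM a : a \in Aint -> M (p%:R * a).
Proof. by move=> aA; apply: idealMr => //; apply: prime_over_p PM. Qed.

Lemma prime_over_nat (n : nat) : M n%:R <-> (p %| n)%N.
Proof.
split=> [Mn|/dvdnP[k ->]]; last first.
  by rewrite mulnC natrM; apply/prime_over_pM/(Aint_int k%:Z).
apply: contraT; rewrite -prime_coprime // => cop; exfalso.
apply: (prime_over_proper PM).
have [a [b e]] : exists a b : nat, (n * a = p * b + 1)%N.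
  have n0 : (0 < n)%N.
    by case: n cop {Mn} => //; rewrite prime_coprime // dvdn0.
  case: (egcdnP p n0) => a b e _; exists a, b.
  by move: cop; rewrite coprime_sym /coprime => /eqP cop; rewrite mulnC e cop mulnC.
have /(congr1 (fun k : nat => k%:R : algC)) := e; rewrite natrD !natrM => e'.
have -> : 1 = n%:R * a%:R - p%:R * b%:R :> algC by rewrite e'; ring.
apply: (idealB MI); last by apply/prime_over_pM/(Aint_int b%:Z).
by apply: (idealMr MI) => //; apply: (Aint_int a%:Z).
Qed.

Lemma prime_over_int (n : int) : M n%:~R <-> (p %| `|n|)%N.
Proof.
rewrite -prime_over_nat; case: n => k; first by [].
rewrite NegzE mulrNz abszN /=.
by split=> /(idealN MI); rewrite ?opprK.
Qed.

Lemma prime_over_intP (x : algC) : x \is a Num.int -> M x -> x / p%:R \in Aint.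
Proof.
case/intrP=> n -> /prime_over_int /dvdnP[k nk].
have p0 : p%:R != 0 :> algC by rewrite pnatr_eq0 -lt0n prime_gt0.
rewrite [n]intEsign nk rmorphM PoszM rmorphM /= -!pmulrn mulrA mulfK //.
by rewrite rpredM // ?(Aint_int k%:Z) // Aint_int.
Qed.

Lemma prime_over_prod (J : finType) (P : pred J) (F : J -> algC) :
  (forall j, P j -> F j \in Aint) -> M (\prod_(j | P j) F j) ->
  exists2 j, P j & M (F j).
Proof.
move=> FA; pose Q x := x \in Aint /\ (M x -> exists2 j, P j & M (F j)).
suff [_ ] : Q (\prod_(j | P j) F j) by [].
apply: big_ind => [|x y [xA Qx] [yA Qy]|j Pj].
- by split; [exact: rpred1 | move/(prime_over_proper PM)].
- by split; [exact: rpredM | case/(prime_over_mul PM xA yA)].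
by split; [exact: FA | exists j].
Qed.

Lemma prime_over_exp x n : x \in Aint -> M (x ^+ n) -> M x.
Proof.
move=> xA; elim: n => [/(prime_over_proper PM)//|n IHn].
by rewrite exprS => /(prime_over_mul PM xA (rpredX _ xA))[//|/IHn].
Qed.

Lemma Aint_coprime_div (n : int) y : ~~ (p %| `|n|)%N -> y \in Aint ->
  n%:~R * (y / p%:R) \in Aint -> y / p%:R \in Aint.
Proof.
move=> npn yA nyA.
have [[a b] e] : exists ab : int * int, ab.1 * n + ab.2 * p%:Z = 1.
  have : coprimez n p by rewrite coprimezE coprime_sym /= prime_coprime.
  by case/coprimezP=> ab e; exists ab.
have p0 : p%:R != 0 :> algC by rewrite pnatr_eq0 -lt0n prime_gt0.
have -> : y / p%:R = a%:~R * (n%:~R * (y / p%:R)) + b%:~R * y.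
  have /(congr1 (fun k : int => k%:~R : algC)) := e.
  rewrite /= rmorphD !rmorphM /= -pmulrn => e'.
  have {1}-> : y / p%:R = (a%:~R * n%:~R + b%:~R * p%:R) * (y / p%:R).
    by rewrite e' mul1r.
  by field.
by apply: rpredD; apply: rpredM => //; apply: Aint_int.
Qed.

End PrimeTheory.

(** * Abelian number fields *)

Lemma prime_exprD (p : nat) (a b : algC) : prime p -> a \in Aint -> b \in Aint ->
  exists2 q, q \in Aint & (a + b) ^+ p = a ^+ p + b ^+ p + p%:R * (a * b * q).
Proof.
move=> p_pr aA bA; case: p p_pr => [|[|n]] // p_pr; set p := n.+2.
exists (\sum_(i < n.+1) ('C(p, i.+1) %/ p)%:R * (a ^+ (n - i) * b ^+ i)).
  rewrite rpred_sum // => i _; rewrite !rpredM ?rpredX //.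
  exact: (Aint_int ('C(p, i.+1) %/ p)%N%:Z).
rewrite exprDn big_ord_recl big_ord_recr /= /bump /= subn0 subnn !expr0 mulr1 mul1r.
rewrite bin0 binn !mulr1n [X in _ + X]addrC addrA; congr (_ + _).
rewrite !mulr_sumr; apply: eq_bigr => i _; rewrite add1n.
have lei : (i <= n)%N by rewrite -ltnS.
have /dvdnP[k ->] : (p %| 'C(p, i.+1))%N by rewrite prime_dvd_bin // !ltnS lei.
rewrite mulnK // subSS subSn // -[LHS]mulr_natl natrM !exprS; ring.
Qed.

Record abelian_field (gT : finGroupType) (K : algC -> Prop)
    (nu : gT -> {rmorphism algC -> algC}) : Prop := AbelianField {
  abf1 : K 1;
  abfD : forall x y, K x -> K y -> K (x + y);
  abfN : forall x, K x -> K (- x);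
  abfM : forall x y, K x -> K y -> K (x * y);
  abf_gal : forall g x, K x -> K (nu g x);
  abf_galM : forall g h x, K x -> nu (g * h)%g x = nu h (nu g x);
  abf_galC : forall g h x, K x -> nu g (nu h x) = nu h (nu g x);
  abf_gal1 : forall x, K x -> nu 1%g x = x;
  abf_fixed : forall x, K x -> (forall g, nu g x = x) -> x \in Crat }.

Section AbelianField.

Variables (gT : finGroupType) (K : algC -> Prop).
Variables (nu : gT -> {rmorphism algC -> algC}).
Hypothesis KA : abelian_field K nu.

Definition integral_in (x : algC) : Prop := K x /\ x \in Aint.
Local Notation O := integral_in.

Lemma abf0 : K 0.
Proof. by rewrite -(subrr 1); apply: (abfD KA (abf1 KA) (abfN KA (abf1 KA))). Qed.

Lemma int_in0 : O 0. Proof. by split; [exact: abf0 | exact: rpred0]. Qed.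
Lemma int_in1 : O 1. Proof. by split; [exact: abf1 KA | exact: rpred1]. Qed.

Lemma int_inD x y : O x -> O y -> O (x + y).
Proof. by case=> Kx xA [Ky yA]; split; [exact: (abfD KA) | exact: rpredD]. Qed.

Lemma int_inN x : O x -> O (- x).
Proof. by case=> Kx xA; split; [exact: (abfN KA) | rewrite rpredN]. Qed.

Lemma int_inB x y : O x -> O y -> O (x - y).
Proof. by move=> Ox Oy; apply: int_inD => //; apply: int_inN. Qed.

Lemma int_inM x y : O x -> O y -> O (x * y).
Proof. by case=> Kx xA [Ky yA]; split; [exact: (abfM KA) | exact: rpredM]. Qed.

Lemma int_inX x n : O x -> O (x ^+ n).
Proof.
by move=> Ox; elim: n => [|n IHn]; rewrite ?exprS; [exact: int_in1 | apply: int_inM].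
Qed.

Lemma int_in_nat n : O n%:R.
Proof.
elim: n => [|n IHn]; first exact: int_in0.
by rewrite mulrS; apply: int_inD => //; exact: int_in1.
Qed.

Lemma int_in_gal g x : O x -> O (nu g x).
Proof. by case=> Kx xA; split; [exact: (abf_gal KA) | rewrite Aint_aut]. Qed.

Lemma int_in_sum (J : Type) (r : seq J) (P : pred J) (F : J -> algC) :
  (forall j, P j -> O (F j)) -> O (\sum_(j <- r | P j) F j).
Proof. by move=> OF; apply: big_ind => //; [exact: int_in0 | exact: int_inD]. Qed.

Lemma int_in_prod (J : Type) (r : seq J) (P : pred J) (F : J -> algC) :
  (forall j, P j -> O (F j)) -> O (\prod_(j <- r | P j) F j).
Proof. by move=> OF; apply: big_ind => //; [exact: int_in1 | exact: int_inM]. Qed.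

Lemma int_in_fixed x : O x -> (forall g, nu g x = x) -> x \is a Num.int.
Proof. by case=> Kx xA fx; apply: (Cint_rat_Aint _ xA); apply: (abf_fixed KA). Qed.

Definition gal_poly (x : algC) : {poly algC} := \prod_g ('X - (nu g x)%:P).

Lemma gal_poly_int x i : O x -> (gal_poly x)`_i \is a Num.int.
Proof.
move=> Ox; apply: int_in_fixed => [|h].
  pose Q (P : {poly algC}) := forall j, O P`_j.
  suff : Q (gal_poly x) by apply.
  apply: big_ind => [j|P R HP HR j|g _ j].
  - by rewrite coefC; case: ifP => _; [exact: int_in1 | exact: int_in0].
  - by rewrite coefM; apply: int_in_sum => k _; apply: int_inM.
  rewrite coefB coefX coefC; apply: int_inB; first exact: int_in_nat.
  by case: ifP => _; [exact: int_in_gal | exact: int_in0].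
suff E : map_poly (nu h) (gal_poly x) = gal_poly x by rewrite -coef_map E.
rewrite /gal_poly rmorph_prod.
rewrite [RHS](reindex_inj (mulIg h)); apply: eq_bigr => g _ /=.
by rewrite rmorphB /= map_polyX map_polyC /= (abf_galM KA) //; case: Ox.
Qed.

Lemma gal_trace_int x : O x -> \sum_g nu g x \is a Num.int.
Proof.
move=> Ox; apply: int_in_fixed => [|h].
  by apply: int_in_sum => g _; apply: int_in_gal.
rewrite rmorph_sum [RHS](reindex_inj (mulIg h)); apply: eq_bigr => g _ /=.
by rewrite (abf_galM KA) //; case: Ox.
Qed.

Lemma gal_norm_int x : O x -> \prod_g nu g x \is a Num.int.
Proof.
move=> Ox; apply: int_in_fixed => [|h].
  by apply: int_in_prod => g _; apply: int_in_gal.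
rewrite rmorph_prod [RHS](reindex_inj (mulIg h)); apply: eq_bigr => g _ /=.
by rewrite (abf_galM KA) //; case: Ox.
Qed.

Lemma gal_poly_root x : K x -> (gal_poly x).[x] = 0.
Proof.
move=> Kx; rewrite /gal_poly horner_prod (bigD1 1%g) //=.
by rewrite hornerXsubC (abf_gal1 KA) // subrr mul0r.
Qed.

Lemma gal_polyE x : gal_poly x = \prod_(z <- [seq nu g x | g : gT]) ('X - z%:P).
Proof. by rewrite /gal_poly big_image. Qed.

Lemma size_gal_seq x : size [seq nu g x | g : gT] = #|gT|.
Proof. by rewrite size_map -cardE. Qed.

Lemma gal_poly_lead x : K x ->
  x ^+ #|gT| = - \sum_(i < #|gT|) (gal_poly x)`_i * x ^+ i.
Proof.
move=> Kx; have := gal_poly_root Kx.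
have sz : size (gal_poly x) = #|gT|.+1.
  by rewrite gal_polyE size_prod_XsubC size_gal_seq.
rewrite horner_coef sz big_ord_recr /=.
have /monicP : gal_poly x \is monic by rewrite gal_polyE monic_prod_XsubC.
rewrite /lead_coef sz /= => -> /eqP; rewrite mul1r addrC addr_eq0 => /eqP ->.
by [].
Qed.

Section PrimeOver.

Variables (p : nat) (M : algC -> Prop).
Hypotheses (p_pr : prime p) (PM : prime_over p M).

Let MI : ideal_Aint M := prime_ideal_of PM.
Let p0 : p%:R != 0 :> algC.
Proof. by rewrite pnatr_eq0 -lt0n prime_gt0. Qed.

Lemma gal_radical_exp w : O w -> (forall g, M (nu g w)) ->
  w ^+ #|gT| / p%:R \in Aint.
Proof.
move=> Ow Mw; have [Kw wA] := Ow.
rewrite gal_poly_lead // mulNr rpredN mulr_suml rpred_sum // => i _.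
rewrite mulrAC rpredM ?rpredX //.
apply: (prime_over_intP p_pr PM); first exact: gal_poly_int.
rewrite gal_polyE; apply: (coef_prodXsubC_ideal MI); last by rewrite size_gal_seq.
by move=> z /imageP[g _ ->].
Qed.

Definition inert_at (g : gT) : Prop := forall x, O x -> M (nu g x - x).

(* Expanding \prod_(h != g1) (nu g x_h - nu h x_h) over the subsets of gT gives a
   combination of the functions g |-> nu g x_S that vanishes at every g != g1. *)
Lemma gal_separation g1 : (forall g, g != 1%g -> ~ inert_at g) ->
  exists c x : {set gT} -> algC,
  [/\ forall S, O (c S), forall S, O (x S),
      forall g, g != g1 -> \sum_S c S * nu g (x S) = 0
    & ~ M (\sum_S c S * nu g1 (x S))].
Proof.
move=> nI.
have [x xP] : exists x : gT -> algC, forall h, O (x h) /\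
    (h != g1 -> ~ M (nu g1 (x h) - nu h (x h))).
  apply: (@fin_all_exists _ (fun=> algC)
    (fun h x => O x /\ (h != g1 -> ~ M (nu g1 x - nu h x)))) => h.
  have [->|hg] := eqVneq h g1; first by exists 1; split=> //; exact: int_in1.
  have /nI : (h^-1 * g1)%g != 1%g by rewrite -eq_mulVg1.
  move=> /not_all_ex_not => -[y hy]; have [Oy nMy] := imply_to_and _ _ hy.
  exists (nu h^-1%g y); split; first exact: int_in_gal.
  by move=> _; rewrite -!(abf_galM KA) ?mulVg ?(abf_gal1 KA) //; case: Oy.
pose c (S : {set gT}) := \prod_(h | h \notin S) (if h == g1 then 0 else - nu h (x h)).
pose y (S : {set gT}) := \prod_(h in S) (if h == g1 then 1 else x h).
have E g : \sum_S c S * nu g (y S) =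
    \prod_h (if h == g1 then 1 else nu g (x h) - nu h (x h)).
  rewrite [RHS](eq_bigr (fun h => nu g (if h == g1 then 1 else x h) +
      (if h == g1 then 0 else - nu h (x h)))); last first.
    by move=> h _; case: eqP => // _; rewrite rmorph1 addr0.
  rewrite bigA_distr; apply: eq_bigr => S _.
  rewrite mulrC /c /y rmorph_prod [RHS](bigID (mem S)) /=; congr (_ * _).
    by apply: eq_bigr => h ->.
  by apply: eq_bigr => h /negPf ->.
exists c, y; split.
- move=> S; apply: int_in_prod => h _; case: eqP => _; first exact: int_in0.
  by apply/int_inN/int_in_gal; case: (xP h).
- move=> S; apply: int_in_prod => h _; case: eqP => _; first exact: int_in1.
  by case: (xP h).
- by move=> g /negPf gg1; rewrite E (bigD1 g) //= gg1 subrr mul0r.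
rewrite E => /(prime_over_prod PM)[h _|h _].
  case: eqP => _; first exact: rpred1.
  have [Ox _] := xP h.
  by have [] := int_inB (int_in_gal g1 Ox) (int_in_gal h Ox).
by have [_] := xP h; case: eqP => [_ _ /(prime_over_proper PM)//|_ /(_ isT)].
Qed.

Lemma prime_over_congrX n x y : x \in Aint -> y \in Aint ->
  M (x - y) -> M (x ^+ n - y ^+ n).
Proof.
move=> xA yA Mxy; rewrite subrXX; apply: (idealMr MI) => //.
by rewrite rpred_sum // => i _; rewrite rpredM ?rpredX.
Qed.

Lemma prime_over_exp_sum (J : finType) (F : J -> algC) :
  (forall j, F j \in Aint) -> M ((\sum_j F j) ^+ p - \sum_j F j ^+ p).
Proof.
move=> FA; suff : \sum_j F j \in Aint /\ M ((\sum_j F j) ^+ p - \sum_j F j ^+ p).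
  by case.
elim/big_rec2: _ => [|j y x _ [xA Mx]].
  by rewrite expr0n gtn_eqF ?prime_gt0 // subrr; split; [exact: rpred0 | exact: (ideal0 MI)].
split; first exact: rpredD.
have [q qA ->] := prime_exprD p_pr (FA j) xA.
rewrite (_ : _ - _ = (x ^+ p - y) + p%:R * (F j * x * q)); last by ring.
by apply: (idealD MI) => //; apply: (prime_over_pM PM); rewrite !rpredM.
Qed.

Lemma prime_over_fermat t : t \is a Num.int -> M (t ^+ p - t).
Proof.
case/intrP=> n ->; pose m := `|(n %% p)%Z|%N.
have pZ0 : p%:Z != 0 by rewrite -lt0n prime_gt0.
have Mnm : M (n%:~R - m%:R).
  have -> : n%:~R - m%:R = p%:R * (n %/ p)%Z%:~R :> algC.
    rewrite {1}(divz_eq n p) rmorphD rmorphM /= -[m%:R]/(m%:Z%:~R) gez0_abs ?modz_ge0 //.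
    by rewrite addrK mulrC.
  by apply: (prime_over_pM PM); apply: Aint_int.
have mA : m%:R \in Aint by exact: (Aint_int m%:Z).
rewrite (_ : _ - _ = (n%:~R ^+ p - m%:R ^+ p) + (m%:R ^+ p - m%:R) - (n%:~R - m%:R));
  last by ring.
apply: (idealB MI) => //; apply: (idealD MI).
  by apply: prime_over_congrX => //; exact: Aint_int.
have lem k : (k <= k ^ p)%N.
  by case: k => // k; rewrite -[leqLHS]expn1; apply: leq_pexp2l => //; apply: prime_gt0.
have /eqP := fermat_little m p_pr; rewrite eqn_mod_dvd //.
by move/(prime_over_nat p_pr PM); rewrite natrB ?natrX.
Qed.

Hypothesis inert_trivial : forall g, g != 1%g -> ~ inert_at g.

Lemma trace_expansion (c x : {set gT} -> algC) y : O y ->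
  (forall g, g != 1%g -> \sum_S c S * nu g (x S) = 0) ->
  (\sum_S c S * nu 1%g (x S)) * y = \sum_S c S * \sum_g nu g (x S * y).
Proof.
case=> Ky _ x0; transitivity (\sum_g (\sum_S c S * nu g (x S)) * nu g y).
  rewrite (bigD1 (1%g : gT)) //= [X in _ + X]big1 ?addr0 ?(abf_gal1 KA _ (x := y)) //.
  by move=> g g1; rewrite x0 ?mul0r.
under eq_bigr do rewrite mulr_suml.
rewrite exchange_big; apply: eq_bigr => S _; rewrite mulr_sumr.
by apply: eq_bigr => g _; rewrite rmorphM mulrA.
Qed.

Lemma unramified_radical y : O y -> (forall g, M (nu g y)) -> y / p%:R \in Aint.
Proof.
move=> Oy My; have [Ky yA] := Oy.
have [c [x [Oc Ox x0 nMe]]] := gal_separation 1%g inert_trivial.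
set e := \sum_S _ in nMe.
have Oe : O e by apply: int_in_sum => S _; apply/int_inM/int_in_gal.
have [Ke eA] := Oe.
have key z : O z -> (forall g, M (nu g z)) -> e * z / p%:R \in Aint.
  move=> Oz Mz; rewrite trace_expansion //.
  rewrite mulr_suml rpred_sum // => S _; rewrite -mulrA rpredM //; first by case: (Oc S).
  apply: (prime_over_intP p_pr PM); first exact/gal_trace_int/int_inM.
  apply: (ideal_sum MI) => g _; rewrite rmorphM.
  by apply: (idealMl MI) => //; have [] := int_in_gal g (Ox S).
pose I (a : algC) := a \in Aint /\ a * (y / p%:R) \in Aint.
have II : ideal_Aint I.
  split=> [a []//||a b [aA ayA] [bA byA]|a b aA [bA byA]].
  - by split; rewrite ?mul0r rpred0.
  - by split; rewrite ?mulrDl rpredD.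
  by split; rewrite -?mulrA rpredM.
have Ie g : I (nu g e).
  split; first by have [] := int_in_gal g Oe.
  have Mg h : M (nu h (nu g^-1%g y)) by rewrite -(abf_galM KA) //; apply: My.
  have := key _ (int_in_gal g^-1 Oy) Mg; rewrite -(Aint_aut (nu g)).
  rewrite !rmorphM -(abf_galM KA) // mulVg (abf_gal1 KA) // fmorphV rmorph_nat.
  by rewrite -mulrA.
have [i [ltid npe]] : exists i, (i < #|gT|)%N /\ ~ M (gal_poly e)`_i.
  apply: NNPP => nex; apply: nMe; apply: (prime_over_exp PM (n := #|gT|) eA).
  rewrite (gal_poly_lead Ke); apply: (idealN MI); apply: (ideal_sum MI) => i _.
  apply: (idealMr MI); first exact: rpredX.
  by apply: NNPP => nMi; apply: nex; exists i.
have [_] : I (gal_poly e)`_i.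
  rewrite gal_polyE; apply: (coef_prodXsubC_ideal II); last by rewrite size_gal_seq.
  by move=> z /imageP[g _ ->].
have /intrP[n En] := gal_poly_int i Oe; rewrite En in npe *.
apply: (Aint_coprime_div p_pr) => //.
by apply/negP => /(prime_over_int p_pr PM).
Qed.

Lemma frobenius_exists : exists phi, forall y, O y -> M (nu phi y - y ^+ p).
Proof.
have [c [x [Oc Ox x0 nMe]]] := gal_separation 1%g inert_trivial.
set e := \sum_S _ in nMe.
have eA : e \in Aint.
  by rewrite rpred_sum // => S _; have [] := int_inM (Oc S) (int_in_gal 1%g (Ox S)).
pose H g := \sum_S c S ^+ p * nu g (x S).
have HA g : H g \in Aint.
  rewrite rpred_sum // => S _.
  by have [] := int_inM (int_inX p (Oc S)) (int_in_gal g (Ox S)).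
have key y : O y -> M (e ^+ p * y ^+ p - \sum_g H g * nu g y).
  move=> Oy; rewrite -exprMn trace_expansion //.
  have -> : \sum_g H g * nu g y = \sum_S c S ^+ p * \sum_g nu g (x S * y).
    under eq_bigr do rewrite mulr_suml.
    rewrite exchange_big; apply: eq_bigr => S _; rewrite mulr_sumr.
    by apply: eq_bigr => g _; rewrite rmorphM mulrA.
  have Ot S : O (\sum_g nu g (x S * y)).
    by apply: int_in_sum => g _; apply/int_in_gal/int_inM.
  apply: (ideal_lin MI); last reflexivity.
    by apply: prime_over_exp_sum => S; have [] := int_inM (Oc S) (Ot S).
  rewrite -sumrB; apply: (ideal_sum MI) => S _; rewrite exprMn -mulrBr.
  apply: (idealMl MI); first by have [] := int_inX p (Oc S).
  exact/prime_over_fermat/gal_trace_int/int_inM.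
have [phi nMH] : exists g, ~ M (H g).
  apply: NNPP => nex; apply: nMe; apply: (prime_over_exp PM (n := p) eA).
  have := key 1 int_in1; rewrite expr1n mulr1 => Mk.
  rewrite -(subrK (\sum_g H g * nu g 1) (e ^+ p)); apply: (idealD MI) => //.
  apply: (ideal_sum MI) => g _; rewrite rmorph1 mulr1.
  by apply: NNPP => nMg; apply: nex; exists g.
exists phi => y Oy; have [Ky yA] := Oy.
pose D z := \sum_g H g * (nu g y - y ^+ p) * nu g z.
have MD z : O z -> M (D z).
  move=> Oz; have [Kz zA] := Oz.
  have -> : D z = y ^+ p * (e ^+ p * z ^+ p - \sum_g H g * nu g z)
     - (e ^+ p * (y * z) ^+ p - \sum_g H g * nu g (y * z)).
    transitivity (\sum_g H g * nu g (y * z) - y ^+ p * \sum_g H g * nu g z).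
      rewrite mulr_sumr -sumrB; apply: eq_bigr => g _; rewrite rmorphM /=; ring.
    by rewrite exprMn; ring.
  by apply: (idealB MI); [apply: (idealMl MI); rewrite ?rpredX //; apply: key
    | apply: key; apply: int_inM].
have [c' [x' [Oc' Ox' x0' nMe']]] := gal_separation phi inert_trivial.
set e' := \sum_S _ in nMe'.
have : M (H phi * (nu phi y - y ^+ p) * e').
  have <- : \sum_S c' S * D (x' S) = H phi * (nu phi y - y ^+ p) * e'.
    under eq_bigr do rewrite mulr_sumr.
    rewrite exchange_big /= (bigD1 phi) //= [X in _ + X]big1 ?addr0.
      by rewrite mulr_sumr; apply: eq_bigr => S _; rewrite mulrCA.
    move=> g gphi; transitivity (H g * (nu g y - y ^+ p) * \sum_S c' S * nu g (x' S)).
      by rewrite mulr_sumr; apply: eq_bigr => S _; rewrite mulrCA.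
    by rewrite x0' ?mulr0.
  apply: (ideal_sum MI) => S _; apply: (idealMl MI); last exact: MD.
  by case: (Oc' S).
have e'A : e' \in Aint.
  by rewrite rpred_sum // => S _; have [] := int_inM (Oc' S) (int_in_gal phi (Ox' S)).
have dA : nu phi y - y ^+ p \in Aint.
  by have [] := int_inB (int_in_gal phi Oy) (int_inX p Oy).
have HdA : H phi * (nu phi y - y ^+ p) \in Aint by rewrite rpredM.
case/(prime_over_mul PM HdA e'A) => //.
by case/(prime_over_mul PM (HA phi) dA).
Qed.

End PrimeOver.

End AbelianField.

Lemma abelian_field_of_generator (z : algC) : generates_abelian_extension z ->
  exists (gT : finGroupType) K (nu : gT -> {rmorphism algC -> algC}),
  [/\ abelian_field K nu, K z & forall g, nu g z = z -> g = 1%g].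
Proof.
case=> L [iota [u [<- galE abG]]]; set E := <<1; u>>%AS in galE abG.
pose G := 'Gal(E / 1%AS)%G.
pose nu (g : [subg G]) : {rmorphism algC -> algC} :=
  sval (extend_algC_subfield_aut iota (gal_repr (sgval g) : 'AEnd(L))).
have nuE g x : nu g (iota x) = iota (sgval g x).
  by rewrite /nu; case: extend_algC_subfield_aut => /= f ->.
exists [subg G], (fun x => exists2 y, y \in E & iota y = x), nu; split.
- split.
  + by exists 1; rewrite ?rmorph1 ?mem1v.
  + by move=> _ _ [x Ex <-] [y Ey <-]; exists (x + y); rewrite ?rmorphD ?rpredD.
  + by move=> _ [x Ex <-]; exists (- x); rewrite ?rmorphN ?rpredN.
  + by move=> _ _ [x Ex <-] [y Ey <-]; exists (x * y); rewrite ?rmorphM ?rpredM.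
  + by move=> g _ [x Ex <-]; exists (sgval g x); rewrite ?nuE ?memv_gal.
  + by move=> g h _ [x Ex <-]; rewrite !nuE morphM ?inE // galM.
  + move=> g h _ [x Ex <-]; rewrite !nuE -!galM //.
    by rewrite (centsP abG) ?subgP.
  + by move=> _ [x Ex <-]; rewrite nuE morph1 gal_id.
  move=> _ [x Ex <-] fx.
  have : x \in 1%AS.
    rewrite -(galois_fixedField galE); apply/fixedFieldP => // g Gg.
    by apply: (fmorph_inj iota); have := fx (subg G g); rewrite nuE subgK.
  by case/vlineP=> r ->; rewrite rmorphZ_num rmorph1 mulr1 Crat_rat.
- by exists u; rewrite ?memv_adjoin.
move=> g; rewrite nuE => /fmorph_inj gu; apply: subg_inj; rewrite morph1.
by apply/eqP; rewrite (gal_adjoin_eq (K := 1%AS) (a := u)) ?subgP ?group1 //= gal_id gu.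
Qed.

(** * Dickson polynomials and the degree bound *)

Fixpoint dickson (n : nat) : {poly int} :=
  if n isn't n1.+1 then 2%:R%:P
  else if n1 isn't n2.+1 then 'X else 'X * dickson n1 - dickson n2.

Lemma dicksonSS n : dickson n.+2 = 'X * dickson n.+1 - dickson n.
Proof. by []. Qed.

(* The pair of matrices below is conjugate to diag(z, 1/z) with z + 1/z = 'X, so
   the congruence is (z + 1/z)^p = z^p + z^-p modulo p. *)
Lemma dickson_prime (p : nat) : prime p ->
  exists q : {poly int}, dickson p = 'X^p + p%:R *: q.
Proof.
move=> p_pr.
pose A : 'M[{poly int}]_2 := \matrix_(i, j) nth 0 (nth [::] [:: [:: 'X; -1]; [:: 1; 0]] i) j.
pose B : 'M[{poly int}]_2 := \matrix_(i, j) nth 0 (nth [::] [:: [:: 0; 1]; [:: -1; 'X]] i) j.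
have AB1 : A * B = 1.
  apply/matrixP=> i j; rewrite !mxE !big_ord_recl big_ord0 !mxE.
  by case: i j => [[|[|[]]]//= ?] [[|[|[]]]//= ?]; rewrite !(mulr0, mul0r, mulr1, mul1r, mulrN, mulNr, addr0, add0r, opprK, subrr).
have BA1 : B * A = 1.
  apply/matrixP=> i j; rewrite !mxE !big_ord_recl big_ord0 !mxE.
  by case: i j => [[|[|[]]]//= ?] [[|[|[]]]//= ?]; rewrite !(mulr0, mul0r, mulr1, mul1r, mulrN, mulNr, addr0, add0r, opprK, subrr, addNr).
have ABX : A + B = 'X%:M.
  apply/matrixP=> i j; rewrite !mxE.
  by case: i j => [[|[|[]]]//= ?] [[|[|[]]]//= ?]; rewrite !(addr0, add0r, mulr1n, mulr0n, addNr, subrr).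
have cAB : GRing.comm A B by rewrite /GRing.comm AB1 BA1.
have TE n : (dickson n)%:M = A ^+ n + B ^+ n /\ (dickson n.+1)%:M = A ^+ n.+1 + B ^+ n.+1.
  elim: n => [|n [IH0 IH1]].
    by rewrite !expr0 !expr1 ABX; split=> //; rewrite -raddfD -polyCD.
  split=> //; rewrite dicksonSS raddfB /= scalar_mxM IH0 IH1 -ABX.
  rewrite [LHS](_ : _ = A * A ^+ n.+1 + B * B ^+ n.+1); first by rewrite -!exprS.
  have -> : A ^+ n = B * A ^+ n.+1 by rewrite exprS mulrA BA1 mul1r.
  have -> : B ^+ n = A * B ^+ n.+1 by rewrite exprS mulrA AB1 mul1r.
  rewrite -[_ *m _]/(_ * _) mulrDl !mulrDr [B * _ + _]addrC addrACA.
  by rewrite [X in _ + X - _]addrC addrACA [X in _ + X - _]addrC addrK.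
have [TpE _] := TE p; case: p p_pr TpE => [|[|m]] // p_pr TpE; set p := m.+2 in p_pr TpE *.
pose N : 'M[{poly int}]_2 := \sum_(i < m.+1) (A ^+ (m.+1 - i) * B ^+ i.+1) *+ ('C(p, i.+1) %/ p).
have : 'X%:M ^+ p = (dickson p)%:M + p%:R * N :> 'M[{poly int}]_2.
  rewrite -ABX exprDn_comm // TpE big_ord_recl big_ord_recr /= /bump /= subn0 subnn.
  rewrite !expr0 mulr1 mul1r bin0 binn !mulr1n [X in _ + X]addrC addrA; congr (_ + _).
  rewrite mulr_sumr; apply: eq_bigr => i _; rewrite add1n subSS mulr_natl -mulrnA.
  have /divnK -> // : (p %| 'C(p, i.+1))%N.
  by rewrite prime_dvd_bin // !ltnS; case: i.
rewrite -rmorphXn => /matrixP /(_ 0 0); rewrite [RHS]mxE mulr_natl mulmxnE !mxE.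
rewrite !mulr1n => e; exists (- N 0 0); rewrite e scalerN scaler_nat addrK.
by [].
Qed.

Definition int_eval (q : {poly int}) (x : algC) : algC := (map_poly intr q).[x].

Lemma int_evalD q r x : int_eval (q + r) x = int_eval q x + int_eval r x.
Proof. by rewrite /int_eval rmorphD hornerD. Qed.

Lemma int_evalM q r x : int_eval (q * r) x = int_eval q x * int_eval r x.
Proof. by rewrite /int_eval rmorphM hornerM. Qed.

Lemma int_evalX x : int_eval 'X x = x.
Proof. by rewrite /int_eval map_polyX hornerX. Qed.

Lemma int_evalC c x : int_eval c%:P x = c%:~R.
Proof. by rewrite /int_eval map_polyC hornerC. Qed.

Lemma int_evalB q r x : int_eval (q - r) x = int_eval q x - int_eval r x.
Proof. by rewrite /int_eval rmorphB hornerD hornerN. Qed.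

Lemma int_eval1 x : int_eval 1 x = 1.
Proof. by rewrite /int_eval rmorph1 hornerC. Qed.

Lemma int_eval0 x : int_eval 0 x = 0.
Proof. by rewrite /int_eval rmorph0 horner0. Qed.

Lemma int_evalXn n x : int_eval 'X^n x = x ^+ n.
Proof. by rewrite /int_eval map_polyXn hornerXn. Qed.

Lemma int_evalMn q n x : int_eval (q *+ n) x = int_eval q x *+ n.
Proof. by rewrite /int_eval rmorphMn hornerMn. Qed.

Lemma int_eval_aut (f : {rmorphism algC -> algC}) q x :
  f (int_eval q x) = int_eval q (f x).
Proof.
rewrite /int_eval -horner_map -map_poly_comp; congr (_.[_]).
by apply: eq_map_poly => n /=; rewrite rmorph_int.
Qed.

Lemma int_eval_Aint q x : x \in Aint -> int_eval q x \in Aint.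
Proof.
move=> xA; elim/poly_ind: q => [|q c IHq]; first by rewrite /int_eval rmorph0 horner0 rpred0.
by rewrite int_evalD int_evalM int_evalX int_evalC rpredD ?rpredM ?Aint_int.
Qed.

Lemma int_eval_sub q x y : x \in Aint -> y \in Aint ->
  exists2 a, a \in Aint & int_eval q x - int_eval q y = (x - y) * a.
Proof.
move=> xA yA; elim/poly_ind: q => [|q c [a aA e]].
  by exists 0; rewrite ?rpred0 // /int_eval rmorph0 !horner0 subrr mulr0.
exists (a * x + int_eval q y); first by rewrite rpredD ?rpredM ?int_eval_Aint.
rewrite !int_evalD !int_evalM !int_evalX !int_evalC mulrDr mulrA -e; ring.
Qed.

Lemma dickson_eval n z w : z * w = 1 ->
  int_eval (dickson n) (z + w) = z ^+ n + w ^+ n.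
Proof.
move=> zw1; suff [] : int_eval (dickson n) (z + w) = z ^+ n + w ^+ n /\
  int_eval (dickson n.+1) (z + w) = z ^+ n.+1 + w ^+ n.+1 by [].
elim: n => [|n [IH0 IH1]]; first by rewrite !expr0 !expr1 int_evalC int_evalX.
split=> //; rewrite dicksonSS int_evalD int_evalM int_evalX IH1.
have -> : int_eval (- dickson n) (z + w) = - (z ^+ n + w ^+ n).
  by rewrite /int_eval rmorphN hornerN -IH0.
rewrite !exprS; ring: zw1.
Qed.

Section DicksonPrime.

Variable p : nat.
Hypothesis p_pr : prime p.

Lemma dickson_prime_eval : exists q, forall x,
  int_eval (dickson p) x = x ^+ p + p%:R * int_eval q x.
Proof.
have [q ->] := dickson_prime p_pr; exists q => x; rewrite int_evalD.
rewrite -mul_polyC int_evalM int_evalC rmorph_nat; congr (_ + _).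
by rewrite /int_eval map_polyXn hornerXn.
Qed.

Lemma dickson_mod x : x \in Aint ->
  exists2 a, a \in Aint & int_eval (dickson p) x = x ^+ p + p%:R * a.
Proof.
by have [q E] := dickson_prime_eval; exists (int_eval q x); rewrite ?int_eval_Aint.
Qed.

Lemma dickson_sub x y : x \in Aint -> y \in Aint ->
  exists2 a, a \in Aint & int_eval (dickson p) x - int_eval (dickson p) y =
    (x - y) ^+ p + p%:R * (x - y) * a.
Proof.
move=> xA yA; have [q E] := dickson_prime_eval.
have [a aA e] := int_eval_sub q xA yA.
have wA : x - y \in Aint by rewrite rpredB.
have [b bA f] := prime_exprD p_pr wA yA.
exists (y * b + a); first by rewrite rpredD ?rpredM.
rewrite !E -{1}[x](subrK y) f (_ : int_eval q x = int_eval q y + (x - y) * a).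
  ring.
by rewrite -e addrC subrK.
Qed.

End DicksonPrime.

Lemma Aint_exp (x : algC) n : (0 < n)%N -> x ^+ n \in Aint -> x \in Aint.
Proof.
move=> n0 xnA; apply: (@root_monic_Aint (minCpoly (x ^+ n) \Po 'X^n)).
- by rewrite /root horner_comp hornerXn; apply: root_minCpoly.
- rewrite monicE lead_coef_comp ?size_polyXn ?ltnS //.
  by rewrite (monicP (monicXn _ n)) expr1n mulr1 -monicE minCpoly_monic.
by rewrite polyOver_comp // ?rpredX ?polyOverX.
Qed.

Lemma int_norm_ge1 (x : algC) : x \is a Num.int -> x != 0 -> 1 <= `|x|.
Proof. exact: norm_intr_ge1. Qed.

Lemma pow_17_6_ge n : (5 <= n)%N -> (n * 6 * 6 ^ n <= 17 ^ n)%N.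
Proof.
elim: n => // n IHn; rewrite leq_eqVlt => /orP[/eqP <-|]; first by rewrite !expnS; lia.
by rewrite ltnS => n5; have := IHn n5; rewrite !expnS; nia.
Qed.

Section NormBound.

Variables (gT : finGroupType) (K : algC -> Prop).
Variables (nu : gT -> {rmorphism algC -> algC}).
Hypothesis KA : abelian_field K nu.
Local Notation O := (integral_in K).
Local Notation d := #|gT|.

Variables (beta s : algC) (p : nat).
Hypotheses (Obeta : O beta) (s1 : 1 < s) (betaE : beta = s + s^-1).
Hypothesis faithful : forall g : gT, nu g beta = beta -> g = 1%g.
Hypothesis circle : forall g : gT, g != 1%g ->
  exists2 z : algC, `|z| = 1 & nu g beta = z + z^-1.
Hypotheses (p_pr : prime p) (d_ge2 : (2 <= d)%N).

Let s0 : s != 0. Proof. by rewrite gt_eqF // (lt_trans ltr01). Qed.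
Local Notation T := (int_eval (dickson p)).

Let Tg (g : gT) : algC := `|T (nu g beta)|.

Lemma dickson_circle_le g : g != 1%g -> Tg g <= 2.
Proof.
move=> /circle[z z1 E]; have z0 : z != 0 by rewrite -normr_gt0 z1.
rewrite /Tg E dickson_eval ?mulfV // (le_trans (ler_normD _ _)) //.
by rewrite !normrX normfV z1 invr1 expr1n.
Qed.

Lemma conj_circle_le g : g != 1%g -> `|nu g beta| <= 2.
Proof.
move=> /circle[z z1 E]; rewrite E (le_trans (ler_normD _ _)) //.
by rewrite normfV z1 invr1.
Qed.

Lemma dickson_perron : Tg 1%g = s ^+ p + s^-1 ^+ p.
Proof.
have sV0 : 0 < s^-1 by rewrite invr_gt0 (lt_trans ltr01).
rewrite /Tg (abf_gal1 KA); last by case: Obeta.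
rewrite betaE dickson_eval ?mulfV // ger0_norm // addr_ge0 ?exprn_ge0 //.
  by rewrite ltW // (lt_trans ltr01).
exact: ltW.
Qed.

Lemma dickson_perron_gt2 : 2 < Tg 1%g.
Proof.
rewrite dickson_perron exprVn.
have sp1 : 1 < s ^+ p by rewrite exprn_egt1 // -lt0n prime_gt0.
have sp0 : 0 < s ^+ p by apply: lt_trans sp1.
have -> : 2 = (2 * s ^+ p) / s ^+ p by rewrite mulfK // gt_eqF.
rewrite -[ltRHS](mulfK (lt0r_neq0 sp0)) ltr_pM2r ?invr_gt0 // -subr_gt0.
have -> : (s ^+ p + (s ^+ p)^-1) * s ^+ p - 2 * s ^+ p = (s ^+ p - 1) ^+ 2.
  by field; rewrite gt_eqF.
by rewrite exprn_gt0 // subr_gt0.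
Qed.

Definition perron_bound : algC := s ^+ p + s^-1 ^+ p + 4%:R.

Lemma int_in_eval q x : O x -> O (int_eval q x).
Proof.
move=> Ox; elim/poly_ind: q => [|q c IHq].
  by rewrite /int_eval rmorph0 horner0; exact: int_in0 KA.
rewrite int_evalD int_evalM int_evalX int_evalC; apply: (int_inD KA).
  exact: (int_inM KA).
case: c => n; first exact: (int_in_nat KA).
by rewrite NegzE mulrNz; apply/(int_inN KA)/(int_in_nat KA).
Qed.

Lemma prod_conj_le (f : gT -> algC) (h : gT) (B C : algC) :
  (forall g, 0 <= f g) -> h != 1%g -> 0 <= B -> 0 <= C ->
  f 1%g <= B -> f h <= C -> (forall g, g != 1%g -> g != h -> f g <= 4%:R) ->
  \prod_g f g <= B * C * 4%:R ^+ (d - 2).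
Proof.
move=> f0 h1 B0 C0 fB fC f4; rewrite (bigD1 1%g) //= (bigD1 h) //= mulrA.
apply: ler_pM; rewrite ?mulr_ge0 ?prodr_ge0 //; first exact: ler_pM.
apply: (@le_trans _ _ (\prod_(g | (g != 1%g) && (g != h)) 4%:R)).
  by apply: ler_prod => g /andP[g1 gh]; rewrite f0 f4.
rewrite prodr_const; suff -> : #|[pred g | (g != 1%g) && (g != h)]| = (d - 2)%N by [].
have := cardC (mem [:: 1%g; h]); rewrite (@card_uniqP _ [:: 1%g; h] _) /=; last first.
  by rewrite inE eq_sym h1.
move=> <-; rewrite addKn; apply: eq_card => g.
by rewrite !inE /in_mem /= orbF negb_or.
Qed.

Let p0 : p%:R != 0 :> algC.
Proof. by rewrite pnatr_eq0 -lt0n prime_gt0. Qed.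

Lemma beta_norm : `|nu 1%g beta| = s + s^-1.
Proof.
have sV0 : 0 < s^-1 by rewrite invr_gt0 (lt_trans ltr01).
rewrite (abf_gal1 KA); last by case: Obeta.
by rewrite betaE ger0_norm // addr_ge0 // ltW // (lt_trans ltr01).
Qed.

Lemma norm_lower c m : O c -> c != 0 ->
  (\prod_g nu g c) / p%:R ^+ m \in Aint -> p%:R ^+ m <= \prod_g `|nu g c|.
Proof.
move=> Oc c0 NA; have pm0 : p%:R ^+ m != 0 :> algC by rewrite expf_neq0.
have : (\prod_g nu g c) / p%:R ^+ m \is a Num.int.
  apply: (Cint_rat_Aint _ NA); rewrite rpred_div ?rpredX ?rpred_nat //.
  exact/rpred_int_num/(gal_norm_int KA).
have N0 : (\prod_g nu g c) / p%:R ^+ m != 0.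
  by rewrite mulf_neq0 ?invr_eq0 //; apply/prodf_neq0 => g _; rewrite fmorph_eq0.
move=> /int_norm_ge1 /(_ N0); rewrite normrM normfV normrX normr_nat -normr_prod.
by rewrite ler_pdivlMr ?mul1r // lt0r pm0 exprn_ge0 ?ler0n.
Qed.

Lemma dickson_perron_gt_beta : s + s^-1 < Tg 1%g.
Proof.
have sgt0 : 0 < s by apply: lt_trans s1.
rewrite dickson_perron -subr_gt0; case: p p_pr => [|[|n]] // _.
have -> : s ^+ n.+2 + s^-1 ^+ n.+2 - (s + s^-1) = (s ^+ n.+1 - 1) * (s - s^-1 ^+ n.+2).
  by rewrite exprVn !exprS; field; rewrite expf_neq0.
have sV1 : s^-1 < 1 by rewrite invf_lt1.
have sV0 : 0 < s^-1 by rewrite invr_gt0.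
rewrite mulr_gt0 ?subr_gt0 ?exprn_egt1 //; apply: lt_trans s1.
by rewrite exprn_ilt1 // ltW.
Qed.

Lemma conj_le g : s + s^-1 <= 4%:R -> `|nu g beta| <= 4%:R.
Proof.
move=> s4; have [->|g1] := eqVneq g 1%g; first by rewrite beta_norm.
by apply: (le_trans (conj_circle_le g1)); rewrite ler_nat.
Qed.

Lemma unramified_norm_bound M phi : prime_over p M -> s + s^-1 <= 4%:R ->
  (forall y, O y -> M (nu phi y - y ^+ p)) ->
  (forall y, O y -> (forall g, M (nu g y)) -> y / p%:R \in Aint) ->
  p%:R ^+ d <= perron_bound * 6%:R * 4%:R ^+ (d - 2).
Proof.
move=> PM s4 frob rad; pose c := T beta - nu phi beta.
have Oc : O c by apply: (int_inB KA); [apply: int_in_eval | apply: (int_in_gal KA)].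
have [Kb bA] := Obeta.
have cpA g : nu g c / p%:R \in Aint.
  suff : c / p%:R \in Aint.
    by rewrite -(Aint_aut (nu g)) rmorphM fmorphV rmorph_nat.
  have [a aA E] := dickson_mod p_pr bA.
  have -> : c / p%:R = a - (nu phi beta - beta ^+ p) / p%:R.
    by rewrite /c E; field.
  rewrite rpredB //; apply: rad.
    by apply: (int_inB KA); [apply: (int_in_gal KA) | apply: (int_inX KA)].
  move=> g'; rewrite rmorphB rmorphXn /= (abf_galC KA) //.
  exact/frob/(int_in_gal KA).
have c0 : c != 0.
  rewrite subr_eq0; apply/eqP => E; have := congr1 Num.norm E.
  rewrite -[X in T X](abf_gal1 KA Kb) -/(Tg 1%g) => E1.
  have [phi1|phi1] := eqVneq phi 1%g.
    by have := dickson_perron_gt_beta; rewrite E1 phi1 beta_norm ltxx.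
  by have := dickson_perron_gt2; rewrite E1 => /lt_geF; rewrite conj_circle_le.
apply: (@le_trans _ _ (\prod_g `|nu g c|)).
  apply: norm_lower => //; rewrite -(prodr_const gT) -prodf_div.
  exact: rpred_prod.
have fle g : `|nu g c| <= Tg g + `|nu (phi * g)%g beta|.
  by rewrite rmorphB /= int_eval_aut -(abf_galM KA) // ler_normB.
have Tpos : 0 <= Tg 1%g by exact: normr_ge0.
have bound1 : Tg 1%g + 4%:R = perron_bound by rewrite dickson_perron.
have other g : g != 1%g -> (phi * g != 1)%g -> `|nu g c| <= 4%:R.
  move=> g1 pg1; apply: le_trans (fle g) _; rewrite -[4%:R]/((2 + 2)%N%:R) natrD.
  by apply: lerD; [exact: dickson_circle_le | exact: conj_circle_le].
have [h [h1 hle ho]] : exists h, [/\ h != 1%g, `|nu h c| <= 6%:R &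
    forall g, g != 1%g -> g != h -> `|nu g c| <= 4%:R].
  have [phi1|phi1] := eqVneq phi 1%g; last first.
    exists phi^-1%g; split; first by rewrite invg_eq1.
      apply: le_trans (fle _) _; rewrite mulgV -[6%:R]/((2 + 4)%N%:R) natrD.
      by apply: lerD; [rewrite dickson_circle_le ?invg_eq1 | exact: conj_le].
    by move=> g g1 gp; apply: other => //; rewrite -eq_invg_mul eq_sym.
  have [h h1] : exists h : gT, h != 1%g.
    by apply/existsP; rewrite -negb_forall; apply: contraTN d_ge2 => /forallP all1;
    rewrite -ltnNge ltnS -(cards1 (1%g : gT)) -cardsT subset_leq_card //; apply/subsetP=> x _; rewrite inE.
  exists h; split=> // [|g g1 _]; last by apply: other; rewrite // phi1 mul1g.
  by apply: (le_trans (other _ _ _)); rewrite ?ler_nat // phi1 mul1g.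
apply: (prod_conj_le (h := h)) => //.
- by rewrite -bound1 addr_ge0.
- by rewrite -bound1; apply: (le_trans (fle _)); rewrite lerD2l mulg1 conj_le.
Qed.

Lemma ramified_norm_bound M sigma : prime_over p M -> sigma != 1%g ->
  inert_at K nu M sigma ->
  p%:R ^+ minn d.+1 p <= perron_bound ^+ 2 * 4%:R ^+ (d - 2).
Proof.
move=> PM sig1 inert; have [Kb bA] := Obeta; have [Ksb sbA] := int_in_gal KA sigma Obeta.
have d0 : (0 < d)%N by apply: ltn_trans d_ge2.
pose c := T beta - T (nu sigma beta); pose m := minn d.+1 p.
have Oc : O c by apply: (int_inB KA); apply: int_in_eval => //; apply: (int_in_gal KA).
pose r : algC := d.-root p%:R.
have rd : r ^+ d = p%:R by rewrite rootCK.
have r0 : r != 0 by rewrite rootC_eq0.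
have rA : r \in Aint by apply: (Aint_exp d0); rewrite rd (Aint_int p%:Z).
have cA g : nu g c / r ^+ m \in Aint.
  pose w := nu g (beta - nu sigma beta).
  have Od : O (beta - nu sigma beta).
    by apply: (int_inB KA) => //; apply: (int_in_gal KA).
  have Ow : O w by apply: (int_in_gal KA).
  have [q qA E] := dickson_sub p_pr (proj2 (int_in_gal KA g Obeta))
    (proj2 (int_in_gal KA g (int_in_gal KA sigma Obeta))).
  have {}E : nu g c = w ^+ p + p%:R * w * q.
    by rewrite /w !rmorphB /= !int_eval_aut E.
  have wA : w / r \in Aint.
    apply: (Aint_exp d0); rewrite expr_div_n rd; apply: (gal_radical_exp KA p_pr PM) => // h.
    rewrite -(abf_galM KA); last by case: Od.
    rewrite rmorphB /= (abf_galC KA) // -opprB; apply: (idealN (prime_ideal_of PM)).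
    by apply: inert; apply: (int_in_gal KA).
  have -> : nu g c / r ^+ m = (w / r) ^+ p * r ^+ (p - m) + (w / r) * q * r ^+ (d.+1 - m).
    have e1 : r ^+ p = r ^+ (p - m) * r ^+ m by rewrite -exprD subnK // geq_minr.
    have e2 : p%:R * r = r ^+ (d.+1 - m) * r ^+ m.
      by rewrite -exprD subnK ?geq_minl // exprSr rd.
    have wE : w = w / r * r by rewrite divfK.
    rewrite E {1 2}wE exprMn e1 [p%:R * _]mulrCA e2; field.
    by rewrite r0 expf_neq0.
  have wqA : w / r * q \in Aint by apply: rpredM.
  by apply: rpredD; apply: rpredM => //; apply: rpredX.
have c0 : c != 0.
  rewrite subr_eq0; apply/eqP => E; have := congr1 Num.norm E.
  rewrite -[X in T X](abf_gal1 KA Kb) -/(Tg 1%g) => E1.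
  by have := dickson_perron_gt2; rewrite E1 => /lt_geF; rewrite dickson_circle_le.
apply: (@le_trans _ _ (\prod_g `|nu g c|)).
  apply: norm_lower => //; rewrite -rd -exprM mulnC exprM -(prodr_const gT) -prodf_div.
  exact: rpred_prod.
have fle g : `|nu g c| <= Tg g + Tg (sigma * g)%g.
  by rewrite rmorphB /= !int_eval_aut /Tg (abf_galM KA) // ler_normB.
have bound1 : Tg 1%g + 2 <= perron_bound.
  by rewrite /perron_bound dickson_perron lerD2l ler_nat.
have bound0 : 0 <= perron_bound by apply: le_trans bound1; rewrite addr_ge0 // /Tg.
apply: (prod_conj_le (h := sigma^-1%g)) => //.
- by rewrite invg_eq1.
- apply: (le_trans (fle _)); apply: (le_trans _ bound1).
  by rewrite lerD2l mulg1 dickson_circle_le.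
- apply: (le_trans (fle _)); apply: (le_trans _ bound1); rewrite mulgV addrC.
  by rewrite lerD2l dickson_circle_le ?invg_eq1.
move=> g g1 gs; apply: (le_trans (fle _)); rewrite -[4%:R]/((2 + 2)%N%:R) natrD.
by apply: lerD; apply: dickson_circle_le; rewrite // -eq_invg_mul eq_sym.
Qed.

Lemma perron_norm_bound : (5 <= p)%N -> 6%:R * s < 17%:R ->
  (36 ^ p * p ^ minn d.+1 p <= 4 ^ (d - 2) * (17 ^ p + 5 * 6 ^ p) ^ 2)%N.
Proof.
move=> p5 s17; have sgt0 : 0 < s by apply: lt_trans s1.
have s176 : s <= 17%:R / 6%:R.
  by rewrite ler_pdivlMr ?ltr0n // mulrC ltW.
have sV1 : s^-1 <= 1 by rewrite invf_le1 // ltW.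
have sV0 : 0 <= s^-1 by rewrite invr_ge0 ltW.
have s4 : s + s^-1 <= 4%:R.
  rewrite -[4%:R]/((3 + 1)%N%:R) natrD; apply: lerD => //.
  by apply: le_trans s176 _; rewrite ler_pdivrMr ?ltr0n // -natrM ler_nat.
pose B : algC := (17%:R ^+ p + 5%:R * 6%:R ^+ p) / 6%:R ^+ p.
have six0 : 6%:R ^+ p != 0 :> algC by rewrite expf_neq0 // pnatr_eq0.
have bB : perron_bound <= B.
  rewrite /B mulrDl mulfK // -expr_div_n /perron_bound -addrA.
  apply: lerD; first by rewrite lerXn2r // nnegrE ?divr_ge0 ?ler0n // ltW.
  rewrite -[5%:R]/((1 + 4)%N%:R) natrD lerD2r.
  by rewrite exprn_ile1.
have b0 : 0 <= perron_bound.
  by rewrite /perron_bound !addr_ge0 ?exprn_ge0 ?ler0n // ltW.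
have main : p%:R ^+ minn d.+1 p <= B ^+ 2 * 4%:R ^+ (d - 2).
  have [M PM] := prime_over_exists p_pr.
  case: (classic (exists2 g, g != 1%g & inert_at K nu M g)) => [[g g1 ig]|nex].
    apply: (le_trans (ramified_norm_bound PM g1 ig)).
    rewrite ler_wpM2r ?exprn_ge0 ?ler0n // lerXn2r // nnegrE //.
    exact: le_trans bB.
  have ni g : g != 1%g -> ~ inert_at K nu M g by move=> g1 ig; apply: nex; exists g.
  have [phi frob] := frobenius_exists KA p_pr PM ni.
  have := unramified_norm_bound PM s4 frob (unramified_radical KA p_pr PM ni).
  move=> h; apply: (@le_trans _ _ (p%:R ^+ d.+1)).
    by rewrite -!natrX ler_nat leq_pexp2l ?prime_gt0 // geq_minl.
  rewrite exprS; apply: (@le_trans _ _ (p%:R * (perron_bound * 6%:R * 4%:R ^+ (d - 2)))).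
    by rewrite ler_wpM2l ?ler0n.
  rewrite mulrA ler_wpM2r ?exprn_ge0 ?ler0n // mulrCA.
  apply: ler_pM => //; first by rewrite mulr_ge0 ?ler0n.
  rewrite /B ler_pdivlMr ?exprn_gt0 ?ltr0n // -!natrX -!natrM -natrD ler_nat.
  exact: leq_trans (pow_17_6_ge p5) (leq_addr _ _).
move: main; rewrite /B expr_div_n mulrAC ler_pdivlMr ?exprn_gt0 ?ltr0n //.
rewrite -!natrX -!natrM -natrD -natrX -natrM ler_nat -expnM [(p * 2)%N]mulnC expnM.
by rewrite mulnC [X in (_ <= X)%N]mulnC.
Qed.

End NormBound.

Section DegreeArithmetic.
Local Open Scope nat_scope.

Lemma central_bin_lower n : (0 < n)%N -> (4 ^ n <= 2 * n * 'C(2 * n, n))%N.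
Proof.
elim: n => // n IHn _; have [->|n0] := posnP n; first by [].
have e1 := mul_bin_diag (2 * n).+1 n; have e2 := binS (2 * n).+1 n.
have e3 : 'C((2 * n).+1, n) = 'C((2 * n).+1, n.+1).
  by rewrite -[LHS]bin_sub; [congr 'C(_, _); lia | lia].
have -> : (2 * n.+1 = (2 * n).+2)%N by lia.
by have := IHn n0; rewrite /= in e1; rewrite e2 e3 expnS; nia.
Qed.

Lemma pfactor_central_bin p n : prime p -> (0 < n)%N ->
  (p ^ logn p 'C(2 * n, n) <= 2 * n)%N.
Proof.
move=> p_pr n0; have p1 := prime_gt1 p_pr.
pose t := trunc_log p (2 * n).
suff h : (logn p 'C(2 * n, n) <= t)%N.
  by apply: leq_trans (trunc_logP p1 _); rewrite ?muln_gt0 // leq_pexp2l // ltnW.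
have C0 : (0 < 'C(2 * n, n))%N by rewrite bin_gt0; lia.
have := congr1 (logn p) (@bin_fact (2 * n) n (leq_pmull n (ltn0Sn 1))).
have -> : (2 * n - n = n)%N by lia.
rewrite !lognM ?muln_gt0 ?fact_gt0 // !logn_fact //.
have -> : (\sum_(1 <= k < n.+1) n %/ p ^ k = \sum_(1 <= k < (2 * n).+1) n %/ p ^ k)%N.
  rewrite [RHS](big_cat_nat (n := n.+1)) //=; last by lia.
  rewrite -[LHS]addn0; congr (_ + _)%N; rewrite big_nat_cond big1 // => k.
  case/andP=> /andP[nk _] _.
  by rewrite divn_small // (leq_trans nk) // ltnW // ltn_expl.
have le1 : (\sum_(1 <= k < (2 * n).+1) 2 * n %/ p ^ k <=
    \sum_(1 <= k < (2 * n).+1) (2 * (n %/ p ^ k) + (k <= t)))%N.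
  apply: leq_sum => k _; have q0 : (0 < p ^ k)%N by rewrite expn_gt0 ltnW.
  have [kt|tk] := leqP k t.
    rewrite -ltnS ltn_divLR //.
    by have := divn_eq n (p ^ k); have := ltn_pmod n q0; nia.
  rewrite divn_small //; apply: leq_trans (trunc_log_ltn _ p1) _.
  by rewrite leq_exp2l.
have le2 : (\sum_(1 <= k < (2 * n).+1) (k <= t) <= t)%N.
  rewrite big_add1 /=; elim: (2 * n)%N => [|m IHm]; first by rewrite big_geq.
  rewrite big_nat_recr //=; have [mt|tm] := leqP m.+1 t; last by rewrite addn0.
  suff : (\sum_(0 <= i < m) (i < t) <= m)%N by lia.
  by rewrite -[leqRHS]subn0 -[leqRHS]muln1 -sum_nat_const_nat; apply: leq_sum => i _; case: (_ < _)%N.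
move: le1; rewrite big_split /= -big_distrr /=; lia.
Qed.

Lemma half_prime_count n :
  (\sum_(0 <= q < n.+1) prime q <= n./2.+1)%N.
Proof.
have pair m : (\sum_(0 <= q < (2 * m).+2) prime q <= m.+1)%N.
  elim: m => [|[|m] IHm]; [by rewrite !big_nat_recr //= big_geq..|].
  have -> : ((2 * m.+2).+2 = (2 * m.+1).+4)%N by lia.
  rewrite big_nat_recr // big_nat_recr //=; suff -> : prime (2 * m.+1).+2 = false.
    by case: (prime _) IHm; lia.
  apply/negbTE/negP => /even_prime [|]; first by lia.
  by rewrite mul2n /= negbK odd_double.
apply: leq_trans (pair n./2); have := odd_double_half n => nE.
rewrite [leqRHS](big_cat_nat (n := n.+1)) ?leq_addr //=; case: (odd n) nE => /=; lia.
Qed.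

Lemma prime_supply n x : (0 < n)%N -> (2 * n) ^ (x./2 + 2) < 4 ^ n ->
  exists2 p, prime p & (x < p <= 2 * n)%N.
Proof.
move=> n0 lt4; pose C := 'C(2 * n, n).
have C0 : (0 < C)%N by rewrite bin_gt0; lia.
suff /hasP[p _ /andP[p_pr px]] : has (fun p => prime p && (x < p <= 2 * n)) (iota 0 C.+1).
  by exists p.
apply: contraLR lt4 => /hasPn nop; rewrite -leqNgt.
apply: leq_trans (central_bin_lower n0) _; rewrite addn2 expnS leq_mul2l.
apply/orP; right; rewrite -/C.
have le1 : (C <= \prod_(0 <= p < C.+1) (2 * n) ^ (prime p && (p <= x)))%N.
  rewrite -{1}(partnT C0) /partn [leqLHS]big_nat_cond [leqRHS]big_nat_cond.
  rewrite (eq_bigl (fun p => (0 <= p < C.+1) && true)); last by [].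
  apply: leq_prod => p /andP[/andP[_ pC] _].
  have := nop p; rewrite mem_iota add0n pC => /(_ isT).
  have [p_pr|np] := boolP (prime p); last by rewrite lognE (negbTE np).
  rewrite /= negb_and -leqNgt -ltnNge; have pfac := pfactor_central_bin p_pr n0.
  have [px|xp] := leqP p x; first by rewrite expn1.
  rewrite /= => np2; case: (posnP (logn p C)) => [-> //|l0].
  suff : (p <= 2 * n)%N by rewrite leqNgt np2.
  by apply: leq_trans pfac; rewrite -[leqLHS]expn1; apply: leq_pexp2l => //; apply: prime_gt0.
apply: (leq_trans le1); rewrite -expn_sum leq_pexp2l ?muln_gt0 //.
apply: leq_trans (half_prime_count x).
apply: (@leq_trans (\sum_(0 <= p < x.+1 + C.+1) (prime p && (p <= x)))).
  by rewrite addnC [leqRHS](big_cat_nat (n := C.+1)) ?leq_addr.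
rewrite (big_cat_nat (n := x.+1)) ?leq_addr //= [X in (_ + X)%N]big_nat_cond.
rewrite [X in (_ + X)%N]big1 ?addn0; last first.
  by move=> p /andP[/andP[xp _] _]; rewrite [(p <= x)%N]leqNgt xp andbF.
by apply: leq_sum => p _; case: (prime p); case: (p <= x)%N.
Qed.

Lemma leq_exp2r_weak m n e : m <= n -> m ^ e <= n ^ e.
Proof. by case: e => // e mn; rewrite leq_exp2r. Qed.

Lemma pow_18_ge n : 4 <= n -> 17 ^ n + 5 * 6 ^ n <= 18 ^ n.
Proof.
elim: n => // n IHn; rewrite leq_eqVlt => /orP[/eqP <-|]; first by rewrite !expnS; lia.
by rewrite ltnS => n4; have := IHn n4; rewrite !expnS; lia.
Qed.

Lemma pow_2_ge k : 4 <= k -> k * (4 * 9 ^ k.+1 * k.+1) <= 2 ^ (6 * k - 1).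
Proof.
elim: k => // k IHk; rewrite leq_eqVlt => /orP[/eqP <-|]; first by rewrite !expnS; lia.
rewrite ltnS => k4; have -> : 6 * k.+1 - 1 = 6 + (6 * k - 1) by lia.
rewrite expnD; apply: (@leq_trans (2 ^ 6 * (k * (4 * 9 ^ k.+1 * k.+1)))); last first.
  by rewrite leq_mul2l IHk.
rewrite [9 ^ k.+2]expnS; move: (9 ^ k.+1) => X; rewrite (_ : 2 ^ 6 = 64) //; nia.
Qed.

Lemma to_nat_pow (m n : BinNums.N) : BinNat.N.to_nat (BinNat.N.pow m n) = BinNat.N.to_nat m ^ BinNat.N.to_nat n.
Proof.
rewrite Nnat.N2Nat.inj_pow; elim: (BinNat.N.to_nat n) => //= k ->.
by rewrite expnS.
Qed.

Lemma to_nat_ltb (m n : BinNums.N) : BinNat.N.ltb m n -> BinNat.N.to_nat m < BinNat.N.to_nat n.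
Proof. by move/BinNat.N.ltb_lt; lia. Qed.

Definition window_check (p lo hi : nat) : bool :=
  let: (c, mul, pow) := (BinNat.N.of_nat, BinNat.N.mul, BinNat.N.pow) in
  let B := pow (BinNat.N.add (pow (c 17) (c p)) (mul (c 5) (pow (c 6) (c p)))) (c 2) in
  let U := pow (c 36) (c p) in
  BinNat.N.ltb (mul (pow (c 4) (c (lo - 2))) B) (mul U (pow (c p) (c lo.+1))) &&
  BinNat.N.ltb (mul (pow (c 4) (c (hi - 2))) B) (mul U (pow (c p) (c p))).

Lemma window_checkP p lo hi : window_check p lo hi ->
  4 ^ (lo - 2) * (17 ^ p + 5 * 6 ^ p) ^ 2 < 36 ^ p * p ^ lo.+1 /\
  4 ^ (hi - 2) * (17 ^ p + 5 * 6 ^ p) ^ 2 < 36 ^ p * p ^ p.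
Proof.
case/andP=> /to_nat_ltb h1 /to_nat_ltb h2; move: h1 h2.
by rewrite !(Nnat.N2Nat.inj_mul, to_nat_pow, Nnat.N2Nat.inj_add, Nnat.Nat2N.id).
Qed.

Section DegreeBound.

Variable d : nat.
Hypothesis norm_bound : forall p, prime p -> (5 <= p)%N ->
  36 ^ p * p ^ minn d.+1 p <= 4 ^ (d - 2) * (17 ^ p + 5 * 6 ^ p) ^ 2.

Lemma degree_window p lo hi : prime p -> 5 <= p -> 2 <= lo -> lo < p <= hi.+1 ->
  4 ^ (lo - 2) * (17 ^ p + 5 * 6 ^ p) ^ 2 < 36 ^ p * p ^ lo.+1 ->
  4 ^ (hi - 2) * (17 ^ p + 5 * 6 ^ p) ^ 2 < 36 ^ p * p ^ p ->
  ~~ (lo <= d <= hi).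
Proof.
move=> p_pr p5 lo2 /andP[lop phi] ltlo lthi; apply/negP => /andP[lod dhi].
have := norm_bound p_pr p5; rewrite leqNgt => /negP; apply.
set B := (_ ^ 2)%N in ltlo lthi *; have [pd|dp] := leqP p d.+1.
  apply: leq_ltn_trans lthi; rewrite leq_mul2r; apply/orP; right.
  by apply: leq_pexp2l => //; apply: leq_sub2r.
have -> : d - 2 = (lo - 2) + (d - lo) by lia.
have -> : d.+1 = lo.+1 + (d - lo) by lia.
rewrite !expnD mulnAC [ltnRHS]mulnA.
apply: (@leq_trans (36 ^ p * p ^ lo.+1 * 4 ^ (d - lo))).
  by rewrite ltn_mul2r expn_gt0 /=.
by rewrite leq_mul2l leq_exp2r_weak ?orbT // ltnW.
Qed.

Lemma degree_wide_window p k : prime p -> 2 <= k -> 4 * 9 ^ k <= p ->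
  2 <= d -> ~~ ((p <= k * d) && (d <= k * p)).
Proof.
move=> p_pr k2 kp d2; apply/negP => /andP[pkd dkp].
have p4 : 4 <= p.
  by apply: leq_trans kp; rewrite -{1}[4]muln1 leq_mul2l expn_gt0.
have p5 : 5 <= p by rewrite ltn_neqAle p4 andbT; apply: contraTneq p_pr => <-.
have p0 : 0 < p by apply: leq_trans p4.
have h : 36 ^ p * p ^ minn d.+1 p <= 36 ^ p * (4 ^ (d - 2) * 9 ^ p).
  apply: leq_trans (norm_bound p_pr p5) _; rewrite mulnCA leq_mul2l -expnMn.
  apply/orP; right; rewrite (_ : 36 * 9 = 18 ^ 2) // expnAC.
  by apply: leq_exp2r_weak; apply: pow_18_ge.
have kpp : p <= k * p by rewrite leq_pmull // ltnW.
have {h} : p ^ minn d.+1 p <= 4 ^ (d - 2) * 9 ^ p.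
  by rewrite -(@leq_pmul2l (36 ^ p)) ?expn_gt0.
apply/negP; rewrite -ltnNge; have [pd|dp] := leqP p d.+1.
  apply: (@leq_trans ((4 * 9 ^ k) ^ p)); last exact: leq_exp2r_weak.
  rewrite expnMn -expnM (_ : k * p = p + (k * p - p)); last by lia.
  rewrite expnD mulnA; apply: (@leq_ltn_trans (4 ^ (k * p - 2) * 9 ^ p)).
    by rewrite leq_mul2r; apply/orP; right; apply: leq_pexp2l => //; lia.
  rewrite mulnAC ltn_mul2r expn_gt0 /=.
  rewrite (_ : k * p - 2 = (p - 2) + (k * p - p)); last by lia.
  rewrite expnD; apply: (@leq_trans (4 ^ p * 4 ^ (k * p - p))).
    rewrite ltn_mul2r expn_gt0 /=; rewrite ltn_exp2l //; lia.
  by rewrite leq_mul2l leq_exp2r_weak ?orbT.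
apply: (@leq_trans ((4 * 9 ^ k) ^ d.+1)); last exact: leq_exp2r_weak.
rewrite expnMn -expnM; apply: (@leq_ltn_trans (4 ^ (d - 2) * 9 ^ (k * d.+1))).
  rewrite leq_mul2l; apply/orP; right; apply: leq_pexp2l => //; nia.
rewrite ltn_mul2r expn_gt0 /=; rewrite ltn_exp2l //; lia.
Qed.

Lemma degree_large_k k : 4 <= k -> 4 * 9 ^ k * k <= d -> d < 4 * 9 ^ k.+1 * k.+1 ->
  False.
Proof.
move=> k4 dk kd; pose n := (k * d)./2; pose x := d %/ k.
have d100 : 100 * k <= d.
  apply: leq_trans dk; rewrite leq_mul2r; apply/orP; right.
  apply: (@leq_trans (4 * 9 ^ 4)); first by rewrite !expnS; lia.
  by rewrite leq_mul2l leq_pexp2l.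
have nE : k * d <= 2 * n + 1 /\ 2 * n <= k * d.
  by have := odd_double_half (k * d); rewrite -/n; case: (odd _) => /=; lia.
have xd : k * x <= d by rewrite mulnC leq_divM.
have n0 : 0 < n by nia.
have [p p_pr /andP[xp p2n]] : exists2 p, prime p & x < p <= 2 * n.
  apply: prime_supply => //; have n2 : 2 * n <= 2 ^ (6 * k - 1).
    apply: leq_trans (pow_2_ge k4); apply: leq_trans (proj2 nE) _.
    by have := ltnW kd; nia.
  apply: (@leq_ltn_trans ((2 ^ (6 * k - 1)) ^ (x./2 + 2))); first exact: leq_exp2r_weak.
  rewrite -expnM (_ : 4 = 2 ^ 2) // -expnM ltn_exp2l //.
  have := odd_double_half x; nia.
have kp : 4 * 9 ^ k <= p.
  apply: leq_trans (ltnW xp); rewrite leq_divRL //; lia.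
have d2 : 2 <= d by lia.
have := degree_wide_window p_pr (ltnW (ltnW k4)) kp d2; rewrite (leq_trans p2n (proj2 nE)) /=.
have := ltn_ceil d (ltnW (ltnW (ltnW k4))); rewrite -/x => dx /negP; apply.
by apply: ltnW (leq_trans dx _); rewrite mulnC leq_mul2l xp orbT.
Qed.

Lemma degree_le_27 : 2 <= d -> d <= 27.
Proof.
move=> d2; rewrite leqNgt; apply/negP => d28.
have small p lo hi : prime p -> 5 <= p -> 2 <= lo -> lo < p <= hi.+1 ->
    window_check p lo hi -> ~~ (lo <= d <= hi).
  by move=> p_pr p5 lo2 lp /window_checkP[]; apply: degree_window.
have w1 : ~~ (28 <= d <= 28) by apply: (small 29 28 28).
have w2 : ~~ (29 <= d <= 32) by apply: (small 31 29 32).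
have w3 : ~~ (33 <= d <= 42) by apply: (small 37 33 42).
have w4 : ~~ (36 <= d <= 50) by apply: (small 41 36 50).
have w5 : ~~ (45 <= d <= 61) by apply: (small 47 45 61).
have w6 : ~~ (58 <= d <= 86) by apply: (small 59 58 86).
have w7 : ~~ (82 <= d <= 141) by apply: (small 83 82 141); last by vm_compute.
have w8 : ~~ (138 <= d <= 287) by apply: (small 139 138 287); last by vm_compute.
have v1 := @degree_wide_window 331 2 isT isT isT d2.
have v2 := @degree_wide_window 1301 2 isT isT isT d2.
have v3 := @degree_wide_window (779 * 10 + 3) 3 isT isT isT d2.
have [p p_pr pE] : exists2 p, prime p & p = 700 * 100 + 1.
  by exists (700 * 100 + 1) => //; vm_compute.
have v4 : ~~ ((p <= 3 * d) && (d <= 3 * p)).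
  by apply: degree_wide_window => //; rewrite pE !expnS; lia.
have d4 : 4 * 9 ^ 4 * 4 <= d by move: v4; rewrite pE !expnS; lia.
have exk : exists k, 4 * 9 ^ k * k <= d by exists 4.
have kb k : 4 * 9 ^ k * k <= d -> k <= d.
  by apply: leq_trans; rewrite leq_pmull // muln_gt0 expn_gt0.
have [k kd kmax] := ex_maxnP exk kb.
apply: (degree_large_k (kmax 4 d4) kd); rewrite ltnNge; apply/negP => dk.
by have := kmax _ dk; rewrite ltnn.
Qed.

End DegreeBound.

End DegreeArithmetic.

(** * The spider polynomial *)

Definition spider_poly (A B : nat) : {poly int} :=
  ('X^3 - 1) * ('X^A + 1) * ('X^B + 1) - 'X * ('X + 1) * ('X^(A + B) - 1) *+ 2.

Definition spider_fun (A B : nat) (z : algC) : algC :=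
  (z ^+ 3 - 1) * (z ^+ A + 1) * (z ^+ B + 1) - 2 * z * (z + 1) * (z ^+ (A + B) - 1).

Lemma spider_polyE A B z : int_eval (spider_poly A B) z = spider_fun A B z.
Proof.
rewrite /spider_poly !(int_evalB, int_evalD, int_evalM, int_evalMn, int_eval1, int_evalXn).
by rewrite int_evalX /spider_fun; ring.
Qed.

Section Herglotz.

(* With z = e^(2iu), [cot_ratio n z] is sin(2u)/tan(nu) up to a constant, and the
   equation [spider_fun A B z = 0] is tan u + tan Au + tan Bu = 2 sin 2u. *)
Definition cot_ratio (n : nat) (z : algC) : algC :=
  (z - z^-1) * (z ^+ n + 1) / (z ^+ n - 1).

Definition cot_ratio2 (n : nat) (z : algC) : algC :=
  cot_ratio n z / (z + z^-1 + 2).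

Lemma off_circle_pow (z : algC) n : `|z| != 1 -> (0 < n)%N -> z ^+ n != 1 /\ z ^+ n != -1.
Proof.
move=> z1 n0; split; apply: contra_neq z1 => /(congr1 Num.norm).
  by rewrite normrX normr1 => /eqP; rewrite pexpr_eq1 // => /eqP.
by rewrite normrX normrN1 => /eqP; rewrite pexpr_eq1 // => /eqP.
Qed.

Variable z : algC.
Hypotheses (z0 : z != 0) (zc : `|z| != 1).

Let z1 : z - 1 != 0.
Proof. by rewrite subr_eq0; have [] := @off_circle_pow z 1 zc isT. Qed.
Let zN1 : z + 1 != 0.
Proof. by rewrite addr_eq0; have [] := @off_circle_pow z 1 zc isT. Qed.
Let pow1 n : (0 < n)%N -> z ^+ n - 1 != 0.
Proof. by move=> n0; rewrite subr_eq0; have [] := @off_circle_pow z n zc n0. Qed.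
Let powN1 n : (0 < n)%N -> z ^+ n + 1 != 0.
Proof. by move=> n0; rewrite addr_eq0; have [] := @off_circle_pow z n zc n0. Qed.

Lemma trace_add2 : z + z^-1 + 2 = (z + 1) ^+ 2 / z.
Proof. by field. Qed.

Lemma trace_add2_neq0 : z + z^-1 + 2 != 0.
Proof. by rewrite trace_add2 mulf_neq0 ?expf_neq0 ?invr_eq0. Qed.

Lemma cot_ratio1 : cot_ratio 1 z = z + z^-1 + 2.
Proof. by rewrite /cot_ratio expr1; field; rewrite z0 z1. Qed.

Lemma cot_ratio21 : cot_ratio2 1 z = 1.
Proof. by rewrite /cot_ratio2 cot_ratio1 divff ?trace_add2_neq0. Qed.

Lemma cot_ratioS n : (0 < n)%N ->
  cot_ratio n.+1 z = z + z^-1 + 2 - 4%:R / (1 + cot_ratio2 n z).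
Proof.
move=> n0; have := pow1 n0; have := @pow1 n.+1 isT; rewrite /cot_ratio2 /cot_ratio exprS trace_add2.
move: (z ^+ n) => X zX1 X1; field; rewrite z0 zN1 X1 zX1 ?andbT /=.
rewrite (_ : _ + _ = 2 * (z + 1) * (z * X - 1)); last by ring.
by rewrite !mulf_neq0 ?pnatr_eq0.
Qed.

Lemma cot_ratio2S n : (0 < n)%N ->
  cot_ratio2 n.+1 z = 1 - 4%:R / (cot_ratio n z + (z + z^-1 + 2)).
Proof.
move=> n0; have := pow1 n0; have := @pow1 n.+1 isT; rewrite /cot_ratio2 /cot_ratio exprS trace_add2.
move: (z ^+ n) => X zX1 X1; field; rewrite z0 zN1 X1 zX1 ?andbT /=.
rewrite (_ : _ + _ = 2 * (z + 1) * (z * X - 1)); last by ring.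
by rewrite !mulf_neq0 ?pnatr_eq0.
Qed.

Lemma spider_fun_cot A B : (0 < A)%N -> (0 < B)%N -> spider_fun A B z = 0 ->
  (cot_ratio 1 z)^-1 + (cot_ratio A z)^-1 + (cot_ratio B z)^-1 = 1.
Proof.
move=> A0 B0; have := pow1 A0; have := pow1 B0; have := powN1 A0; have := powN1 B0.
rewrite /spider_fun exprD /cot_ratio expr1.
move: (z ^+ A) (z ^+ B) => X Y hY hX hY1 hX1 e.
have zz1 : z * z - 1 != 0 by rewrite -expr2 subr_sqr_1 mulf_neq0.
transitivity (1 - ((z ^+ 3 - 1) * (X + 1) * (Y + 1) - 2 * z * (z + 1) * (X * Y - 1)) /
   (z * (z + 1) * (X + 1) * (Y + 1) * (z - z^-1))); last by rewrite e mul0r subr0.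
by field; rewrite zz1 hX hY hX1 hY1 z0 z1 zN1.
Qed.

End Herglotz.

Lemma Im_inv_lt0 (x : algC) : 0 < 'Im x -> 'Im x^-1 < 0.
Proof.
move=> ix; have x0 : x != 0 by apply: contraTneq ix => ->; rewrite raddf0 ltxx.
rewrite invC_norm ImMl; last by rewrite rpredV rpredX // normr_real.
rewrite Im_conj mulrN oppr_lt0 mulr_gt0 // invr_gt0 exprn_gt0 // normr_gt0.
by [].
Qed.

Lemma cot_ratio_Herglotz (z : algC) n : z != 0 -> `|z| != 1 -> 0 < 'Im (z + z^-1) ->
  0 < 'Im (cot_ratio n.+1 z) /\ 0 <= 'Im (cot_ratio2 n.+1 z).
Proof.
move=> z0 zc ib; have Im_nat k : 'Im (k%:R : algC) = 0 by apply/Creal_ImP/realn.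
have ib2 : 0 < 'Im (z + z^-1 + 2) by rewrite raddfD /= Im_nat addr0.
have Im_1 : 'Im (1 : algC) = 0 by apply/Creal_ImP/real1.
have Im_4V (x : algC) : 'Im (4%:R / x) = 4%:R * 'Im (x^-1) by rewrite ImMl ?realn.
elim: n => [|n [IH1 IH2]].
  by rewrite cot_ratio1 ?cot_ratio21 // Im_1.
rewrite (cot_ratioS z0 zc (ltn0Sn n)) (cot_ratio2S z0 zc (ltn0Sn n)) !raddfB /=.
rewrite !Im_4V Im_1 sub0r oppr_ge0; split; last first.
  by rewrite mulr_ge0_le0 ?ler0n // ltW // Im_inv_lt0 // raddfD addr_gt0.
have : 0 <= 'Im (1 + cot_ratio2 n.+1 z) by rewrite raddfD /= Im_1 add0r.
rewrite le_eqVlt eq_sym => /predU1P[/Creal_ImP i0|ilt].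
  have /Creal_ImP -> : (1 + cot_ratio2 n.+1 z)^-1 \is Num.real by rewrite realV.
  by rewrite mulr0 subr0.
by rewrite subr_gt0 (lt_trans _ ib2) // pmulr_rlt0 ?ltr0n // Im_inv_lt0.
Qed.

Lemma spider_root_trace_Im (z : algC) A B : (0 < A)%N -> (0 < B)%N -> z != 0 -> `|z| != 1 ->
  spider_fun A B z = 0 -> ~ 0 < 'Im (z + z^-1).
Proof.
case: A B => [|A] [|B] // _ _ z0 zc E0 ib.
have := congr1 (fun x => 'Im x) (spider_fun_cot z0 zc (ltn0Sn A) (ltn0Sn B) E0).
have gI n := Im_inv_lt0 (proj1 (cot_ratio_Herglotz n z0 zc ib)).
rewrite !raddfD /= (Creal_ImP 1 (real1 _)) => e.
have : 0 < - ('Im (cot_ratio 1 z)^-1 + 'Im (cot_ratio A.+1 z)^-1 + 'Im (cot_ratio B.+1 z)^-1).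
  by rewrite !opprD !addr_gt0 ?oppr_gt0.
by rewrite e oppr0 ltxx.
Qed.

Lemma spider_root_trace_real (z : algC) A B : (0 < A)%N -> (0 < B)%N -> z != 0 -> `|z| != 1 ->
  spider_fun A B z = 0 -> z + z^-1 \is Num.real.
Proof.
move=> A0 B0 z0 zc E0; apply/Creal_ImP/eqP.
have := Creal_Im (z + z^-1); rewrite realE => /orP[]; rewrite le_eqVlt => /predU1P[<- //|].
  by move/(spider_root_trace_Im A0 B0 z0 zc E0).
move=> i0; exfalso; apply: (@spider_root_trace_Im z^* A B) => //.
- by rewrite conjC_eq0.
- by rewrite norm_conjC.
- have := congr1 Num.conj E0; rewrite rmorph0 => <-.
  by rewrite /spider_fun !(rmorphB, rmorphD, rmorphM, rmorphXn, rmorph1, rmorph_nat).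
by rewrite -fmorphV -rmorphD Im_conj oppr_gt0.
Qed.

Lemma trace_real_off_circle (z : algC) : z != 0 -> `|z| != 1 ->
  z + z^-1 \is Num.real -> z \is Num.real.
Proof.
move=> z0 zc /CrealP; rewrite rmorphD fmorphV /= => e; apply/CrealP.
have zn1 : z * z^* != 1.
  rewrite -normCK; apply: contra zc; rewrite -{1}(expr1n _ 2) eqrXn2 ?normr_ge0 //.
have zc0 : z^* != 0 by rewrite conjC_eq0.
have : (z^* - z) * (z * z^* - 1) = 0.
  have -> : (z^* - z) * (z * z^* - 1) = z * z^* * (z^* + (z^*)^-1 - (z + z^-1)).
    by field; rewrite z0 zc0.
  by rewrite e subrr mulr0.
by move/eqP; rewrite mulf_eq0 !subr_eq0 (negPf zn1) orbF => /eqP.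
Qed.

Lemma trace_gt2 (z : algC) : 0 < z -> z != 1 -> 2 < z + z^-1.
Proof.
move=> zgt0 z1; rewrite -subr_gt0.
have -> : z + z^-1 - 2 = (z - 1) ^+ 2 / z by field; rewrite gt_eqF.
have zR : z - 1 \is Num.real by rewrite rpredB ?real1 // gtr0_real.
by rewrite divr_gt0 // -real_normK // exprn_gt0 // normr_gt0 subr_eq0.
Qed.

Lemma addr_lt0 (x y : algC) : x < 0 -> y < 0 -> x + y < 0.
Proof. by move=> x0 y0; rewrite -oppr_gt0 opprD addr_gt0 ?oppr_gt0. Qed.

Lemma spider_root_neg (z : algC) A B : (0 < A)%N -> (0 < B)%N -> z < 0 -> `|z| != 1 ->
  spider_fun A B z <> 0.
Proof.
case: A B => [|A] [|B] // _ _ zlt zc E0; have z0 : z != 0 by rewrite lt_eqF.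
have b0 : z + z^-1 + 2 < 0.
  have -> : z + z^-1 + 2 = 2 - (- z + (- z)^-1) by rewrite invrN; ring.
  rewrite subr_lt0 trace_gt2 ?oppr_gt0 //; apply: contraNneq zc => z1.
  by rewrite -normrN z1 normr1.
have g n : cot_ratio n.+1 z < 0 /\ 1 <= cot_ratio2 n.+1 z.
  elim: n => [|n [IH1 IH2]]; first by rewrite cot_ratio1 // cot_ratio21.
  rewrite (cot_ratioS z0 zc (ltn0Sn n)) (cot_ratio2S z0 zc (ltn0Sn n)).
  have d0 : 0 < 1 + cot_ratio2 n.+1 z by rewrite addr_gt0 // (lt_le_trans ltr01).
  split; first by rewrite subr_lt0 (lt_trans b0) // divr_gt0 ?ltr0n.
  by rewrite lerBrDl gerDr mulr_ge0_le0 ?ler0n // invr_le0 ltW // addr_lt0.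
have := spider_fun_cot z0 zc (ltn0Sn A) (ltn0Sn B) E0 => e.
have : (cot_ratio 1 z)^-1 + (cot_ratio A.+1 z)^-1 + (cot_ratio B.+1 z)^-1 < 0.
  by rewrite !addr_lt0 // invr_lt0; case: (g 0%N) (g A) (g B) => ? _ [? _] [? _].
by rewrite e ltr10.
Qed.

Lemma spider_root_pos_le (z s : algC) A B : (0 < A)%N -> (0 < B)%N ->
  0 < z -> 0 < s -> `|z| != 1 -> `|s| != 1 ->
  spider_fun A B z = 0 -> spider_fun A B s = 0 -> ~ z + z^-1 < s + s^-1.
Proof.
case: A B => [|A] [|B] // _ _ zgt sgt zc sc Ez Es lt_zs.
have [z0 s0] : z != 0 /\ s != 0 by rewrite !gt_eqF.
have bz : 4%:R < z + z^-1 + 2.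
  rewrite -[4%:R]/((2 + 2)%N%:R) natrD ltrD2r trace_gt2 //.
  by apply: contraNneq zc => ->; rewrite normr1.
have bzs : z + z^-1 + 2 < s + s^-1 + 2 by rewrite ltrD2r.
set b := z + _ + 2 in bz bzs; set b' := s + _ + 2 in bzs.
have four0 : 0 < 4%:R :> algC by rewrite ltr0n.
have b0 : 0 < b by apply: lt_trans bz.
have g n : [/\ 0 < cot_ratio n.+1 z, cot_ratio n.+1 z < cot_ratio n.+1 s,
    0 < cot_ratio2 n.+1 z & cot_ratio2 n.+1 z <= cot_ratio2 n.+1 s].
  elim: n => [|n [IH1 IH2 IH3 IH4]]; first by rewrite !cot_ratio1 // !cot_ratio21 // ltr01.
  rewrite !(cot_ratioS _ _ (ltn0Sn n)) // !(cot_ratio2S _ _ (ltn0Sn n)) // -/b -/b'.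
  have d0 : 0 < 1 + cot_ratio2 n.+1 z by rewrite addr_gt0.
  have d1 : 0 < cot_ratio n.+1 z + b by rewrite addr_gt0.
  have d2 : cot_ratio n.+1 z + b < cot_ratio n.+1 s + b' by apply: ltrD.
  split.
  - rewrite subr_gt0 (lt_trans _ bz) // gtr_pMr // invf_lt1 // ltrDl //.
  - apply: ltr_leD => //; rewrite lerN2 ler_wpM2l ?(ltW four0) // lef_pV2 ?posrE //.
      by rewrite lerD2l.
    by apply: lt_le_trans d0 _; rewrite lerD2l.
  - by rewrite subr_gt0 ltr_pdivrMr // mul1r (lt_trans bz) // ltrDr.
  rewrite lerD2l lerN2 ler_wpM2l ?(ltW four0) // lef_pV2 ?posrE // ?(ltW d2) //.
  exact: lt_trans d2.
have e1 := spider_fun_cot z0 zc (ltn0Sn A) (ltn0Sn B) Ez.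
have e2 := spider_fun_cot s0 sc (ltn0Sn A) (ltn0Sn B) Es.
have h n : (cot_ratio n.+1 s)^-1 < (cot_ratio n.+1 z)^-1.
  have [h1 h2 _ _] := g n; rewrite ltf_pV2 ?posrE //; exact: lt_trans h2.
have := ltrD (ltrD (h 0%N) (h A)) (h B).
by rewrite e1 e2 ltxx.
Qed.

Lemma spider_root_unique (z s : algC) A B : (0 < A)%N -> (0 < B)%N ->
  1 < s -> spider_fun A B s = 0 -> z != 0 -> `|z| != 1 -> spider_fun A B z = 0 ->
  z + z^-1 = s + s^-1.
Proof.
move=> A0 B0 s1 Es z0 zc Ez; have sgt : 0 < s by apply: lt_trans s1.
have sc : `|s| != 1 by rewrite gtr0_norm // gt_eqF.
have zR := trace_real_off_circle z0 zc (spider_root_trace_real A0 B0 z0 zc Ez).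
have zgt : 0 < z.
  move: (zR); rewrite realE le_eqVlt eq_sym (negPf z0) /= => /orP[//|].
  rewrite le_eqVlt (negPf z0) /= => zlt.
  by case: (spider_root_neg A0 B0 zlt zc).
have [bz bs] : z + z^-1 \is Num.real /\ s + s^-1 \is Num.real.
  by rewrite !rpredD ?rpredV // gtr0_real.
case: (real_ltgtP bz bs) => // h.
  by case: (spider_root_pos_le A0 B0 zgt sgt zc sc Ez Es).
by case: (spider_root_pos_le A0 B0 sgt zgt sc zc Es Ez).
Qed.

Local Notation pQtoC := (map_poly (ratr : rat -> algC)).

Lemma root_gcdp_rat (p q : {poly rat}) (y : algC) :
  root (pQtoC p) y -> root (pQtoC q) y -> root (pQtoC (gcdp p q)) y.
Proof. by move=> py qy; rewrite gcdp_map root_gcd py qy. Qed.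

Lemma conj_root_rat (q : {poly rat}) (z y : algC) :
  root (minCpoly z) y -> root (pQtoC q) y -> root (pQtoC q) z.
Proof.
have [r [-> rmon] rP] := minCpolyP z; move=> ry qy.
have rz : root (pQtoC r) z by rewrite rP.
have gy := root_gcdp_rat ry qy; set g := gcdp r q in gy.
have [h rE] := dvdpP _ _ (dvdp_gcdl r q); rewrite -/g in rE.
have : root (pQtoC h) z || root (pQtoC g) z by rewrite -rootM -rmorphM -rE.
case/orP; last first.
  by rewrite !rP => /dvdp_trans; apply; apply: dvdp_gcdr.
rewrite rP => rh; have r0 := monic_neq0 rmon.
have := r0; rewrite {1}rE mulf_eq0 negb_or => /andP[h0 g0].
have : (size g <= 1)%N.
  have := dvdp_leq h0 rh; rewrite {1}rE size_mul //.
  by rewrite -subn1 leq_subLR addnC leq_add2r.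
move=> /size1_polyC gE; move: gy g0; rewrite gE map_polyC rootC fmorph_eq0 => /eqP ->.
by rewrite polyC0 eqxx.
Qed.

Lemma minCpoly_uniq_roots (z : algC) (rs : seq algC) :
  minCpoly z = \prod_(y <- rs) ('X - y%:P) -> uniq rs.
Proof.
move=> Prs; apply: contraT => nu; exfalso.
have [y [s rsE]] : exists y s, perm_eq rs [:: y, y & s].
  elim: rs nu {Prs} => //= x rs IH; rewrite negb_and negbK => /orP[xrs|/IH[y [s e]]].
    by exists x, (rem x rs); rewrite perm_cons perm_to_rem.
  exists y, (x :: s); apply/seq.permP=> p; have /seq.permP/(_ p) /= -> := e.
  by rewrite addnCA; congr addn; rewrite addnCA.
have [r [Pr rmon] rP] := minCpolyP z; rewrite Pr (perm_big _ rsE) !big_cons /= mulrA in Prs.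
have rr : root (pQtoC r) y by rewrite Prs !rootM root_XsubC eqxx.
have rr' : root (pQtoC r^`()) y.
  rewrite -deriv_map Prs; move: (\prod_(_ <- _) _) => S.
  rewrite !derivM derivXsubC mul1r mulr1 /root hornerD !hornerM hornerD hornerXsubC subrr.
  by rewrite addr0 !mul0r addr0.
have : root (pQtoC r^`()) z by apply: (conj_root_rat (z := z) (y := y)); rewrite ?Pr.
rewrite rP => rr'dvd; have r1 : (1 < size r)%N.
  rewrite -(size_map_poly (ratr : {rmorphism rat -> algC})).
  by apply: root_size_gt1 rr; rewrite map_poly_eq0 monic_neq0.
have r'0 : r^`() != 0.
  apply/eqP => /(congr1 (fun q : {poly rat} => q`_(size r).-2)) /eqP.
  rewrite coef_deriv coef0 (_ : (size r).-2.+1 = (size r).-1); last by case: (size r) r1 => [|[]].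
  have /monicP := rmon; rewrite /lead_coef => ->.
  by rewrite pnatr_eq0 -subn1 subn_eq0 leqNgt r1.
have := leq_ltn_trans (dvdp_leq r'0 rr'dvd) (lt_size_deriv (monic_neq0 rmon)).
by rewrite ltnn.
Qed.

Lemma absz_shift_lt (x : int) (m : nat) : (`|x| < m)%N -> (absz (x + m%:Z)%R < (2 * m).+1)%N.
Proof. lia. Qed.

Lemma absz_shift_inj (x y : int) (m : nat) : (`|x| < m)%N -> (`|y| < m)%N ->
  absz (x + m%:Z) = absz (y + m%:Z) -> x = y.
Proof. lia. Qed.

Lemma kronecker (z : algC) : z \in Aint ->
  (forall y, root (minCpoly z) y -> `|y| = 1) -> exists2 n, (0 < n)%N & z ^+ n = 1.
Proof.
move=> zA circ; set P := minCpoly z in circ.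
have Pint : P \is a polyOver Num.int by [].
have Pmon : P \is monic := minCpoly_monic z.
have [rs PE] := closed_field_poly_normal P.
rewrite (monicP Pmon) scale1r in PE.
have urs := minCpoly_uniq_roots PE.
have rootE y : root P y = (y \in rs) by rewrite PE root_prod_XsubC.
have z_rs : z \in rs by rewrite -rootE root_minCpoly.
set n := size rs.
have n0 : (0 < n)%N by rewrite /n; case: (rs) z_rs.
have sP : size P = n.+1 by rewrite PE size_prod_XsubC.
pose r k := iter k (fun q : {poly algC} => 'X * q - q`_n.-1 *: P) 1.
have r_eval y k : y \in rs -> (r k).[y] = y ^+ k.
  rewrite -rootE => /rootP Py; elim: k => [|k IHk]; first by rewrite /r /= hornerC.
  by rewrite /r iterS -/(r k) !hornerE Py mulr0 subr0 IHk exprS.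
have r_size k : (size (r k) <= n)%N.
  elim: k => [|k IHk]; first by rewrite size_poly1.
  apply/leq_sizeP => j; rewrite leq_eqVlt => /orP[/eqP <-|nj]; rewrite /r iterS -/(r k) coefB coefXM coefZ.
    rewrite gtn_eqF //; have /monicP := Pmon; rewrite /lead_coef sP /= => ->.
    by rewrite mulr1 subrr.
  rewrite gtn_eqF ?(leq_ltn_trans _ nj) // nth_default; last first.
    by apply: leq_trans IHk _; rewrite -ltnS prednK // (leq_ltn_trans _ nj).
  by rewrite [P`_j]nth_default ?sP // mulr0 subr0.
have r_int k j : (r k)`_j \is a Num.int.
  elim: k j => [|k IHk] j; first by rewrite coefC; case: ifP; rewrite ?rpred1 ?rpred0.
  rewrite /r iterS -/(r k) coefB coefXM coefZ rpredB ?rpredM ?(polyOverP Pint) //.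
  by case: ifP; rewrite ?rpred0.
pose v : 'rV_n := \row_j rs`_j.
have Vunit : Vandermonde n v \in unitmx.
  rewrite unitmxE unitfE det_Vandermonde; apply/prodf_neq0 => i _; apply/prodf_neq0 => j ij.
  by rewrite subr_eq0 !mxE nth_uniq // gt_eqF.
pose c k : 'rV_n := \row_j (r k)`_j.
have cE k : c k = (\row_j rs`_j ^+ k) *m invmx (Vandermonde n v).
  apply: (canRL (mulmxK Vunit)); apply/rowP=> j; rewrite !mxE -(r_eval _ _ (mem_nth 0 (ltn_ord j))).
  rewrite (horner_coef_wide _ (r_size k)); apply: eq_bigr => i _.
  by rewrite !mxE.
pose bnd : algC := \sum_i \sum_j `|invmx (Vandermonde n v) i j|.
have c_bnd k j : `|(r k)`_j| <= bnd.
  have [jn|nj] := ltnP j n; last first.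
    rewrite nth_default ?normr0 ?sumr_ge0 //; last exact: leq_trans nj.
    by move=> i _; apply: sumr_ge0.
  have := congr1 (fun m : 'rV_n => m 0 (Ordinal jn)) (cE k); rewrite !mxE /= => ->.
  apply: le_trans (ler_norm_sum _ _ _) _; apply: ler_sum => i _; rewrite normrM mxE normrX.
  rewrite circ ?expr1n ?mul1r; last by rewrite rootE mem_nth.
  by rewrite (bigD1 (Ordinal jn)) //= lerDl sumr_ge0.
pose N := Num.bound bnd.
have bnd0 : 0 <= bnd by apply: le_trans (c_bnd 0%N 0%N).
pose a k j : int := Num.floor (r k)`_j.
have aE k j : (a k j)%:~R = (r k)`_j by apply/eqP; rewrite -intrEfloor.
have a_bnd k j : (`|a k j| < N)%N.
  have : `|a k j|%:~R < N%:R :> algC.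
    by rewrite intr_norm aE (le_lt_trans (c_bnd k j)) // archi_boundP.
  by rewrite -[N%:R]/(N%:Z%:~R) ltr_int; lia.
pose T : finType := {ffun 'I_n -> 'I_(2 * N).+1}.
pose f (k : 'I_#|T|.+1) : T := [ffun j : 'I_n => inord (absz (a k j + N%:Z))].
have /injectivePn[k [l kl fkl]] : ~~ injectiveb f.
  apply: contraT => /negPn /injectiveP /leq_card; rewrite card_ord ltnn //.
have rkl : r k = r l.
  apply/polyP => j; have [jn|nj] := ltnP j n; last first.
    by rewrite !nth_default // (leq_trans _ nj).
  rewrite -!aE; congr _%:~R.
  have := congr1 (fun g : T => val (g (Ordinal jn))) fkl; rewrite !ffunE /= !inordK.
  - exact: absz_shift_inj.
  - exact: absz_shift_lt.
  exact: absz_shift_lt.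
have z0 : z != 0 by apply: contra_eq_neq (circ z (root_minCpoly z)) => ->; rewrite normr0 eq_sym oner_eq0.
have zkl : z ^+ k = z ^+ l by rewrite -!r_eval // rkl.
wlog lt_kl : k l kl zkl {fkl rkl} / (k < l)%N.
  by move=> W; case: (ltngtP k l) => [|/(W l k)|/val_inj e];
    [exact: W | rewrite eq_sym; exact | rewrite e eqxx in kl].
exists (l - k)%N; first by rewrite subn_gt0.
by rewrite expfB // zkl divff // expf_neq0.
Qed.

Section TwoAdic.

Let c : algC := 8.-root 2.
Let c8 : c ^+ 8 = 2. Proof. exact: rootCK. Qed.
Let c0 : c != 0. Proof. by rewrite rootC_eq0 // pnatr_eq0. Qed.
Let cA : c \in Aint.
Proof. by apply: (@Aint_exp _ 8) => //; rewrite c8 (Aint_int 2). Qed.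

(* The 2-adic valuation of x is at most k/8. *)
Definition val2_le (x : algC) (k : nat) : Prop :=
  exists2 m : nat, odd m & m%:R * (8.-root 2) ^+ k / x \in Aint.

Lemma val2_leM x y k l : val2_le x k -> val2_le y l -> val2_le (x * y) (k + l).
Proof.
case=> m om mA [n on nA]; exists (m * n)%N; first by rewrite oddM om on.
have -> : (m * n)%:R * (8.-root 2) ^+ (k + l) / (x * y) =
    (m%:R * (8.-root 2) ^+ k / x) * (n%:R * (8.-root 2) ^+ l / y) :> algC.
  by rewrite natrM exprD invfM; ring.
exact: rpredM.
Qed.

Lemma val2_leW x k l : (k <= l)%N -> val2_le x k -> val2_le x l.
Proof.
move=> kl [m om mA]; exists m => //; rewrite -(subnK kl) exprD mulrCA -mulrA.
by rewrite rpredM ?rpredX // mulrA.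
Qed.

Lemma val2_leN x k : val2_le x k -> val2_le (- x) k.
Proof. by case=> m om mA; exists m => //; rewrite invrN mulrN rpredN. Qed.

Lemma val2_le_ge x w j k : x != 0 -> w \in Aint -> x = (8.-root 2) ^+ j * w ->
  val2_le x k -> (j <= k)%N.
Proof.
move=> x0 wA xE [m om mA]; rewrite leqNgt; apply/negP => kj.
have : m%:R / c ^+ (j - k) \in Aint.
  have w0 : w != 0 by apply: contraNneq x0 => w0; rewrite xE w0 mulr0.
  suff -> : m%:R / c ^+ (j - k) = m%:R * c ^+ k / x * w by apply: rpredM.
  rewrite xE -/c -{2}(subnK (ltnW kj)) exprD; field.
  by rewrite w0 !expf_neq0.
move/(@rpredX _ Aint 8); rewrite expr_div_n exprAC c8 -!natrX Aint_div_nat ?expn_eq0 //.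
move/(dvdn_trans (dvdn_exp2l 2 _ : 2 ^ 1 %| 2 ^ (j - k)))%N; rewrite subn_gt0 => /(_ kj).
by rewrite expn1 dvdn2 oddX om orbT.
Qed.

Lemma two_div_power i (y : algC) : y \in Aint -> y ^+ (2 ^ i) = -1 ->
  2 / (1 - y) ^+ (2 ^ i) \in Aint.
Proof.
elim: i y => [|i IHi] y yA yi.
  by move: yi; rewrite expn0 expr1 => ->; rewrite opprK -[1 + 1]/(2%:R) expr1 divff ?rpred1 ?pnatr_eq0.
have y1 : 1 - y != 0.
  by rewrite subr_eq0; apply: contra_eq_neq yi => <-; rewrite expr1n -subr_eq0 opprK -[1 + 1]/(2%:R) pnatr_eq0.
have yN1 : 1 + y != 0.
  rewrite addrC addr_eq0; apply: contra_eq_neq yi => ->.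
  by rewrite expnS exprM sqrrN !expr1n -subr_eq0 opprK -[1 + 1]/(2%:R) pnatr_eq0.
have y2 : 2 / (1 - y ^+ 2) ^+ (2 ^ i) \in Aint.
  by apply: IHi; rewrite ?rpredX // -exprM -expnS.
have q : (1 + y) / (1 - y) \in Aint.
  have -> : 1 + y = (1 - y) * \sum_(k < (2 ^ i.+1).+1) y ^+ k.
    have := subrX1 y (2 ^ i.+1).+1; rewrite exprS yi => e.
    by rewrite -opprB mulNr -e; ring.
  by rewrite mulrC mulKf // rpred_sum // => k _; rewrite rpredX.
have -> : 2 / (1 - y) ^+ (2 ^ i.+1) =
    2 / (1 - y ^+ 2) ^+ (2 ^ i) * ((1 + y) / (1 - y)) ^+ (2 ^ i).
  have -> : 1 - y ^+ 2 = (1 - y) * (1 + y) by ring.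
  rewrite expnSr exprM exprMn expr_div_n; field.
  by rewrite !expf_neq0.
by rewrite rpredM ?rpredX.
Qed.

Lemma val2_one_sub i n (y : algC) : (0 < n)%N -> y ^+ n = 1 -> (i <= 3)%N ->
  y ^+ (2 ^ i) != 1 -> val2_le (1 - y) (2 ^ (3 - i)).
Proof.
move=> n0 yn i3 yi; have yA : y \in Aint by apply: (Aint_exp n0); rewrite yn rpred1.
have y1 : 1 - y != 0.
  by rewrite subr_eq0; apply: contraNneq yi => <-; rewrite expr1n.
have [o] := pfactor_coprime (isT : prime 2) n0; rewrite coprime2n => oo.
set j := logn 2 n; pose x := y ^+ (2 ^ j) => nE.
have xo : x ^+ o = 1 by rewrite -exprM mulnC -nE.
have [x1|x1] := eqVneq x 1; last first.
  apply: (@val2_leW _ 0) => //; exists o => //; rewrite expr0 mulr1.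
  have -> : o%:R = \sum_(k < o) (1 - x ^+ k).
    rewrite sumrB sumr_const card_ord.
    have := subrX1 x o; rewrite xo subrr => /esym/eqP; rewrite mulf_eq0 subr_eq0 (negPf x1) /=.
    by move/eqP => ->; rewrite subr0.
  rewrite mulr_suml rpred_sum // => k _; rewrite /x -exprM -[1 - _]opprB subrX1 -mulNr opprB.
  by rewrite mulrC mulKf // rpred_sum // => l _; rewrite rpredX.
have [m [mi ym]] : exists m, (i <= m)%N /\ y ^+ (2 ^ m) = -1.
  have ex : exists m, y ^+ (2 ^ m) == 1 by exists j; apply/eqP.
  have [[|m] /eqP ym mmin] := ex_minnP ex.
    by case/negP: yi; move: ym; rewrite expn0 expr1 => ->; rewrite expr1n.
  exists m; split.
    rewrite leqNgt; apply: contra yi => mi; have {mi} := mi; move=> mi.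
    by rewrite -(subnK mi) expnD mulnC exprM ym expr1n.
  have : (y ^+ (2 ^ m)) ^+ 2 == 1 by rewrite -exprM mulnC -expnS ym.
  rewrite sqrf_eq1 => /orP[/mmin|/eqP //]; by rewrite ltnn.
exists 1%N => //; rewrite mul1r.
have := two_div_power yA ym; rewrite -(subnK mi) expnD mulnC exprM => h.
apply: (@Aint_exp _ (2 ^ i)); first by rewrite expn_gt0.
rewrite expr_div_n -exprM -expnD subnK // -/c c8.
have p1 : (0 < 2 ^ (m - i))%N by rewrite expn_gt0.
have -> : 2 / (1 - y) ^+ (2 ^ i) = 2 / ((1 - y) ^+ (2 ^ i)) ^+ (2 ^ (m - i)) * ((1 - y) ^+ (2 ^ i)) ^+ (2 ^ (m - i)).-1.
  by rewrite -{1}(prednK p1) exprS; field; rewrite !expf_neq0.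
by rewrite rpredM // !rpredX // rpredB ?rpred1.
Qed.

End TwoAdic.

Lemma spider_root_of_unity (A B n : nat) (z : algC) : (0 < n)%N -> z ^+ n = 1 ->
  spider_fun A B z = 0 -> z ^+ 24 = 1 \/ (z ^+ A = -1 /\ z ^+ B = -1).
Proof.
move=> n0 zn E0; have [->|z24] := eqVneq (z ^+ 24) 1; [by left|right].
have zA : z \in Aint by apply: (Aint_exp n0); rewrite zn rpred1.
have z0 : z != 0.
  by apply: contra_eq_neq zn => ->; rewrite expr0n gtn_eqF // eq_sym oner_eq0.
have zX k : (k %| 24)%N -> z ^+ k != 1.
  by case/dvdnP=> m km; apply: contraNneq z24 => zk; rewrite km mulnC exprM zk expr1n.
have pw k : (z ^+ k) ^+ n = 1 by rewrite -exprM mulnC exprM zn expr1n.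
have pN k : (- z ^+ k) ^+ (n * 2) = 1 by rewrite mulnC exprM sqrrN -exprM mulnC exprM pw expr1n.
have n20 : (0 < n * 2)%N by rewrite muln_gt0 n0.
have zp1 : z + 1 != 0.
  by rewrite addr_eq0; apply: contraNneq (zX 2 isT) => ->; rewrite sqrrN expr1n.
set X := z ^+ A; set Y := z ^+ B.
have E1 : (z ^+ 3 - 1) * (X + 1) * (Y + 1) = 2 * z * (z + 1) * (X * Y - 1).
  by apply/eqP; rewrite -subr_eq0 /X /Y -exprD; apply/eqP.
have z31 : z ^+ 3 - 1 != 0 by rewrite subr_eq0 zX.
have [XA YA] : X \in Aint /\ Y \in Aint by rewrite !rpredX.
have two0 : 2 != 0 :> algC by rewrite pnatr_eq0.
have neg1 W V : (z ^+ 3 - 1) * (W + 1) * (V + 1) = 2 * z * (z + 1) * (W * V - 1) ->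
    W = -1 -> V = -1.
  move=> + W1; rewrite W1 addNr mulr0 mul0r mulN1r => /esym/eqP.
  rewrite !mulf_eq0 (negPf two0) (negPf z0) (negPf zp1) /= subr_eq0 eqr_oppLR.
  by move/eqP.
have E2 : (z ^+ 3 - 1) * (Y + 1) * (X + 1) = 2 * z * (z + 1) * (Y * X - 1).
  by rewrite mulrAC E1 [X * Y]mulrC.
have [X1|X1] := eqVneq X (-1); first by split=> //; apply: neg1 X1.
have [Y1|Y1] := eqVneq Y (-1); first by split=> //; apply: neg1 Y1.
exfalso.
have v3 : val2_le (z ^+ 3 - 1) 1.
  rewrite -opprB; apply: val2_leN; apply: (@val2_one_sub 3 n) => //.
  by rewrite -exprM zX.
have vz : val2_le (z + 1) 1.
  rewrite addrC -[z]opprK; apply: (@val2_one_sub 3 (n * 2)) => //.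
    by have := pN 1%N; rewrite expr1.
  by rewrite (exprM _ 2 4) sqrrN -exprM zX.
have vz2 : val2_le (z ^+ 2 + 1) 2.
  rewrite addrC -[z ^+ 2]opprK; apply: (@val2_one_sub 2 (n * 2)) => //.
  by rewrite (exprM _ 2 2) sqrrN -!exprM zX.
have v1 k : z ^+ k != 1 -> z ^+ k != -1 -> val2_le (z ^+ k + 1) 4.
  move=> h1 h2; rewrite addrC -[z ^+ k]opprK; apply: (@val2_one_sub 1 (n * 2)) => //.
  by rewrite sqrrN sqrf_eq1 negb_or h1.
have v2 k : (z ^+ k) ^+ 2 != 1 -> (z ^+ k) ^+ 2 != -1 -> val2_le (z ^+ k + 1) 2.
  move=> h1 h2; rewrite addrC -[z ^+ k]opprK; apply: (@val2_one_sub 2 (n * 2)) => //.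
  by rewrite (exprM _ 2 2) sqrrN sqrf_eq1 negb_or h1.
have c8 : (8.-root 2) ^+ 8 = 2 :> algC by exact: rootCK.
have [Xp Yp] : X + 1 != 0 /\ Y + 1 != 0 by rewrite !addr_eq0.
have one W k : W = z ^+ k -> W != -1 ->
    (z ^+ 3 - 1) * (1 + 1) * (W + 1) = 2 * z * (z + 1) * (1 * W - 1) -> False.
  move=> Wk W1 e; have [We|Wn] := eqVneq W 1.
    move: e; rewrite We mul1r subrr mulr0 -[1 + 1]/(2%:R) => /eqP.
    by rewrite !mulf_eq0 (negPf z31) (negPf two0).
  have WA : W \in Aint by rewrite Wk rpredX.
  have Wp : W + 1 != 0 by rewrite addr_eq0.
  have z21 : z ^+ 2 + 1 != 0.
    rewrite addr_eq0; apply: contraNneq (zX 4 isT) => z2.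
    by rewrite (exprM _ 2 2) z2 sqrrN expr1n.
  have key : (W + 1) * (z + 1) * (z ^+ 2 + 1) = (8.-root 2) ^+ 8 * (W * (z ^+ 2 + z + 1) + 1).
    rewrite c8; apply: (mulfI two0).
    by rewrite -[LHS]subr0 -(subrr (2 * z * (z + 1) * (1 * W - 1))) -{1}e; ring.
  have := @val2_le_ge _ _ 8 (4 + 1 + 2) _ _ key; rewrite !mulf_neq0 // => /(_ isT).
  rewrite !(rpredD, rpredM, rpredX, rpred1) // => /(_ isT) h.
  suff : (8 <= 4 + 1 + 2)%N by [].
  by apply: h; apply: val2_leM => //; apply: val2_leM => //; rewrite Wk; apply: v1; rewrite -?Wk.
have [Xe|Xn] := eqVneq X 1; first by apply: (one Y B) => //; move: E1; rewrite Xe.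
have [Ye|Yn] := eqVneq Y 1; first by apply: (one X A) => //; move: E2; rewrite Ye.
have bigstep k l : 2 * z * (z + 1) * (X * Y - 1) != 0 ->
    val2_le (X + 1) k -> val2_le (Y + 1) l -> (8 <= 1 + k + l)%N.
  move=> nz vX vY; apply: (@val2_le_ge ((z ^+ 3 - 1) * (X + 1) * (Y + 1))
    (z * (z + 1) * (X * Y - 1))).
  - by rewrite !mulf_neq0.
  - by rewrite !(rpredB, rpredD, rpredM, rpred1).
  - by rewrite E1 c8; ring.
  by apply: val2_leM => //; apply: val2_leM.
have nz : 2 * z * (z + 1) * (X * Y - 1) != 0 by rewrite -E1 !mulf_neq0.
have sq1 (W : algC) : W != 1 -> W != -1 -> W ^+ 2 != 1 by move=> h1 h2; rewrite sqrf_eq1 negb_or h1.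
have X2 : X ^+ 2 = -1.
  apply/eqP; apply: contraT => X2; suff : (8 <= 1 + 2 + 4)%N by [].
  by apply: (bigstep 2 4) => //; [apply: v2 => //; exact: sq1 | exact: v1].
have Y2 : Y ^+ 2 = -1.
  apply/eqP; apply: contraT => Y2; suff : (8 <= 1 + 4 + 2)%N by [].
  by apply: (bigstep 4 2) => //; [exact: v1 | apply: v2 => //; exact: sq1].
have : (X * Y) ^+ 2 == 1 by rewrite exprMn X2 Y2 mulrNN mulr1.
rewrite sqrf_eq1 => /orP[/eqP XY|/eqP XY].
  by move: nz; rewrite XY subrr mulr0 eqxx.
suff : (16 <= 1 + 4 + 4)%N by [].
apply: (@val2_le_ge ((z ^+ 3 - 1) * (X + 1) * (Y + 1)) (- z * (z + 1))).
- by rewrite !mulf_neq0.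
- by rewrite rpredM ?rpredN // rpredD ?rpred1.
- by rewrite E1 XY (exprM _ 8 2) c8; ring.
by apply: val2_leM; [apply: val2_leM => //|]; apply: v1.
Qed.

Definition euler_op (R : comNzRingType) (q : {poly R}) : {poly R} := 'X * q^`().

Section EulerOp.
Variable R : comNzRingType.
Implicit Types q r : {poly R}.

Lemma euler_opD q r : euler_op (q + r) = euler_op q + euler_op r.
Proof. by rewrite /euler_op derivD mulrDr. Qed.

Lemma euler_opB q r : euler_op (q - r) = euler_op q - euler_op r.
Proof. by rewrite /euler_op derivB mulrBr. Qed.

Lemma euler_opMn q n : euler_op (q *+ n) = euler_op q *+ n.
Proof. by rewrite /euler_op derivMn mulrnAr. Qed.

Lemma euler_opM q r : euler_op (q * r) = euler_op q * r + q * euler_op r.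
Proof. by rewrite /euler_op derivM mulrDr mulrA mulrCA. Qed.

Lemma euler_op1 : euler_op (1 : {poly R}) = 0.
Proof. by rewrite /euler_op derivC mulr0. Qed.

Lemma euler_op0 : euler_op (0 : {poly R}) = 0.
Proof. by rewrite /euler_op deriv0 mulr0. Qed.

Lemma euler_opX : euler_op ('X : {poly R}) = 'X.
Proof. by rewrite /euler_op derivX mulr1. Qed.

Lemma euler_opXn n : euler_op ('X^n : {poly R}) = 'X^n *+ n.
Proof. by rewrite /euler_op derivXn mulrnAr; case: n => // n; rewrite -exprS. Qed.

Definition euler_opE := (euler_opB, euler_opD, euler_opMn, euler_opM, euler_op0, euler_op1,
  euler_opX, euler_opXn).

Lemma euler_op_root2 (x : R) (S : {poly R}) :
  (euler_op (('X - x%:P) * (('X - x%:P) * S))).[x] = 0.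
Proof.
by rewrite /euler_op !derivM derivXsubC !(hornerE, hornerXsubC) subrr; ring.
Qed.

Lemma euler_op2_root3 (x : R) (S : {poly R}) :
  (euler_op (euler_op (('X - x%:P) * (('X - x%:P) * (('X - x%:P) * S))))).[x] = 0.
Proof.
have E T : euler_op (('X - x%:P) * T) = 'X * T + ('X - x%:P) * euler_op T.
  by rewrite euler_opM {1}/euler_op derivXsubC mulr1.
pose T := ('X - x%:P) * (('X - x%:P) * S).
have T0 : T.[x] = 0 by rewrite hornerM hornerXsubC subrr mul0r.
have T2 : (euler_op T).[x] = 0 by apply: euler_op_root2.
rewrite -/T; move: T T0 T2 => U U0 U2; rewrite E euler_opD euler_opM E.
move: (euler_op (euler_op U)) (euler_op U) (euler_op 'X) U2 => W V Z V0.
by rewrite !hornerD !hornerM hornerXsubC subrr U0 V0; ring.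
Qed.

End EulerOp.

Lemma map_euler_op (q : {poly int}) :
  map_poly intr (euler_op q) = euler_op (map_poly (intr : int -> algC) q).
Proof. by rewrite /euler_op rmorphM /= map_polyX deriv_map. Qed.

Section SpiderDerivative.

Variables A B : nat.
Local Notation P := (spider_poly A B).

Lemma spider_euler (z : algC) : z + 1 != 0 -> z != 0 -> z ^+ A + 1 != 0 -> z ^+ B + 1 != 0 ->
  spider_fun A B z = 0 -> int_eval (euler_op P) z = 0 ->
  z + z^-1 = 2 * (z / (z + 1) ^+ 2 + A%:R * (z ^+ A / (z ^+ A + 1) ^+ 2)
    + B%:R * (z ^+ B / (z ^+ B + 1) ^+ 2)).
Proof.
move=> z1 z0 XA XB.
rewrite /spider_poly !euler_opE !(int_evalB, int_evalD, int_evalM, int_evalMn, int_evalXn, int_eval1, int_eval0, int_evalX).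
rewrite /spider_fun exprD; move: (z ^+ A) (z ^+ B) XA XB => X Y X1 Y1 E0 E1.
set u := _ + _ + _; suff : z + z^-1 - 2 * u = 0 by move/eqP; rewrite subr_eq0 => /eqP.
move: E0 E1; set e0 := (X in X = 0 -> _); set e1 := (X in _ -> X = 0 -> _) => E0 E1.
transitivity ((e1 - (A%:R * X / (X + 1) + B%:R * Y / (Y + 1) + 1 + z / (z + 1)) * e0) /
   ((X + 1) * (Y + 1) * z * (z + 1))); last by rewrite E0 E1 mulr0 subr0 mul0r.
rewrite /e0 /e1 /u -(mulr_natr X) -(mulr_natr Y) -(mulr_natr (X * Y)) natrD; field.
by rewrite z0 z1 X1 Y1.
Qed.

Lemma spider_euler_neg1 (z : algC) : z + 1 != 0 -> z != 0 -> (0 < A)%N -> z ^+ A = -1 -> z ^+ B = -1 ->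
  int_eval (euler_op P) z != 0.
Proof.
move=> z1 z0 A0 XA XB.
rewrite /spider_poly !euler_opE !(int_evalB, int_evalD, int_evalM, int_evalMn, int_evalXn, int_eval1, int_eval0, int_evalX).
rewrite exprD XA XB.
have nz : - (2 * z * (z + 1) * (A%:R + B%:R)) != 0.
  rewrite oppr_eq0 !mulf_neq0 ?pnatr_eq0 // -natrD pnatr_eq0 addn_eq0 negb_and.
  by rewrite -lt0n A0.
rewrite -(mulr_natr _ A) -(mulr_natr _ B) -(mulr_natr _ (A + B)) natrD.
by rewrite [X in X != 0](_ : _ = - (2 * z * (z + 1) * (A%:R + B%:R))) //; ring.
Qed.

Hypothesis A0 : (0 < A)%N.

Lemma spider_euler2_neg1 :
  [|| int_eval P (-1) != 0, int_eval (euler_op P) (-1) != 0 | int_eval (euler_op (euler_op P)) (-1) != 0].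
Proof.
rewrite /spider_poly !euler_opE !(int_evalB, int_evalD, int_evalM, int_evalMn, int_evalXn, int_eval1, int_eval0, int_evalX).
rewrite exprD.
rewrite -(signr_odd _ A) -(signr_odd _ B); set a : algC := (-1) ^+ odd A.
set b : algC := (-1) ^+ odd B.
rewrite -(mulr_natr a A) -(mulr_natr (a * A%:R) A) -(mulr_natr b B) -(mulr_natr (b * B%:R) B).
rewrite -(mulr_natr (a * b) (A + B)) -(mulr_natr (a * b * (A + B)%:R) (A + B)) !natrD.
rewrite {}/a {}/b; case: (odd A); case: (odd B); rewrite /= ?expr0 ?expr1; apply/or3P.
- apply: Or33; rewrite [X in X != 0](_ : _ = - (4%:R * (A%:R * B%:R + A%:R + B%:R))); last by ring.
  by rewrite oppr_eq0 -natrM -!natrD -natrM pnatr_eq0 -lt0n muln_gt0 /=; lia.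
- apply: Or32; rewrite [X in X != 0](_ : _ = 4%:R * (A%:R + 1)); last by ring.
  by rewrite mulf_neq0 ?pnatr_eq0 // natr1 pnatr_eq0.
- apply: Or32; rewrite [X in X != 0](_ : _ = 4%:R * (B%:R + 1)); last by ring.
  by rewrite mulf_neq0 ?pnatr_eq0 // natr1 pnatr_eq0.
apply: Or31; rewrite [X in X != 0](_ : _ = - 8%:R); last by ring.
by rewrite oppr_eq0 pnatr_eq0.
Qed.

End SpiderDerivative.

Lemma circle_weight (w : algC) : `|w| = 1 -> w + 1 != 0 -> 4%:R^-1 <= w / (w + 1) ^+ 2.
Proof.
move=> w1 wp; have w0 : w != 0 by rewrite -normr_gt0 w1.
have wV : w^* = w^-1 by rewrite invC_norm w1 expr1n invr1 mul1r.
have -> : w / (w + 1) ^+ 2 = (`|w + 1| ^+ 2)^-1.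
  rewrite normCK rmorphD /= wV conjC1; field.
  by rewrite w0 addrC wp.
have n0 : 0 < `|w + 1| ^+ 2 by rewrite exprn_gt0 // normr_gt0.
rewrite lef_pV2 ?posrE ?ltr0n //.
rewrite (_ : 4%:R = 2 ^+ 2); last by rewrite -natrX.
rewrite ler_sqr ?nnegrE ?normr_ge0 ?ler0n //.
by rewrite (le_trans (ler_normD _ _)) // w1 normr1.
Qed.

Lemma pow_gap (x : algC) n : 1 < x -> n%:R * x ^+ n * (x - x^-1) <= x ^+ (2 * n) - 1.
Proof.
move=> x1; have x0 : 0 < x by apply: lt_trans x1.
have px k : 0 <= x ^+ k - 1 by rewrite subr_ge0 exprn_ege1 // ltW.
elim: n => [|n IHn]; first by rewrite !mul0r muln0 expr0 subrr.
rewrite -subr_ge0; set T := _ - _.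
have -> : T = x * (x ^+ (2 * n) - 1 - n%:R * x ^+ n * (x - x^-1)) +
    (x - 1) * ((x ^+ n.+1 - 1) * (x ^+ n - 1)).
  rewrite /T mulnS !exprS (mulnC 2) exprM -natr1; field.
  by rewrite gt_eqF.
by rewrite addr_ge0 ?mulr_ge0 ?px ?(ltW x0) // ?subr_ge0 // ltW.
Qed.

Lemma real_weight (x : algC) n : (0 < n)%N -> 1 < x ->
  n%:R * (x ^+ n / (x ^+ n + 1) ^+ 2) <= (cot_ratio n x)^-1.
Proof.
move=> n0 x1; have x0 : 0 < x by apply: lt_trans x1.
have xn1 : 0 < x ^+ n - 1 by rewrite subr_gt0 exprn_egt1 // -lt0n.
have xp : 0 < x ^+ n + 1 by rewrite addr_gt0 // exprn_gt0.
have xV : 0 < x - x^-1.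
  by rewrite subr_gt0 (lt_trans _ x1) // invf_lt1.
rewrite /cot_ratio -subr_ge0.
have -> : ((x - x^-1) * (x ^+ n + 1) / (x ^+ n - 1))^-1 - n%:R * (x ^+ n / (x ^+ n + 1) ^+ 2)
   = (x ^+ (2 * n) - 1 - n%:R * x ^+ n * (x - x^-1)) / ((x ^+ n + 1) ^+ 2 * (x - x^-1)).
  have zz1 : x * x - 1 != 0 by rewrite -expr2 subr_sqr_1 mulf_neq0 ?gt_eqF ?subr_gt0 ?addr_gt0.
  by rewrite (mulnC 2) exprM; field; rewrite zz1 !gt_eqF.
by rewrite divr_ge0 ?subr_ge0 ?pow_gap // ltW // mulr_gt0 ?exprn_gt0.
Qed.

Lemma spider_simple_root A B (s z : algC) : (2 <= A)%N -> (2 <= B)%N ->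
  1 < s -> spider_fun A B s = 0 -> z != 0 -> z + 1 != 0 -> spider_fun A B z = 0 ->
  int_eval (euler_op (spider_poly A B)) z != 0.
Proof.
move=> A2 B2 s1 Es z0 z1 Ez; have [A0 B0] : (0 < A)%N /\ (0 < B)%N by split; apply: ltnW.
have two0 : 2 != 0 :> algC by rewrite pnatr_eq0.
have XY : z ^+ A = -1 -> z ^+ B = -1.
  move=> X1; move: Ez; rewrite /spider_fun exprD X1 addNr mulr0 mul0r sub0r mulN1r.
  move/eqP; rewrite oppr_eq0 !mulf_eq0 (negPf two0) (negPf z0) (negPf z1) /= subr_eq0 eqr_oppLR.
  by move/eqP.
have YX : z ^+ B = -1 -> z ^+ A = -1.
  move=> Y1; move: Ez; rewrite /spider_fun exprD Y1 addNr mulr0 sub0r mulrN1.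
  move/eqP; rewrite oppr_eq0 !mulf_eq0 (negPf two0) (negPf z0) (negPf z1) /= subr_eq0 eqr_oppLR.
  by move/eqP.
have [X1|X1] := eqVneq (z ^+ A) (-1); first exact: spider_euler_neg1 (XY X1).
have Y1 : z ^+ B != -1 by apply: contra_neq X1 => /YX.
have XA : z ^+ A + 1 != 0 by rewrite addr_eq0.
have XB : z ^+ B + 1 != 0 by rewrite addr_eq0.
apply/eqP => /(spider_euler z1 z0 XA XB Ez) e.
have [zc|zc] := eqVneq `|z| 1.
  have h n : z ^+ n + 1 != 0 -> 4%:R^-1 <= z ^+ n / (z ^+ n + 1) ^+ 2.
    by apply: circle_weight; rewrite normrX zc expr1n.
  have : 5%:R / 2 <= z + z^-1.
    rewrite e (_ : 5%:R / 2 = 2 * (4%:R^-1 + 2 * 4%:R^-1 + 2 * 4%:R^-1)); last by field.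
    have q4 : 0 <= 4%:R^-1 :> algC by rewrite invr_ge0 ler0n.
    rewrite ler_pM2l ?ltr0n //; apply: lerD; first apply: lerD.
    - by have := h 1%N; rewrite expr1; apply.
    - by rewrite ler_pM ?ler_nat ?h.
    by rewrite ler_pM ?ler_nat ?h.
  move=> le; have : 5%:R / 2 <= `|z + z^-1|.
    rewrite ger0_norm //; apply: le_trans le; rewrite divr_ge0 ?ler0n //.
  have le2 : `|z + z^-1| <= 2.
    by rewrite (le_trans (ler_normD _ _)) // normfV zc invr1.
  move/le_trans/(_ le2); rewrite ler_pdivrMr ?ltr0n // -natrM ler_nat //.
have zs := spider_root_unique A0 B0 s1 Es z0 zc Ez.
have s0 : 0 < s by apply: lt_trans s1.
have sc : `|s| != 1 by rewrite gtr0_norm // gt_eqF.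
have w n : z ^+ n / (z ^+ n + 1) ^+ 2 = s ^+ n / (s ^+ n + 1) ^+ 2.
  have : (z - s) * (z * s - 1) = 0.
    have -> : (z - s) * (z * s - 1) = z * s * (z + z^-1 - (s + s^-1)).
      by field; rewrite z0 gt_eqF.
    by rewrite zs subrr mulr0.
  move/eqP; rewrite mulf_eq0 !subr_eq0 => /orP[/eqP -> //|/eqP zs1].
  have -> : z = s^-1 by apply: (mulIf (lt0r_neq0 s0)); rewrite zs1 mulVf ?gt_eqF.
  have sn0 : s ^+ n != 0 by rewrite expf_neq0 // gt_eqF.
  have sp : s ^+ n + 1 != 0 by rewrite gt_eqF // addr_gt0 // exprn_gt0.
  by rewrite exprVn; field; rewrite sn0 ?sp /= ?[1 + _]addrC ?sp.
have w1 : z / (z + 1) ^+ 2 = s / (s + 1) ^+ 2 by have := w 1%N; rewrite !expr1.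
have cE := spider_fun_cot (lt0r_neq0 s0) sc A0 B0 Es.
have : s + s^-1 <= 2.
  rewrite -zs e w1 (w A) (w B) -[leRHS]mulr1 ler_pM2l ?ltr0n //.
  rewrite -[X in _ <= X]cE; apply: lerD; last exact: real_weight.
  apply: lerD; last exact: real_weight.
  by have := @real_weight s 1 isT s1; rewrite mul1r expr1.
by move/le_gtF; rewrite trace_gt2 // gt_eqF.
Qed.

Lemma spider_poly_expand A B : spider_poly A B =
  'X^(A + B + 3) + ('X^(A + 3) + 'X^(B + 3) + 'X^3 + 'X^2 *+ 2 + 'X *+ 2
   - 'X^(A + B) - 'X^A - 'X^B - 1 - 'X^(A + B + 2) *+ 2 - 'X^(A + B + 1) *+ 2).
Proof. by rewrite /spider_poly !exprD; ring. Qed.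

Lemma spider_poly_size A B : (2 <= A)%N -> (2 <= B)%N ->
  (A + B + 3 < size (map_poly (intr : int -> algC) (spider_poly A B)))%N.
Proof.
move=> A2 B2; rewrite ltnNge; apply/negP => /leq_sizeP/(_ _ (leqnn _)).
rewrite spider_poly_expand coef_map !(coefD, coefB, coefN, coefMn, coefXn, coefX, coef1) /=.
have E k : (k < A + B + 3)%N -> (A + B + 3 == k)%N = false by move=> h; rewrite gtn_eqF.
rewrite eqxx !E ?mul0rn; try lia.
by move/eqP; rewrite !(addr0, subr0, add0r, oppr0) oner_eq0.
Qed.

Lemma spider_root_neq0 A B (z : algC) : (2 <= A)%N -> (2 <= B)%N -> spider_fun A B z = 0 -> z != 0.
Proof.
move=> A2 B2; apply: contraPneq => ->; rewrite /spider_fun !expr0n !gtn_eqF ?addn_gt0 //; try lia.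
by rewrite mulr0 !mul0r subr0 sub0r !add0r !mulr1 => /eqP; rewrite oppr_eq0 oner_eq0.
Qed.

Section SpiderRoots.

Variables (A B : nat) (s : algC).
Hypotheses (A2 : (2 <= A)%N) (B2 : (2 <= B)%N) (s1 : 1 < s) (Es : spider_fun A B s = 0).
Local Notation P := (spider_poly A B).

Lemma root_multiplicity_split (rs : seq algC) (z : algC) k : (k <= count_mem z rs)%N ->
  exists rs', perm_eq rs (nseq k z ++ rs').
Proof.
move=> kz; exists (nseq (count_mem z rs - k) z ++ filter (predC (pred1 z)) rs).
rewrite catA -nseqD subnKC // -(perm_filterC (pred1 z)) perm_cat2r.
suff -> : filter (pred1 z) rs = nseq (count_mem z rs) z by [].
by rewrite -size_filter; apply/all_pred1P/filter_all.
Qed.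

Lemma spider_root_count (T : seq algC) :
  (forall z, spider_fun A B z = 0 -> z + 1 != 0 -> z \in T) -> (A + B + 1 <= size T)%N.
Proof.
move=> hT; have szq := spider_poly_size A2 B2; set q := map_poly _ _ in szq.
have [rs qE] := closed_field_poly_normal q; set c := lead_coef q in qE.
have c0 : c != 0 by rewrite lead_coef_eq0 -size_poly_eq0 -lt0n; apply: leq_ltn_trans szq.
have szr : (A + B + 3 <= size rs)%N.
  by move: szq; rewrite qE size_scale // size_prod_XsubC ltnS.
have rE z : z \in rs -> spider_fun A B z = 0.
  move=> zr; rewrite -spider_polyE /int_eval -/q qE hornerZ; apply/eqP.
  by rewrite mulf_eq0 -[X in _ || X]/(root _ z) root_prod_XsubC zr orbT.
have split k z : (k <= count_mem z rs)%N ->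
    exists S, q = \prod_(x <- nseq k z) ('X - x%:P) * S.
  move/root_multiplicity_split => [rs' e]; exists (c *: \prod_(x <- rs') ('X - x%:P)).
  by rewrite qE (perm_big _ e) big_cat /= scalerAr.
have thE z : int_eval (euler_op P) z = (euler_op q).[z] by rewrite /int_eval map_euler_op.
have mN1 : (count_mem (-1 : algC)%R rs <= 2)%N.
  rewrite leqNgt; apply/negP => /split[S]; rewrite /= !big_cons big_nil mulr1 -!mulrA => qS.
  have := @spider_euler2_neg1 A B (ltnW A2).
  have -> : int_eval P (-1) = q.[-1] by [].
  rewrite thE /int_eval map_euler_op -/(map_poly _ _) map_euler_op -/q qS.
  rewrite euler_op2_root3 euler_op_root2 hornerM hornerXsubC subrr mul0r eqxx.
  by [].
have simple z : z + 1 != 0 -> (count_mem z rs <= 1)%N.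
  move=> z1; rewrite leqNgt; apply/negP => z2; have := z2.
  move/split => [S]; rewrite /= !big_cons big_nil mulr1 -!mulrA => qS.
  have Ez : spider_fun A B z = 0 by apply: rE; rewrite -has_pred1 has_count ltnW.
  have z0 := spider_root_neq0 A2 B2 Ez.
  by have := spider_simple_root A2 B2 s1 Es z0 z1 Ez; rewrite thE qS euler_op_root2 eqxx.
pose t := filter (predC1 (-1)) rs.
have tu : uniq t.
  apply: count_mem_uniq => z; rewrite count_filter (eq_count (a2 := fun x => (x == z) && (z != -1))) /=; last first.
    by move=> x /=; case: eqP => // ->.
  rewrite mem_filter /=; case: eqVneq => /= [_|z1].
    by rewrite (eq_count (a2 := pred0)) ?count_pred0 // => x; rewrite andbF.
  rewrite (eq_count (a2 := pred1 z)); last by move=> x; rewrite andbT.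
  have := simple z; rewrite addr_eq0 => /(_ z1); rewrite -has_pred1 has_count.
  by case: count => [|[]].
have tT : (size t <= size T)%N.
  apply: uniq_leq_size => // z; rewrite mem_filter /= => /andP[z1 /rE Ez].
  by apply: hT => //; rewrite addr_eq0.
have : size rs = (count_mem (-1)%R rs + size t)%N.
  by rewrite size_filter -(count_predC (pred1 (-1))).
move=> e; rewrite e in szr; move: (leq_trans szr (leq_add mN1 tT)).
by lia.
Qed.

End SpiderRoots.

Lemma spider_poly_monic A B : (2 <= A)%N -> (2 <= B)%N ->
  map_poly (intr : int -> algC) (spider_poly A B) \is monic.
Proof.
move=> A2 B2; have szq := spider_poly_size A2 B2.
set q := map_poly _ _ in szq *.
have cE k : (A + B + 3 <= k)%N -> q`_k = (k == A + B + 3)%:R.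
  move=> hk; rewrite /q.
  rewrite spider_poly_expand coef_map !(coefD, coefB, coefN, coefMn, coefXn, coefX, coef1) /=.
  have E j : (j < A + B + 3)%N -> (k == j)%N = false by move=> h; rewrite gtn_eqF //; lia.
  set b := (k == A + B + 3)%N; rewrite !(E (_ + _)%N) ?(E A) ?(E B) ?(E 0%N) ?(E 1%N) ?(E 2) ?(E 3); try lia.
  by rewrite ?mul0rn !(addr0, subr0, add0r, oppr0); case: b.
have sz : size q = (A + B + 3).+1.
  apply/eqP; rewrite eqn_leq szq andbT; apply/leq_sizeP => j hj.
  by rewrite cE ?(ltnW hj) // gtn_eqF.
by rewrite monicE lead_coefE sz /= cE // eqxx.
Qed.

Lemma spider_fun_inv A B (z : algC) : z != 0 -> spider_fun A B z = 0 -> spider_fun A B z^-1 = 0.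
Proof.
move=> z0; rewrite /spider_fun !exprVn exprD.
have := expf_neq0 A z0; have := expf_neq0 B z0; move: (z ^+ A) (z ^+ B) => X Y Y0 X0.
set e := (X in X = 0 -> _) => e0.
rewrite [LHS](_ : _ = - e / (z ^+ 3 * X * Y)); first by rewrite e0 oppr0 mul0r.
by rewrite /e; field; rewrite z0 X0 Y0.
Qed.

Lemma spider_root_Aint A B (z : algC) : (2 <= A)%N -> (2 <= B)%N -> spider_fun A B z = 0 ->
  z \in Aint.
Proof.
move=> A2 B2 Ez; apply: (root_monic_Aint _ (spider_poly_monic A2 B2)).
  by rewrite /root -[_.[z]]/(int_eval _ z) spider_polyE Ez.
by apply/polyOverP => i; rewrite coef_map /=; apply: intr_int.
Qed.

Lemma spider_root_lt A B (s : algC) : (0 < A)%N -> (0 < B)%N -> 1 < s -> spider_fun A B s = 0 ->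
  6%:R * s < 17%:R.
Proof.
move=> A0 B0 s1 Es; have s0 : 0 < s by apply: lt_trans s1.
have sR : 6%:R * s \is Num.real by rewrite gtr0_real // mulr_gt0 ?ltr0n.
rewrite real_ltNge ?realn //; apply/negP; rewrite -subr_ge0 => u0.
have pos : 0 <= s ^+ 3 - 1 - 2 * s * (s + 1).
  set u := _ - _ in u0; have -> : s ^+ 3 - 1 - 2 * s * (s + 1) =
    (u ^+ 3 + 39%:R * u ^+ 2 + 387%:R * u + 5%:R) / 216%:R by rewrite /u; field.
  by rewrite divr_ge0 ?ler0n // !addr_ge0 ?mulr_ge0 ?exprn_ge0 ?ler0n.
have X1 : 1 < s ^+ A by rewrite exprn_egt1 // -lt0n.
have Y1 : 1 < s ^+ B by rewrite exprn_egt1 // -lt0n.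
have : 0 < spider_fun A B s.
  rewrite /spider_fun exprD; move: (s ^+ A) (s ^+ B) X1 Y1 => X Y X1 Y1.
  rewrite [ltRHS](_ : _ = (s ^+ 3 - 1 - 2 * s * (s + 1)) * ((X + 1) * (Y + 1)) +
    2 * s * (s + 1) * (X + Y + 2)); last by ring.
  have X0 : 0 < X by apply: lt_trans X1.
  have Y0 : 0 < Y by apply: lt_trans Y1.
  apply: ltr_wpDl; last by rewrite !mulr_gt0 ?addr_gt0 ?ltr0n.
  by rewrite mulr_ge0 // ltW // !mulr_gt0 // addr_gt0.
by rewrite Es ltxx.
Qed.

Section SpiderField.

Variables (A B : nat) (s : algC).
Hypotheses (A2 : (2 <= A)%N) (B2 : (2 <= B)%N) (s1 : 1 < s) (Es : spider_fun A B s = 0).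
Variables (gT : finGroupType) (K : algC -> Prop) (nu : gT -> {rmorphism algC -> algC}).
Hypotheses (KA : abelian_field K nu) (Kb : K (s + s^-1)).
Hypothesis faithful : forall g, nu g (s + s^-1) = s + s^-1 -> g = 1%g.
Local Notation O := (integral_in K).

Let A0 : (0 < A)%N := ltnW A2.
Let B0 : (0 < B)%N := ltnW B2.

Lemma spider_trace_int : O (s + s^-1).
Proof.
split=> //; have s0 := spider_root_neq0 A2 B2 Es.
by apply: rpredD; apply: (spider_root_Aint A2 B2) => //; apply: spider_fun_inv.
Qed.

Lemma spider_fun_gal (f : {rmorphism algC -> algC}) z : spider_fun A B z = 0 -> spider_fun A B (f z) = 0.
Proof.
move/(congr1 f); rewrite rmorph0 => <-.
by rewrite /spider_fun !(rmorphB, rmorphD, rmorphM, rmorphXn, rmorph1, rmorph_nat).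
Qed.

Lemma spider_trace_circle g : g != 1%g ->
  exists2 z : algC, `|z| = 1 & nu g (s + s^-1) = z + z^-1.
Proof.
move=> g1; exists (nu g s); last by rewrite rmorphD fmorphV.
have Eg := spider_fun_gal (nu g) Es.
apply: contra_neq_eq g1 => gc; apply: faithful; rewrite rmorphD fmorphV.
exact: spider_root_unique (spider_root_neq0 A2 B2 Eg) gc Eg.
Qed.

Lemma spider_degree_le : (#|gT| <= 27)%N.
Proof.
rewrite leqNgt; apply/negP => d27; have d2 : (1 < #|gT|)%N by apply: leq_trans d27.
have := @degree_le_27 #|gT| _ d2; rewrite leqNgt d27 => /(_ _)/negP; apply => // p p_pr p5.
apply: (perron_norm_bound KA spider_trace_int s1 erefl spider_trace_circle) => //.
exact: spider_root_lt Es.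
Qed.

Lemma spider_root_conj z : spider_fun A B z = 0 ->
  (exists g, z + z^-1 = nu g (s + s^-1)) \/ exists2 n, (0 < n)%N & z ^+ n = 1.
Proof.
move=> Ez; have z0 := spider_root_neq0 A2 B2 Ez.
have [circ|/not_all_ex_not[y hy]] :=
   classic (forall y, root (minCpoly z) y -> `|y| = 1).
  by right; apply: kronecker circ; apply: (spider_root_Aint A2 B2).
have [ry yc] := imply_to_and _ _ hy; left; have Ey : spider_fun A B y = 0.
  have [r [rE _] rP] := minCpolyP z.
  have : root (map_poly ratr (map_poly intr (spider_poly A B))) z.
    rewrite -map_poly_comp (eq_map_poly (g := intr)) => [|k] /=; last by rewrite ratr_int.
    by rewrite /root -[_.[z]]/(int_eval _ z) spider_polyE Ez.
  rewrite rP => /dvdpP[h hE].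
  have : root (map_poly ratr (map_poly intr (spider_poly A B))) y.
    by rewrite hE rmorphM rootM; apply/orP; right; move: ry; rewrite rE.
  rewrite -map_poly_comp (eq_map_poly (g := intr)) => [|k] /=; last by rewrite ratr_int.
  by rewrite /root -[_.[y]]/(int_eval _ y) spider_polyE => /eqP.
have y0 := spider_root_neq0 A2 B2 Ey.
have yE : y + y^-1 = s + s^-1.
  by apply: spider_root_unique Ey => //; apply/eqP.
pose c i := Num.floor (gal_poly nu (s + s^-1))`_i.
have cE i : (c i)%:~R = (gal_poly nu (s + s^-1))`_i :> algC.
  by rewrite floorK // (gal_poly_int KA) //; apply: spider_trace_int.
pose H : {poly rat} := \sum_(i < #|gT|.+1) (c i)%:~R *: (('X ^+ 2 + 1) ^+ i * 'X ^+ (#|gT| - i)).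
have HE x : x != 0 -> (map_poly ratr H).[x] = x ^+ #|gT| * (gal_poly nu (s + s^-1)).[x + x^-1].
  move=> x0; rewrite /H rmorph_sum horner_sum horner_coef gal_polyE size_prod_XsubC size_gal_seq.
  rewrite mulr_sumr; apply: eq_bigr => i _.
  rewrite -gal_polyE -cE -mul_polyC !rmorphM /= !rmorphXn rmorphD rmorphXn rmorph1 /=.
  rewrite map_polyC map_polyX /= ratr_int !hornerE.
  rewrite (_ : x ^+ 2 + 1 = (x + x^-1) * x); last by field.
  have -> : x ^+ #|gT| = x ^+ i * x ^+ (#|gT| - i) by rewrite -exprD subnKC // -ltnS.
  by rewrite exprMn /=; ring.
have Hy : root (map_poly ratr H) y.
  by rewrite /root HE // yE (gal_poly_root KA) // mulr0.
have := conj_root_rat ry Hy; rewrite /root HE // mulf_eq0 expf_eq0 (negPf z0) andbF /=.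
rewrite gal_polyE -[_ == 0]/(root _ _) root_prod_XsubC => /imageP[g _ gE].
by exists g.
Qed.

Lemma spider_root_alt z : spider_fun A B z = 0 ->
  [\/ exists g, z + z^-1 = nu g (s + s^-1), z ^+ 24 = 1 | z ^+ A = -1 /\ z ^+ B = -1].
Proof.
move=> Ez; have [?|[n n0 zn]] := spider_root_conj Ez; first by apply: Or31.
by have [?|?] := spider_root_of_unity n0 zn Ez; [apply: Or32 | apply: Or33].
Qed.

(* This bounds the number of solutions of z^A = z^B = -1: there are none unless A and B have the
   same 2-adic valuation. *)
Definition neg_gcd : nat :=
  let g := gcdn A B in if odd (A %/ g) && odd (B %/ g) then g else 0%N.

Lemma neg_roots : exists2 T : seq algC, (size T <= neg_gcd)%N &
  forall z : algC, z ^+ A = -1 -> z ^+ B = -1 -> z \in T.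
Proof.
have [[z0 [zA zB]]|no] := classic (exists z0 : algC, z0 ^+ A = -1 /\ z0 ^+ B = -1); last first.
  by exists [::] => // z zA zB; case: no; exists z.
set g := gcdn A B.
have g0 : (0 < g)%N by rewrite gcdn_gt0 A0.
have AE : A = (g * (A %/ g))%N by rewrite mulnC divnK ?dvdn_gcdl.
have BE : B = (g * (B %/ g))%N by rewrite mulnC divnK ?dvdn_gcdr.
have cop : coprime (A %/ g) (B %/ g) by rewrite /coprime -(eqn_pmul2l g0) muln1 muln_gcdr -AE -BE.
have z00 : z0 != 0.
  by apply: contra_eq_neq zA => ->; rewrite expr0n gtn_eqF // eq_sym oppr_eq0 oner_eq0.
have pr k l : (z0 ^+ g) ^+ k = -1 -> (z0 ^+ g) ^+ l = -1 -> coprime k l -> odd k.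
  move=> zk zl kl; apply: contraT => ek.
  have ol : odd l.
    apply: contraT => el; have : (2 %| gcdn k l)%N by rewrite dvdn_gcd !dvdn2 ek el.
    by rewrite (eqP kl).
  have : (z0 ^+ g) ^+ k ^+ l = (z0 ^+ g) ^+ l ^+ k by apply: exprAC.
  rewrite zk zl -signr_odd ol -(signr_odd _ k) (negPf ek) expr1 expr0 => /esym/eqP.
  by rewrite -addr_eq0 (pnatr_eq0 _ 2).
have zA' : (z0 ^+ g) ^+ (A %/ g) = -1 by rewrite -exprM -AE.
have zB' : (z0 ^+ g) ^+ (B %/ g) = -1 by rewrite -exprM -BE.
have ne : neg_gcd = g.
  rewrite /neg_gcd -/g (pr _ _ zA' zB' cop) (pr _ _ zB' zA') //.
  by rewrite coprime_sym.
have [w wP] := C_prim_root_exists g0.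
exists [seq z0 * w ^+ i | i <- iota 0 g]; first by rewrite size_map size_iota ne.
move=> z hA hB; have zzA : (z / z0) ^+ A = 1 by rewrite exprMn exprVn hA zA divff // oppr_eq0 oner_eq0.
have zzB : (z / z0) ^+ B = 1 by rewrite exprMn exprVn hB zB divff // oppr_eq0 oner_eq0.
have zzg : (z / z0) ^+ g = 1.
  have [u v e _] := egcdnP B A0; rewrite -/g in e.
  have : (z / z0) ^+ (u * A) = 1 by rewrite mulnC exprM zzA expr1n.
  by rewrite e exprD (mulnC v) exprM zzB expr1n mul1r.
have [i iE] := prim_rootP wP zzg.
apply/mapP; exists (val i); first by rewrite mem_iota /= ltn_ord.
by rewrite -iE mulrC divfK.
Qed.

Lemma spider_size_le : (A + B <= 77 + neg_gcd)%N.
Proof.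
have [T Tsz TP] := neg_roots; have [w wP] := @C_prim_root_exists 24 isT.
pose T' := [seq nu g s | g : gT] ++ [seq (nu g s)^-1 | g : gT] ++
  [seq w ^+ i | i <- iota 0 24] ++ T.
have : (A + B + 1 <= size T')%N.
  apply: (spider_root_count A2 B2 s1 Es) => z Ez _; rewrite !mem_cat.
  have z0 := spider_root_neq0 A2 B2 Ez.
  have [[g zg]|z24|[zA zB]] := spider_root_alt Ez; last by rewrite (TP z) ?orbT.
    have y0 := spider_root_neq0 A2 B2 (spider_fun_gal (nu g) Es).
    have : (z - nu g s) * (z - (nu g s)^-1) = 0.
      transitivity (z * (z + z^-1 - (nu g s + (nu g s)^-1))); first by field; rewrite z0 y0.
      by rewrite zg rmorphD fmorphV subrr mulr0.
    move/eqP; rewrite mulf_eq0 !subr_eq0 => /orP[/eqP ->|/eqP ->]; first by rewrite image_f.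
    by rewrite [X in _ || (X || _)]image_f ?orbT.
  have [i ->] := prim_rootP wP z24.
  by rewrite (map_f (fun i => w ^+ i)) ?mem_iota ?ltn_ord ?orbT.
rewrite !size_cat !size_image size_map size_iota => le.
have := leq_trans le (leq_add spider_degree_le (leq_add spider_degree_le (leq_add (leqnn 24) Tsz))); lia.
Qed.

End SpiderField.

(** * Certificates modulo primes *)

Inductive ring_expr : Type :=
  | RVar | RNat of nat | RAdd of ring_expr & ring_expr | ROpp of ring_expr
  | RMul of ring_expr & ring_expr | RExp of ring_expr & nat.

Fixpoint expr_eval (x : algC) (e : ring_expr) : algC :=
  match e with
  | RVar => x
  | RNat n => n%:R
  | RAdd e1 e2 => expr_eval x e1 + expr_eval x e2
  | ROpp e1 => - expr_eval x e1
  | RMul e1 e2 => expr_eval x e1 * expr_eval x e2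
  | RExp e1 n => expr_eval x e1 ^+ n
  end.

Lemma Aint_natr k : k%:R \in Aint.
Proof. exact: (Aint_int k%:Z). Qed.

Lemma expr_eval_Aint x e : x \in Aint -> expr_eval x e \in Aint.
Proof.
move=> xA; elim: e => //= [k|e1 ? e2 ?|e1 ?|e1 ? e2 ?|e1 ? k].
- exact: Aint_natr.
- exact: rpredD.
- by rewrite rpredN.
- exact: rpredM.
exact: rpredX.
Qed.

Section IdealCongruence.

Variable I : algC -> Prop.
Hypothesis II : ideal_Aint I.

Lemma congrD a b c d : I (a - b) -> I (c - d) -> I (a + c - (b + d)).
Proof. by move=> ab cd; rewrite opprD addrACA; apply: (idealD II). Qed.

Lemma congrM a b c d : b \in Aint -> c \in Aint -> I (a - b) -> I (c - d) -> I (a * c - b * d).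
Proof.
move=> bA cA ab cd; rewrite (_ : _ - _ = (a - b) * c + b * (c - d)); last by ring.
by apply: (idealD II); [apply: (idealMr II) | apply: (idealMl II)].
Qed.

Lemma congrT a b c : I (a - b) -> I (b - c) -> I (a - c).
Proof. by move=> ab bc; rewrite -(subrKA b); apply: (idealD II). Qed.

End IdealCongruence.

Section QuadraticRing.

(* Arithmetic in Z[w] / (l, w^2 - t w + n) on coordinates in the basis 1, w. *)
Variables l t n : BinNums.N.
Local Notation addN := BinNat.N.add.
Local Notation mulN := BinNat.N.mul.
Local Notation modN := BinNat.N.modulo.
Local Notation quad := (BinNums.N * BinNums.N)%type.

Definition quad_add (x y : quad) : quad :=
  (modN (addN x.1 y.1) l, modN (addN x.2 y.2) l).

Definition quad_scale (k : BinNums.N) (x : quad) : quad :=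
  (modN (mulN k x.1) l, modN (mulN k x.2) l).

Definition quad_opp : quad -> quad := quad_scale (BinNat.N.pred l).

Definition quad_mul (x y : quad) : quad :=
  let d := mulN x.2 y.2 in
  (modN (addN (mulN x.1 y.1) (mulN (mulN (BinNat.N.pred l) n) d)) l,
   modN (addN (addN (mulN x.1 y.2) (mulN x.2 y.1)) (mulN t d)) l).

Fixpoint quad_pow (x : quad) (p : BinNums.positive) : quad :=
  match p with
  | BinNums.xH => x
  | BinNums.xO p' => let y := quad_pow x p' in quad_mul y y
  | BinNums.xI p' => let y := quad_pow x p' in quad_mul x (quad_mul y y)
  end.

Fixpoint quad_eval (e : ring_expr) : quad :=
  match e with
  | RVar => (BinNums.N0, BinNums.Npos BinNums.xH)
  | RNat k => (modN (BinNat.N.of_nat k) l, BinNums.N0)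
  | RAdd e1 e2 => quad_add (quad_eval e1) (quad_eval e2)
  | ROpp e1 => quad_opp (quad_eval e1)
  | RMul e1 e2 => quad_mul (quad_eval e1) (quad_eval e2)
  | RExp e1 k =>
      if BinNat.N.of_nat k is BinNums.Npos p then quad_pow (quad_eval e1) p
      else (BinNums.Npos BinNums.xH, BinNums.N0)
  end.

Definition quad_zero (x : quad) : bool :=
  BinNat.N.eqb x.1 BinNums.N0 && BinNat.N.eqb x.2 BinNums.N0.

Definition quad_norm (x : quad) : BinNums.N :=
  modN (addN (addN (mulN x.1 x.1) (mulN t (mulN x.1 x.2))) (mulN n (mulN x.2 x.2))) l.

Definition quad_unit (x : quad) : bool := ~~ BinNat.N.eqb (quad_norm x) BinNums.N0.

Variables (M : algC -> Prop) (w : algC).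
Local Notation ofN := BinNat.N.to_nat.
Hypotheses (l_pr : prime (ofN l)) (PM : prime_over (ofN l) M).
Hypothesis wE : w ^+ 2 = (ofN t)%:R * w - (ofN n)%:R.
Hypothesis wA : w \in Aint.

Let MI := prime_ideal_of PM.

Definition quad_val (x : quad) : algC := (ofN x.1)%:R + (ofN x.2)%:R * w.

Lemma quad_val_Aint x : quad_val x \in Aint.
Proof. by rewrite rpredD ?rpredM ?Aint_natr. Qed.

Lemma modN_congr a : M ((ofN a)%:R - (ofN (modN a l))%:R).
Proof.
have l0 : l <> BinNums.N0 by move=> l0; have := l_pr; rewrite l0.
have := BinNat.N.div_mod a l l0; move: (BinNat.N.div a l) (modN a l) => q r ->.
rewrite Nnat.N2Nat.inj_add Nnat.N2Nat.inj_mul natrD natrM addrK.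
by apply: (prime_over_pM PM); apply: Aint_natr.
Qed.

Lemma quad_modN u v a b : (ofN u)%:R + (ofN v)%:R * w = a -> b = (modN u l, modN v l) ->
  M (a - quad_val b).
Proof.
move=> <- ->; apply: (congrD MI); first exact: modN_congr.
by rewrite -mulrBl; apply: idealMr => //; apply: modN_congr.
Qed.

Lemma pred_congr : M ((ofN (BinNat.N.pred l))%:R + 1).
Proof.
rewrite natr1 Nnat.N2Nat.inj_pred prednK ?prime_gt0 //.
exact: prime_over_p PM.
Qed.

Lemma quad_add_congr x y : M (quad_val x + quad_val y - quad_val (quad_add x y)).
Proof.
apply: (quad_modN _ erefl); rewrite !Nnat.N2Nat.inj_add /quad_val !natrD; ring.
Qed.

Lemma quad_opp_congr x : M (- quad_val x - quad_val (quad_opp x)).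
Proof.
apply: (@congrT _ MI _ ((ofN (BinNat.N.pred l))%:R * quad_val x)).
  rewrite (_ : _ - _ = - (((ofN (BinNat.N.pred l))%:R + 1) * quad_val x)); last by ring.
  by apply: idealN => //; apply: idealMr pred_congr; rewrite ?quad_val_Aint.
by apply: (quad_modN _ erefl); rewrite !Nnat.N2Nat.inj_mul /quad_val !natrM; ring.
Qed.

Lemma quad_mul_congr x y : M (quad_val x * quad_val y - quad_val (quad_mul x y)).
Proof.
apply: (congrT MI) (quad_modN erefl erefl).
rewrite !(Nnat.N2Nat.inj_add, Nnat.N2Nat.inj_mul) !(natrD, natrM) /quad_val.
have := pred_congr; move: (ofN (BinNat.N.pred l))%:R => m Mm.
set e := _ - _.
have -> : e = - ((m + 1) * ((ofN n)%:R * ((ofN x.2)%:R * (ofN y.2)%:R))) +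
   (ofN x.2)%:R * (ofN y.2)%:R * (w ^+ 2 - ((ofN t)%:R * w - (ofN n)%:R)) by rewrite /e; ring.
rewrite wE subrr mulr0 addr0; apply: idealN => //; apply: idealMr Mm => //.
by rewrite !rpredM ?Aint_natr.
Qed.

Lemma quad_pow_congr x q p : x \in Aint -> M (x - quad_val q) ->
  M (x ^+ (BinPos.Pos.to_nat p) - quad_val (quad_pow q p)).
Proof.
move=> xA xq; elim: p => [p IHp|p IHp|] /=; last by rewrite expr1.
  rewrite Pnat.Pos2Nat.inj_xI exprS multE mulnC exprM; apply: (congrT MI) (quad_mul_congr _ _).
  apply: (congrM MI) => //; rewrite ?quad_val_Aint ?rpredX //.
  apply: (congrT MI) (quad_mul_congr _ _); rewrite expr2.
  by apply: (congrM MI); rewrite ?quad_val_Aint ?rpredX.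
rewrite Pnat.Pos2Nat.inj_xO multE mulnC exprM expr2; apply: (congrT MI) (quad_mul_congr _ _).
by apply: (congrM MI); rewrite ?quad_val_Aint ?rpredX.
Qed.

Lemma quad_eval_congr e : M (expr_eval w e - quad_val (quad_eval e)).
Proof.
have N0 : (ofN BinNums.N0)%:R = 0 :> algC by [].
have N1 : (ofN (BinNums.Npos BinNums.xH))%:R = 1 :> algC by [].
elim: e => /= [|k|e1 IH1 e2 IH2|e1 IH1|e1 IH1 e2 IH2|e1 IH1 k].
- by rewrite /quad_val N0 N1 add0r mul1r subrr; apply: ideal0.
- rewrite /quad_val N0 mul0r addr0 -[in k%:R](Nnat.Nat2N.id k); exact: modN_congr.
- by apply: (congrT MI) (quad_add_congr _ _); apply: (congrD MI).
- apply: (congrT MI) (quad_opp_congr _); rewrite -opprD; exact: idealN.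
- by apply: (congrT MI) (quad_mul_congr _ _); apply: (congrM MI); rewrite ?quad_val_Aint ?expr_eval_Aint.
have := Nnat.Nat2N.id k; case: (BinNat.N.of_nat k) => [<-|p <-] /=.
  by rewrite expr0 /quad_val N0 N1 mul0r addr0 subrr; apply: ideal0.
by apply: quad_pow_congr; rewrite ?expr_eval_Aint.
Qed.

Lemma quad_zero_expr e : quad_zero (quad_eval e) -> M (expr_eval w e).
Proof.
case/andP=> /BinNat.N.eqb_eq h1 /BinNat.N.eqb_eq h2; have := quad_eval_congr e.
by rewrite /quad_val h1 h2 /= mul0r addr0 subr0.
Qed.

Lemma quad_unit_expr e : quad_unit (quad_eval e) -> ~ M (expr_eval w e).
Proof.
move=> un Me; have : M (quad_val (quad_eval e)).
  rewrite (_ : quad_val _ = expr_eval w e - (expr_eval w e - quad_val (quad_eval e))); last by ring.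
  exact/(idealB MI Me)/quad_eval_congr.
move: un; rewrite /quad_unit /quad_norm; move: (quad_eval e) => [u v] /=.
set k := addN _ _ => un Muv.
have Mk : M (ofN k)%:R.
  have : M (quad_val (u, v) * ((ofN u)%:R + (ofN v)%:R * ((ofN t)%:R - w))).
    apply: (idealMr MI) => //; apply: rpredD; first exact: Aint_natr.
    by apply: rpredM; rewrite ?rpredB ?Aint_natr.
  congr M; rewrite /k !(Nnat.N2Nat.inj_add, Nnat.N2Nat.inj_mul) !(natrD, natrM) /quad_val /=.
  transitivity ((ofN u)%:R ^+ 2 + (ofN t)%:R * ((ofN u)%:R * (ofN v)%:R) +
    ((ofN t)%:R * w - w ^+ 2) * ((ofN v)%:R * (ofN v)%:R)); first by ring.
  by rewrite wE; ring.
have : M (ofN (modN k l))%:R.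
  rewrite (_ : _%:R = (ofN k)%:R - ((ofN k)%:R - (ofN (modN k l))%:R)); last by ring.
  exact/(idealB MI Mk)/modN_congr.
move/(prime_over_nat l_pr PM) => /dvdn_leq le.
have l0 : l <> BinNums.N0 by move=> l0; have := l_pr; rewrite l0.
have := BinNat.N.mod_lt k l l0; move: un le => /negPf /BinNat.N.eqb_neq.
move: (modN k l) => r; clear -r; move=> r0 le rl. lia.
Qed.

End QuadraticRing.

Definition pow_add1 n := RAdd (RExp RVar n) (RNat 1).
Definition pow_sub1 n := RAdd (RExp RVar n) (ROpp (RNat 1)).

Definition spider_expr A B : ring_expr :=
  RAdd (RMul (pow_sub1 3) (RMul (pow_add1 A) (pow_add1 B)))
    (ROpp (RMul (RMul (RMul (RNat 2) RVar) (pow_add1 1)) (pow_sub1 (A + B)))).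

Definition spider_euler_expr A B : ring_expr :=
  RAdd (RAdd (RMul (RMul (RNat 3) (RExp RVar 3)) (RMul (pow_add1 A) (pow_add1 B)))
     (RMul (pow_sub1 3) (RAdd (RMul (RMul (RNat A) (RExp RVar A)) (pow_add1 B))
                              (RMul (pow_add1 A) (RMul (RNat B) (RExp RVar B))))))
   (ROpp (RMul (RNat 2) (RAdd (RMul (RMul RVar (RAdd (RMul (RNat 2) RVar) (RNat 1))) (pow_sub1 (A + B)))
      (RMul (RMul RVar (pow_add1 1)) (RMul (RNat (A + B)) (RExp RVar (A + B))))))).

(* With b = x + 1/x this is x^l (b^l - b). *)
Definition trace_frobenius_expr l : ring_expr :=
  RAdd (RExp (pow_add1 2) l) (ROpp (RMul (pow_add1 2) (RExp RVar l.-1))).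

Lemma spider_exprE A B z : expr_eval z (spider_expr A B) = spider_fun A B z.
Proof. by rewrite /= /spider_fun !expr1; ring. Qed.

Lemma spider_euler_exprE A B z :
  expr_eval z (spider_euler_expr A B) = int_eval (euler_op (spider_poly A B)) z.
Proof.
rewrite /spider_poly !euler_opE !(int_evalB, int_evalD, int_evalM, int_evalMn, int_evalXn, int_eval1, int_eval0, int_evalX).
rewrite /= expr1 exprD -(mulr_natr (z ^+ A) A) -(mulr_natr (z ^+ B) B) -(mulr_natr _ (A + B)) natrD.
ring.
Qed.

Section Checker.
Variables A B : nat.
Local Notation N := BinNums.N.

Definition noncyclotomic_root (l t n : N) : bool :=
  let q e := quad_eval l t n e in
  [&& quad_zero (q (spider_expr A B)), quad_unit l t n (q (pow_sub1 24))
    & quad_unit l t n (q (pow_add1 A)) || quad_unit l t n (q (pow_add1 B))].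

(* (l, b, t, n): modulo l the polynomial has a simple root with trace x + 1/x = b and
   a root of trace outside F_l with minimal polynomial x^2 - t x + n. *)
Definition spider_certificate (c : N * N * N * N) : bool :=
  let: (l, b, t, n) := c in let one := BinNums.Npos BinNums.xH in
  [&& prime (BinNat.N.to_nat l), noncyclotomic_root l b one,
      quad_unit l b one (quad_eval l b one (spider_euler_expr A B)),
      noncyclotomic_root l t n
    & quad_unit l t n (quad_eval l t n (trace_frobenius_expr (BinNat.N.to_nat l)))].

End Checker.

Lemma quad_root_exists (t n : nat) : exists2 w : algC, w ^+ 2 = t%:R * w - n%:R & w \in Aint.
Proof.
pose d : algC := sqrtC (t%:R ^+ 2 - 4%:R * n%:R); pose w : algC := (t%:R + d) / 2.
have wE : w ^+ 2 = t%:R * w - n%:R.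
  transitivity ((t%:R ^+ 2 + 2 * t%:R * d + d ^+ 2) / 4%:R); first by rewrite /w; field.
  by rewrite sqrtCK /w; field.
exists w => //; pose r : {poly algC} := (- t%:R) *: 'X + (n%:R)%:P.
pose q := 'X^2 + r.
have szr : (size r < 3)%N.
  rewrite ltnS; apply: leq_trans (size_polyD _ _) _; rewrite geq_max.
  by rewrite (leq_trans (size_scale_leq _ _)) ?size_polyX // (leq_trans (size_polyC_leq1 _)).
apply: (@root_monic_Aint q).
- rewrite /root /q /r hornerD hornerXn hornerD hornerZ hornerX hornerC wE.
  by apply/eqP; ring.
- by rewrite monicE lead_coefDl ?size_polyXn // lead_coefXn.
apply/polyOverP => i; rewrite /q /r coefD coefXn coefD coefZ coefX coefC.
by apply: rpredD; rewrite ?rpred_nat //; apply: rpredD; [apply: rpredM|case: ifP]; rewrite ?rpredN ?rpred0 ?rpred_nat.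
Qed.

Lemma expr_eval_congr p M e x y : prime_over p M -> x \in Aint -> y \in Aint -> M (x - y) ->
  M (expr_eval x e - expr_eval y e).
Proof.
move=> PM xA yA xy; have MI := prime_ideal_of PM; have eA := expr_eval_Aint.
elim: e => //= [k|e1 IH1 e2 IH2|e1 IH1|e1 IH1 e2 IH2|e1 IH1 k].
- by rewrite subrr; apply: ideal0.
- by apply: (congrD MI).
- by rewrite -opprD; apply: idealN.
- by apply: (congrM MI) => //; apply: eA.
by apply: (prime_over_congrX PM) => //; apply: eA.
Qed.

Lemma fermat_trace_frobenius p M (b : nat) w : prime p -> prime_over p M -> w \in Aint ->
  w ^+ 2 = b%:R * w - 1%:R -> M (expr_eval w (trace_frobenius_expr p)).
Proof.
move=> p_pr PM wA wE; have MI := prime_ideal_of PM.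
have -> : expr_eval w (trace_frobenius_expr p) = ((b ^ p)%:R - b%:R) * w ^+ p.
  rewrite /= wE subrK exprMn natrX mulrBl; congr (_ - _).
  by rewrite -mulrA -exprS prednK ?prime_gt0.
apply: (idealMr MI); first exact: rpredX.
have le : (b <= b ^ p)%N.
  case: b {wE} => // b; rewrite -[leqLHS]expn1; apply: leq_pexp2l => //; exact: prime_gt0.
rewrite -natrB //; apply/(prime_over_nat p_pr PM).
by rewrite -eqn_mod_dvd // fermat_little.
Qed.

Section SpiderCertificate.

Variables (A B : nat) (s : algC).
Hypotheses (A2 : (2 <= A)%N) (B2 : (2 <= B)%N) (s1 : 1 < s) (Es : spider_fun A B s = 0).
Variables (gT : finGroupType) (K : algC -> Prop) (nu : gT -> {rmorphism algC -> algC}).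
Hypotheses (KA : abelian_field K nu) (Kb : K (s + s^-1)).
Hypothesis faithful : forall g, nu g (s + s^-1) = s + s^-1 -> g = 1%g.
Local Notation O := (integral_in K).

Let root_Aint z : spider_fun A B z = 0 -> z \in Aint := @spider_root_Aint A B z A2 B2.
Let root_inv z : spider_fun A B z = 0 -> spider_fun A B z^-1 = 0.
Proof. by move=> Ez; apply: spider_fun_inv => //; apply: (spider_root_neq0 A2 B2). Qed.

Section ModPrime.
Variables (p : nat) (M : algC -> Prop).
Hypotheses (p_pr : prime p) (PM : prime_over p M).
Let MI := prime_ideal_of PM.

Lemma spider_root_lift x : x \in Aint -> M (spider_fun A B x) ->
  exists2 z, spider_fun A B z = 0 & M (x - z).
Proof.
move=> xA; rewrite -spider_polyE /int_eval.
have [rs qE] := closed_field_poly_normal (map_poly (intr : int -> algC) (spider_poly A B)).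
have rE z : z \in rs -> spider_fun A B z = 0.
  move=> zr; apply/eqP; rewrite -spider_polyE /int_eval qE hornerZ.
  by rewrite mulf_eq0 -[X in _ || X]/(root _ z) root_prod_XsubC zr orbT.
move: qE; have /monicP -> := spider_poly_monic A2 B2; rewrite scale1r => ->.
rewrite horner_prod (big_nth 0) big_mkord => /(prime_over_prod PM)[i _|i _].
  by rewrite hornerXsubC rpredB // root_Aint // rE // mem_nth.
by rewrite hornerXsubC => Mi; exists rs`_i => //; rewrite rE // mem_nth.
Qed.

Lemma spider_root_congr z y : spider_fun A B z = 0 -> spider_fun A B y = 0 -> M (z - y) ->
  ~ M (expr_eval z (spider_euler_expr A B)) -> z = y.
Proof.
move=> Ez Ey Mzy; rewrite spider_euler_exprE /int_eval map_euler_op.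
have [rs qE] := closed_field_poly_normal (map_poly (intr : int -> algC) (spider_poly A B)).
move: qE; have /monicP -> := spider_poly_monic A2 B2; rewrite scale1r => qE.
have rE x : spider_fun A B x = 0 <-> x \in rs.
  rewrite -root_prod_XsubC -qE /root -[_.[x]]/(int_eval _ x) spider_polyE.
  by split=> [->|/eqP].
rewrite qE => nM; apply: NNPP => /eqP zy; apply: nM.
have zr : z \in rs by apply/rE.
have yr : y \in rem z rs.
  have yr : y \in rs by apply/rE.
  by have := perm_mem (perm_to_rem zr) y; rewrite yr inE eq_sym (negPf zy).
rewrite (perm_big _ (perm_to_rem zr)) big_cons euler_opM.
rewrite (_ : euler_op ('X - z%:P) = 'X); last by rewrite /euler_op derivXsubC mulr1.
rewrite hornerD [X in _ + X]hornerM hornerXsubC subrr mul0r addr0.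
rewrite (perm_big _ (perm_to_rem yr)) big_cons !hornerM hornerX hornerXsubC.
have zA := root_Aint Ez; apply: (idealMl MI) => //; apply: (idealMr MI) Mzy.
rewrite horner_prod big_seq rpred_prod // => x /mem_rem/mem_rem/rE Ex.
by rewrite hornerXsubC rpredB ?root_Aint.
Qed.

Variables (z : algC) (h : gT).
Hypotheses (Ez : spider_fun A B z = 0) (zh : z + z^-1 = nu h (s + s^-1)).
Hypothesis simple : ~ M (expr_eval z (spider_euler_expr A B)).

Lemma spider_gal_congr g : M (nu g (z + z^-1) - (z + z^-1)) -> g = 1%g.
Proof.
move=> Mg; apply: faithful; apply: (fmorph_inj (nu h)).
have Kgb : K (nu g (s + s^-1)) by apply: (abf_gal KA).
rewrite -(abf_galC KA g h Kb) -zh; move: Mg; rewrite rmorphD fmorphV.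
have Eg := spider_fun_gal (nu g) Ez; move: (nu g z) Eg => y Ey.
have [z0 y0] := (spider_root_neq0 A2 B2 Ez, spider_root_neq0 A2 B2 Ey).
move=> Myz; have : M ((z - y) * (z - y^-1)).
  rewrite (_ : _ * _ = - z * (y + y^-1 - (z + z^-1))); last by field; rewrite z0 y0.
  by apply: (idealMl MI) => //; rewrite rpredN root_Aint.
have [zA yA yVA] := And3 (root_Aint Ez) (root_Aint Ey) (root_Aint (root_inv Ey)).
case/(prime_over_mul PM (rpredB zA yA) (rpredB zA yVA)) => /spider_root_congr.
  by move=> <-.
by move=> ->; rewrite ?invrK 1?addrC //; apply: root_inv.
Qed.

Hypothesis zp : M (expr_eval z (trace_frobenius_expr p)).

Lemma trace_frobenius x : spider_fun A B x = 0 ->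
  expr_eval x (trace_frobenius_expr p) = x ^+ p * ((x + x^-1) ^+ p - (x + x^-1)).
Proof.
move=> Ex; have x0 := spider_root_neq0 A2 B2 Ex; rewrite /= expr2.
have -> : x * x + 1 = x * (x + x^-1) by field.
rewrite exprMn mulrBr; congr (_ - _).
by rewrite -{2}(prednK (prime_gt0 p_pr)) exprS; ring.
Qed.

Lemma unit_ideal x a : spider_fun A B x = 0 -> a \in Aint -> M (x ^+ p * a) -> M a.
Proof.
move=> Ex aA Ma; have x0 := spider_root_neq0 A2 B2 Ex.
rewrite -[a](mulKf (expf_neq0 p x0)) -exprVn; apply: (idealMl MI) => //.
by rewrite rpredX // root_Aint // root_inv.
Qed.

Lemma root_trace_Aint x : spider_fun A B x = 0 -> x + x^-1 \in Aint.
Proof. by move=> Ex; rewrite rpredD // root_Aint // root_inv. Qed.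

Lemma spider_frobenius_trivial x k : spider_fun A B x = 0 -> x + x^-1 = nu k (s + s^-1) ->
  M (expr_eval x (trace_frobenius_expr p)).
Proof.
move=> Ex xk.
have Otr y m : y + y^-1 = nu m (s + s^-1) -> O (y + y^-1).
  by move=> ->; apply: (int_in_gal KA); apply: (spider_trace_int A2 B2 Es Kb).
have [phi phiP] : exists phi : gT, forall y : algC, O y -> M (nu phi y - y ^+ p).
  apply: (frobenius_exists KA p_pr PM) => g g1 inert; move/eqP: g1; apply.
  apply: spider_gal_congr; apply: inert; exact: Otr zh.
have phi1 : phi = 1%g.
  apply: spider_gal_congr; apply: (congrT MI (phiP _ (Otr _ _ zh))).
  apply: (unit_ideal Ez); first by rewrite rpredB ?rpredX ?root_trace_Aint.
  by rewrite -trace_frobenius.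
have Ox := Otr _ _ xk; have := phiP _ Ox; rewrite phi1 (abf_gal1 KA); last by case: Ox.
rewrite trace_frobenius // => /(idealN MI); rewrite opprB => Mx.
by apply: (idealMl MI) => //; rewrite rpredX // root_Aint.
Qed.

End ModPrime.

Lemma noncyclotomic_root_lift (l t n : BinNums.N) (M : algC -> Prop) :
  prime (BinNat.N.to_nat l) -> prime_over (BinNat.N.to_nat l) M -> noncyclotomic_root A B l t n ->
  exists w z g, [/\ w ^+ 2 = (BinNat.N.to_nat t)%:R * w - (BinNat.N.to_nat n)%:R, w \in Aint,
    spider_fun A B z = 0, M (w - z) & z + z^-1 = nu g (s + s^-1)].
Proof.
move=> l_pr PM /and3P[zE u24 uAB]; have MI := prime_ideal_of PM.
have [w wE wA] := quad_root_exists (BinNat.N.to_nat t) (BinNat.N.to_nat n).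
have Mw := quad_zero_expr l_pr PM wE wA zE; rewrite spider_exprE in Mw.
have [z Ez Mwz] := spider_root_lift PM wA Mw; have zA := root_Aint Ez.
have nz e : quad_unit l t n (quad_eval l t n e) -> expr_eval z e <> 0.
  move=> /(quad_unit_expr l_pr PM wE wA) nM e0; apply: nM.
  by have := expr_eval_congr e PM wA zA Mwz; rewrite e0 subr0.
exists w, z; have [[g zg]|z24|[zAN zBN]] := spider_root_alt A2 B2 s1 Es KA Kb Ez.
- by exists g.
- by case: (nz _ u24); rewrite /= z24 subrr.
by case/orP: uAB => /nz; rewrite /= ?zAN ?zBN addNr.
Qed.

Lemma spider_certificate_sound c : ~ spider_certificate A B c.
Proof.
case: c => [[[l b] t] n] /and5P[l_pr nb ub nt ut].
have [M PM] := prime_over_exists l_pr; have MI := prime_ideal_of PM.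
have [w [z [g [wE wA Ez Mwz zg]]]] := noncyclotomic_root_lift l_pr PM nb.
have [w' [x [k [w'E w'A Ex Mwx xk]]]] := noncyclotomic_root_lift l_pr PM nt.
have zA := root_Aint Ez; have xA := root_Aint Ex.
apply: (quad_unit_expr l_pr PM w'E w'A ut).
have Mx : M (expr_eval x (trace_frobenius_expr (BinNat.N.to_nat l))).
  apply: (spider_frobenius_trivial l_pr PM Ez zg _ _ Ex xk).
    move=> Mz; apply: (quad_unit_expr l_pr PM wE wA ub).
    have := idealD MI (expr_eval_congr (spider_euler_expr A B) PM wA zA Mwz) Mz.
    by rewrite subrK.
  have := expr_eval_congr (trace_frobenius_expr (BinNat.N.to_nat l)) PM zA wA.
  rewrite -opprB => /(_ (idealN MI Mwz)) h.
  by have := idealD MI h (fermat_trace_frobenius l_pr PM wA wE); rewrite subrK.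
have := idealD MI (expr_eval_congr (trace_frobenius_expr (BinNat.N.to_nat l)) PM w'A xA Mwx) Mx.
by rewrite subrK.
Qed.

End SpiderCertificate.

Declare Scope binary_scope.
Delimit Scope binary_scope with bin.
Number Notation BinNums.N BinNat.N.of_num_uint BinNat.N.to_num_uint : binary_scope.

(* The entries follow the order of [exceptional_pairs]; they were found by computer search, trying
   the primes l in increasing order. *)
Definition certificate_table : seq (BinNums.N * BinNums.N * BinNums.N * BinNums.N) := ([::
  (23,11,8,9);(23,14,3,9);(29,8,2,3);(61,41,42,16);(11,8,0,3);(43,12,2,32);(47,27,3,20);(19,16,11,3);(67,7,64,7);
  (47,3,4,10);(79,75,8,78);(89,48,87,63);(37,10,34,11);(67,35,41,36);(11,8,6,2);(13,7,1,4);(107,66,75,55);(61,25,7,5);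
  (67,62,53,5);(37,28,24,4);(103,41,94,22);(53,49,40,8);(13,3,11,6);(107,74,4,16);(11,8,0,3);(47,3,3,23);(37,30,11,3);
  (137,124,31,27);(41,37,5,3);(29,26,1,4);(11,4,7,7);(17,9,14,10);(103,5,42,70);(53,27,21,13);(11,8,2,2);
  (41,37,23,16);(43,29,0,21);(23,17,7,4);(73,3,33,40);(37,24,16,10);(47,38,41,11);(13,6,12,4);(31,17,25,18);
  (31,19,10,12);(61,51,12,6);(23,14,14,11);(17,3,11,4);(79,46,59,7);(13,8,5,5);(43,13,32,15);(23,12,10,15);
  (17,12,7,2);(59,39,36,18);(23,19,6,2);(73,7,43,35);(37,28,25,4);(29,16,24,2);(31,21,9,6);(53,41,20,33);(19,13,12,4);
  (11,4,4,2);(19,15,18,9);(83,47,32,47);(107,29,64,11);(11,8,0,3);(167,27,25,40);(59,19,20,42);(23,14,3,9);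
  (157,15,108,29);(37,10,17,4);(41,5,13,2);(13,7,4,2);(59,7,31,44);(47,30,25,28);(113,5,43,61);(23,12,14,4);
  (19,16,17,2);(43,32,38,30);(41,19,34,26);(17,5,11,4);(83,43,33,2);(19,3,7,9);(11,3,6,2);(157,146,7,109);
  (53,30,20,17);(53,40,6,12);(17,12,10,11);(47,14,15,28);(47,3,46,26);(19,12,5,3);(19,3,12,3);(17,4,4,11);
  (59,35,34,11);(31,6,10,12);(163,36,45,39);(67,4,57,5);(31,11,14,7);(29,4,13,4);(43,17,29,30);(29,16,9,2);
  (71,41,26,47);(41,9,38,6);(31,3,30,10);(37,11,12,7);(23,11,13,3);(97,22,35,12);(31,10,29,10);(11,3,9,2);
  (31,6,12,14);(17,4,3,5);(67,7,3,23);(17,5,8,11);(11,3,1,7);(43,30,40,5);(97,27,20,41);(53,9,49,6);(13,10,7,2);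
  (29,11,7,8);(47,8,11,4);(29,19,8,2);(29,13,21,4);(53,47,34,22);(61,10,37,43);(41,33,31,13);(131,104,78,2);
  (41,13,39,8);(19,3,7,9);(41,22,30,8);(43,7,4,20);(23,13,19,17);(59,3,1,27);(31,14,11,11);(29,12,1,5);(61,16,36,9);
  (71,35,16,17);(19,3,8,8);(41,8,19,5);(43,18,1,9);(19,6,8,3);(19,10,11,3);(163,40,151,24);(173,38,106,102);
  (89,23,12,79);(83,28,80,33);(59,27,22,18);(11,4,6,3);(19,8,8,14);(19,12,12,14);(17,3,14,5);(31,3,3,15);
  (163,103,89,74);(31,4,16,6);(37,19,1,6);(19,10,7,2);(43,20,19,19);(11,4,5,2);(31,16,16,4);(71,34,60,31);
  (71,19,13,5);(137,38,91,65);(17,8,1,8);(47,11,46,13);(61,55,22,10);(37,9,6,11);(31,3,22,15);(151,113,92,60);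
  (19,8,11,8);(59,32,30,42);(73,49,35,18);(29,17,13,14);(79,48,9,11);(73,30,28,19);(47,27,44,3);(23,12,22,15);
  (17,9,9,2);(11,4,6,3);(41,5,5,8);(67,45,29,40);(107,79,39,21);(41,23,16,9);(17,4,15,11);(19,6,1,9);(19,13,6,6);
  (19,12,16,4);(37,21,27,12);(23,4,4,5);(31,16,22,7);(67,55,33,8);(83,49,32,8);(71,41,12,14);(53,23,44,28);
  (103,49,2,3);(31,28,30,15);(19,15,12,2);(19,11,5,9);(139,113,93,94);(19,7,12,7);(53,21,16,13);(31,27,9,2);
  (31,17,20,23);(67,38,55,2);(59,5,24,18);(59,44,31,6);(17,10,9,11);(79,31,44,59);(11,4,6,3);(19,8,13,6);(67,4,32,14);
  (43,32,15,30);(23,14,3,9);(37,7,34,6);(37,26,4,23);(17,12,8,10);(61,3,15,15);(19,7,12,9);(23,12,21,7);(19,9,7,9);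
  (19,3,5,18);(13,7,7,2);(13,6,1,2);(71,33,11,31);(97,18,42,32);(19,12,13,6);(13,3,12,3);(17,9,8,11);(47,10,33,39);
  (23,11,0,4);(37,25,13,2);(37,10,3,13);(29,18,26,7);(19,16,12,7);(37,11,5,36);(43,12,21,16);(59,12,7,31);(17,4,6,3);
  (61,54,56,19);(67,32,52,43);(23,11,7,4);(13,5,5,5);(31,25,21,2);(107,23,6,13);(23,10,17,11);(29,25,0,2);(19,9,5,8);
  (43,31,16,19);(43,33,38,12);(37,21,10,3);(17,13,10,3);(37,24,2,21);(53,25,49,6);(29,18,9,5);(157,22,50,71);
  (17,4,11,2);(97,42,0,23);(47,13,15,25);(17,3,1,10);(47,4,11,13);(67,35,16,23);(101,57,14,41);(17,5,15,8);
  (61,7,37,24);(19,9,7,9);(101,80,94,40);(13,10,9,6);(61,4,20,16);(13,3,12,3);(37,10,21,7);(13,7,12,2);(53,4,27,8);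
  (79,44,65,21);(13,10,1,4);(19,3,4,2);(79,14,34,15);(41,23,39,13);(89,6,77,6);(29,7,21,4);(53,8,28,23);(31,27,9,5);
  (61,21,16,11);(19,9,18,14);(67,32,20,13);(61,46,34,22);(59,45,15,19);(149,106,97,78);(107,63,98,25);(17,10,10,5);
  (37,20,5,3);(67,25,2,11);(37,21,21,21);(29,25,25,2);(97,94,6,16);(19,9,2,2);(29,20,3,14);(23,4,18,15);(17,5,3,4);
  (47,26,2,35);(19,13,14,3);(41,10,36,20);(101,72,14,3);(17,13,8,2);(157,11,129,92);(79,48,64,19);(31,19,20,15);
  (31,6,27,5);(71,29,1,23);(89,68,0,59);(67,12,40,7);(31,9,20,12);(71,26,19,11);(173,97,6,36);(11,8,1,7);(59,37,32,6);
  (139,71,66,18);(109,27,54,33);(79,48,30,11);(37,4,31,17);(31,13,30,10);(17,13,16,8);(47,20,3,17);(79,6,77,6);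
  (11,8,10,7);(73,18,6,31);(97,23,55,24);(29,22,12,4);(101,12,61,11);(109,6,91,34);(31,13,28,11);(107,75,79,61);
  (71,33,10,3);(31,22,28,18);(79,23,78,6);(17,3,6,4);(31,19,12,10);(43,40,12,17);(23,14,16,13);(13,10,12,4);
  (281,98,27,7);(11,4,7,7);(67,8,45,22);(89,6,53,19);(11,8,3,3);(37,23,14,4);(59,17,11,39);(97,18,78,20);(17,13,14,5);
  (19,9,5,8);(17,12,4,11);(13,6,3,4);(17,10,9,10);(23,12,11,15);(19,16,10,4);(23,17,14,9);(29,16,17,4);(19,11,13,7);
  (61,46,29,2);(61,49,55,3);(31,17,8,23);(71,17,23,16);(53,34,51,4);(19,6,0,4);(67,33,35,25);(11,4,8,3);(43,25,26,12);
  (47,10,42,39);(13,7,9,6);(29,8,26,14);(19,16,3,18);(11,8,2,2);(43,33,18,16);(47,14,4,25);(47,8,8,20);(103,43,38,28);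
  (23,6,3,11);(41,10,26,27);(59,37,21,33);(23,13,10,11);(41,29,7,5);(19,7,1,2);(37,23,26,2);(19,6,17,8);(29,16,5,9);
  (41,5,4,17);(61,6,57,36);(17,10,0,5);(19,16,12,14);(17,3,3,4);(79,62,66,4);(11,8,0,3);(31,17,0,10);(53,32,36,33);
  (29,10,13,3);(47,26,7,26);(13,7,4,6);(61,41,27,17);(47,9,1,2);(19,7,0,4);(151,102,134,18);(59,18,55,39);
  (47,6,31,20);(19,6,12,2);(89,67,68,5);(31,11,5,2);(19,16,3,8);(73,59,51,28);(167,72,63,48);(47,34,0,7);
  (89,13,20,59);(107,17,20,34);(89,5,72,63);(181,176,120,70);(41,13,19,17);(23,12,21,4);(43,37,9,5);(19,7,13,7);
  (19,8,9,3);(17,4,0,5);(23,6,11,17);(37,17,11,2);(17,14,1,2);(47,20,1,15);(29,14,19,14);(31,25,7,30);(137,132,76,77);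
  (13,3,1,4);(167,49,165,22);(23,9,16,3);(67,6,9,52);(41,31,19,5);(29,6,23,7);(37,31,2,9);(47,28,33,14);(11,4,8,3);
  (67,40,11,9);(11,3,6,2);(29,12,27,9);(47,14,9,35);(53,3,38,35);(61,58,9,43);(83,21,41,49);(53,10,17,24);
  (103,35,57,2);(53,7,27,7);(13,8,7,4);(11,3,5,7);(37,4,15,2);(47,38,34,25);(53,9,43,5);(19,15,13,7);(23,10,9,5);
  (37,13,4,18);(17,10,4,11);(13,3,3,5);(47,10,27,7);(23,4,8,11);(29,11,4,14);(41,13,3,5);(53,45,45,28);(13,6,8,5);
  (29,6,14,23);(61,4,0,43);(41,11,3,27);(23,13,9,7);(31,4,15,12);(37,16,1,11);(47,16,15,23);(29,14,22,23);
  (53,18,45,8);(37,14,33,2);(17,10,15,11);(17,3,10,11);(29,21,23,7);(11,4,2,5);(73,44,45,36);(19,8,17,6);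
  (41,11,29,10);(23,4,10,15);(53,19,43,6);(13,8,6,4);(31,10,12,7);(13,3,12,2);(37,17,26,3);(11,8,7,7);(97,4,19,7);
  (67,21,58,5);(59,49,7,47);(13,6,3,6);(31,4,4,5);(83,71,0,11);(23,17,9,15);(31,15,16,12);(17,5,0,5);(89,59,67,20);
  (37,19,13,18);(47,14,33,6);(17,9,14,10);(13,8,10,5);(109,8,24,33);(29,20,15,5);(53,40,46,4);(19,8,16,14);
  (41,9,19,5);(73,62,72,34);(31,28,24,14);(67,16,35,11);(17,13,6,2);(83,5,26,29);(37,5,22,4);(103,9,46,18);
  (37,12,18,2);(43,17,34,4);(23,17,15,2);(13,7,11,6);(37,33,35,6);(17,8,1,8);(67,54,63,43);(19,6,4,2);(109,32,67,18);
  (47,26,21,17);(79,11,24,5);(31,15,7,30);(31,6,17,3);(149,10,124,76);(17,5,0,5);(107,6,80,7);(41,37,35,20);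
  (101,49,2,28);(61,3,12,6);(47,4,45,26);(13,5,2,6);(53,17,43,22);(31,9,13,4);(73,19,13,53);(31,28,16,22);
  (47,38,8,20);(23,4,16,13);(31,6,25,11);(59,53,11,2);(47,29,4,5);(43,32,8,20);(31,24,9,4);(23,12,1,22);(67,55,21,32);
  (67,39,36,18);(79,69,12,57);(47,37,27,13);(37,19,33,18);(13,6,1,4);(31,3,14,12);(47,42,45,5);(31,10,2,15);
  (31,26,12,10);(23,4,15,9);(43,25,21,3);(17,7,10,5);(73,58,24,29);(29,14,22,2);(73,16,7,5);(53,10,13,7);
  (71,17,41,28);(59,44,47,3);(13,6,6,3);(17,4,1,10);(17,7,10,3);(19,7,18,9);(23,9,7,7);(47,3,30,6);(53,9,9,15);
  (43,30,8,25);(31,4,29,5);(53,43,33,13);(19,16,10,3);(37,4,10,2);(47,17,21,5);(41,33,8,13);(13,6,12,3);(29,25,28,3);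
  (113,43,19,14);(31,3,22,11);(103,78,54,16);(61,20,25,30);(67,5,31,11);(79,46,0,2);(131,65,126,13);(31,11,14,15);
  (23,4,21,2);(97,45,81,19);(19,10,12,14);(17,10,6,3);(113,103,27,2);(79,18,29,38);(19,7,8,8);(29,3,15,23);(17,8,9,4);
  (41,26,5,10);(61,15,55,30);(23,4,1,22);(53,47,10,13);(29,22,1,4);(97,26,62,20);(17,5,2,8);(13,6,6,3);(19,7,4,2);
  (71,45,1,21);(73,34,41,6);(37,18,7,23);(13,8,3,5);(37,14,34,17);(79,43,26,5);(97,44,23,63);(73,6,16,12);(13,6,4,6);
  (71,24,39,62);(13,8,11,6);(163,76,21,85);(41,11,35,12);(83,33,33,5);(61,9,0,43);(31,16,11,23);(41,21,39,4);
  (101,64,27,53);(67,31,7,18);(31,10,14,12);(37,8,21,5);(19,9,11,6);(31,15,11,14);(73,7,29,7);(31,26,13,7);(23,4,1,7);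
  (83,11,14,82);(17,14,11,4);(31,7,24,3);(67,10,43,26);(107,84,42,40);(113,19,61,22);(59,40,11,2);(67,41,11,29);
  (17,4,6,2);(73,49,26,6);(17,9,14,5);(191,111,91,77);(19,16,13,6);(139,74,92,75);(127,50,64,29);(67,37,15,25);
  (31,3,19,2);(67,14,66,33);(89,11,56,29);(37,24,23,7);(17,7,10,2);(23,4,6,15);(61,57,4,6);(67,12,66,5);(37,16,24,13);
  (53,13,29,24);(31,15,12,7);(31,5,8,4);(17,8,13,11);(107,46,71,28);(151,73,55,26);(79,42,52,14);(67,47,0,6);
  (31,7,1,15);(19,16,5,3);(23,12,6,13);(11,8,5,3);(29,18,8,2);(19,12,13,14);(17,4,1,8);(79,47,37,3);(29,7,18,2);
  (53,4,27,37);(31,10,19,10);(29,15,24,2);(83,23,20,38);(61,6,24,16);(83,69,54,10);(83,17,23,17);(31,17,16,12);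
  (103,62,96,90);(13,5,7,3);(197,154,37,24);(37,3,2,7);(13,7,1,5);(23,6,1,9);(17,7,9,2);(43,39,24,3);(67,41,3,36);
  (19,10,16,14);(41,3,28,3);(37,7,13,4);(41,20,37,34);(61,16,21,11);(41,33,33,9);(43,7,32,7);(11,8,5,3);(19,3,7,9);
  (103,50,74,6);(53,4,36,4);(19,16,11,4);(83,26,65,29);(43,3,4,17);(103,36,102,49);(19,12,9,3);(41,21,12,9);
  (41,18,13,8);(19,10,1,3);(43,6,32,8);(23,12,6,2);(41,3,0,26);(53,19,4,26);(11,4,7,7);(29,7,1,19);(17,14,9,10);
  (53,4,42,22);(13,10,1,3);(131,64,107,38);(17,5,8,2);(47,6,13,28);(67,6,43,3);(29,4,1,19);(19,7,14,9);(41,20,3,5);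
  (53,39,52,6);(19,16,7,7);(59,31,36,18);(101,45,11,33);(47,9,3,4);(29,14,13,9);(61,34,14,16);(97,78,76,30);
  (67,47,39,14);(47,39,6,13);(19,10,8,6);(37,24,0,5);(37,28,30,5);(13,10,11,6);(17,4,13,10);(17,10,4,10);(13,6,1,2);
  (73,58,17,9);(31,14,6,6);(61,4,38,12);(23,19,22,9);(31,9,9,2);(53,7,11,5);(53,8,25,35);(67,53,24,50);(67,17,52,20);
  (23,11,21,2);(29,4,27,16);(79,17,38,11);(23,4,14,15);(59,10,55,39);(107,41,93,84);(31,24,16,3);(89,13,44,24);
  (13,10,1,3);(17,3,10,3);(101,3,10,53);(41,8,0,13);(29,10,28,7);(59,27,44,21);(37,26,9,17);(29,17,2,3);(53,5,20,21);
  (19,7,9,4);(13,6,2,6);(61,58,30,7);(23,10,21,13);(83,34,63,46);(53,7,9,33);(83,27,60,23);(59,23,46,25);(67,48,24,3);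
  (23,19,16,3);(101,6,41,18);(23,6,1,7);(11,4,7,2);(37,6,12,7);(47,6,30,18);(19,6,12,2);(31,15,6,6);(19,16,17,2);
  (17,3,1,2);(103,55,36,47);(43,23,39,25);(19,3,7,3);(19,7,11,14);(31,14,6,10);(103,67,50,15);(41,22,15,2);
  (43,22,28,5);(103,42,80,4);(41,10,25,17);(151,35,9,10);(41,3,23,13);(19,10,0,4);(17,4,15,11);(17,8,11,4);
  (41,12,9,16);(19,16,8,8);(53,4,15,17);(59,22,32,2);(73,8,33,2);(29,21,22,23);(29,9,17,19);(53,44,50,44);
  (61,28,5,15);(59,14,4,7);(23,6,15,11);(31,7,29,15);(73,17,9,30);(53,25,2,4);(31,17,15,7);(19,7,9,3);(43,31,24,7);
  (17,13,8,11);(53,12,49,22);(41,32,24,10);(67,12,25,36);(17,10,4,10);(13,6,12,4);(43,12,39,14);(19,9,11,8);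
  (29,14,27,16);(67,52,17,4);(41,10,8,5);(59,8,32,49);(23,10,0,3);(43,24,38,5);(47,27,28,35);(31,11,25,23);
  (191,50,97,14);(47,20,44,39);(37,28,16,22);(13,6,7,2);(19,8,17,2);(19,13,7,4);(17,10,6,3);(23,10,11,3);(17,4,10,5);
  (19,9,5,18);(47,41,40,13);(29,7,8,19);(37,26,24,10);(89,8,43,22);(17,12,14,10);(53,13,52,6);(23,17,3,3);
  (71,5,53,11);(23,10,7,4);(61,49,14,5);(23,11,21,3);(37,32,34,12);(31,4,30,18);(47,26,18,5);(83,19,73,11);
  (107,69,32,37);(103,29,67,16);(37,30,6,22);(109,53,62,12);(17,9,14,3);(17,12,3,4);(37,26,32,11);(31,21,21,4);
  (53,29,9,10);(73,30,45,7);(29,20,5,9);(41,25,3,4);(61,10,15,30);(59,51,2,47);(29,26,24,14);(89,17,0,74);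
  (43,11,8,14);(43,27,39,2);(79,68,70,13);(37,18,12,4);(31,15,23,3);(13,3,6,4);(53,23,43,7);(53,16,18,7);(37,7,26,23);
  (23,6,2,3);(11,8,4,7);(89,11,53,27);(31,19,17,6);(71,25,56,28);(23,12,20,3);(61,9,8,10);(31,13,15,22);(29,10,28,4);
  (31,24,16,18);(29,14,8,28);(23,6,6,15);(61,20,39,36);(31,19,12,14);(37,25,10,5);(41,9,6,3);(41,22,24,2);
  (53,9,31,37);(61,10,41,10);(17,10,1,2);(83,65,4,20);(89,20,36,5);(13,8,4,12);(59,20,18,4);(37,24,4,22);(31,15,4,14);
  (53,14,23,8);(79,23,22,5);(19,10,2,2);(29,12,16,23);(43,37,14,21);(61,5,21,11);(47,27,22,31);(13,3,10,4);(31,4,7,7);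
  (61,12,53,14);(29,11,3,9);(47,8,19,3);(73,12,58,10);(61,19,56,19);(29,3,9,3);(79,55,73,45);(101,10,85,37);
  (71,11,38,38);(61,34,47,26);(37,11,17,8);(73,27,16,13);(17,4,14,5);(23,14,2,5);(43,14,8,9);(31,6,28,7);(17,12,2,11);
  (19,11,16,4);(67,50,52,22);(19,8,12,9);(61,56,51,43);(83,20,78,71);(53,7,0,14);(11,8,5,3);(37,10,11,6);(23,19,2,4);
  (43,36,14,16);(19,6,13,6);(13,10,5,5);(131,67,6,42);(37,4,14,10);(59,10,7,49);(43,25,32,9);(11,8,8,3);(37,31,22,8);
  (13,6,12,2);(79,13,19,54);(89,40,62,74);(23,4,21,2);(23,17,22,15);(41,23,31,10);(29,12,22,19);(107,41,105,2);
  (11,3,3,3);(97,29,35,8);(71,47,56,52);(47,17,19,26);(17,12,9,4);(53,21,26,24);(191,129,56,46);(61,28,39,10);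
  (13,5,1,5);(19,15,14,3);(11,3,7,7);(89,3,87,71);(109,56,2,69);(41,31,17,9);(67,31,11,4);(107,48,6,22);(71,61,26,10);
  (67,52,52,22);(67,12,35,11);(41,27,11,17);(79,59,54,23);(31,6,10,10);(13,5,2,6);(11,4,7,2);(17,4,7,11);(17,8,3,4);
  (41,23,40,34);(79,76,5,45);(31,25,30,22);(89,16,82,13);(89,78,54,63);(61,21,46,10);(47,31,41,15);(37,7,18,2);
  (17,3,3,8);(61,16,38,38);(17,12,14,10);(97,90,28,59);(67,18,45,12);(41,12,1,4);(61,26,35,29);(17,8,5,5);(11,8,6,3);
  (37,4,19,22);(41,8,30,9);(13,6,12,5);(97,65,23,6);(67,24,23,7);(47,33,30,26);(53,39,10,17);(41,12,4,23);(41,25,2,4);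
  (11,8,3,3);(59,55,19,22);(53,30,7,33);(67,43,60,2);(41,18,29,2);(59,19,38,22);(83,33,65,31);(151,59,36,69);
  (181,142,38,52);(157,36,84,61);(11,8,6,2);(107,64,80,7);(19,16,7,14);(31,11,12,7);(29,7,1,5);(61,21,21,60);
  (31,16,10,3);(47,4,44,23);(103,41,32,11);(107,77,58,42);(11,8,6,3);(59,15,3,7);(73,58,71,12);(37,28,9,9);
  (113,100,83,4);(13,3,1,5);(97,65,63,36);(139,41,65,68);(89,84,35,3);(109,65,71,32);(13,10,6,2);(19,7,7,3);
  (19,12,9,4);(61,21,14,12);(23,9,5,15);(19,6,11,4);(17,10,10,11);(11,8,9,5);(31,26,16,11);(53,10,52,8);(29,13,22,16);
  (73,53,45,35);(19,11,1,14);(41,8,24,34);(37,10,26,23);(83,20,28,57);(17,8,15,11);(67,48,13,6);(89,76,69,37);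
  (19,7,2,2);(13,6,10,5);(59,23,19,8);(103,35,32,5);(43,37,2,17);(61,37,20,15);(19,6,1,2);(61,55,7,4);(37,21,20,18);
  (131,90,1,45);(13,10,6,2);(43,36,5,5);(37,17,27,7);(19,9,9,7);(13,3,7,2);(151,32,44,3);(53,29,9,37);(13,10,3,6);
  (79,59,45,63);(19,12,11,14);(29,16,21,2);(19,3,14,8);(17,4,0,11);(37,24,19,5);(41,13,25,12);(29,8,22,2);
  (43,12,12,6);(29,20,27,12);(17,7,8,2);(107,78,42,74);(31,5,4,22);(59,20,0,3);(31,4,2,2);(61,46,59,30);(83,5,26,7);
  (19,11,17,8);(37,11,12,4);(71,54,30,37);(73,54,65,9);(53,5,43,6);(83,78,47,41);(83,6,58,51);(101,57,27,10);
  (59,10,42,5);(31,20,1,12);(137,105,58,7);(59,37,7,21);(191,160,32,80);(17,5,16,3);(31,14,12,6);(23,14,21,7);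
  (43,29,28,30);(29,15,21,14);(67,11,41,36);(79,76,16,35);(89,73,41,29);(59,18,25,58);(29,10,22,7);(31,25,21,4);
  (197,100,129,82);(11,4,4,5);(97,23,77,70);(67,3,35,23);(23,4,18,5);(11,8,0,3);(19,7,15,9);(113,58,109,47);
  (29,11,16,9);(17,8,12,8);(19,11,7,3);(89,62,44,42);(17,12,13,10);(23,17,2,5);(17,14,12,5);(37,16,25,17);
  (83,30,62,55);(43,14,26,14);(107,19,2,15);(17,9,5,8);(83,66,47,8);(79,43,16,35);(79,36,75,15);(101,7,37,2);
  (59,16,19,13);(11,8,2,2);(19,10,12,14);(23,9,10,3);(53,8,2,3);(37,10,27,17);(107,35,67,77);(11,4,4,5);(41,3,3,5);
  (79,16,74,23);(53,47,39,44);(41,3,21,3);(19,3,17,2);(43,17,14,10);(17,3,5,16);(13,6,8,5);(17,5,14,5);(19,6,3,4);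
  (37,19,0,5);(29,13,19,7);(37,26,16,21);(127,89,107,57);(59,21,58,5);(181,15,117,100);(53,16,20,2);(43,35,20,6);
  (11,3,9,5);(53,4,25,4);(83,17,81,30);(19,9,7,7);(13,5,3,5);(101,36,68,7);(13,8,4,12);(17,13,2,8);(53,44,13,3);
  (23,6,13,5);(43,34,35,25);(19,11,16,4);(37,7,7,18);(31,6,8,3);(11,4,4,5);(11,3,5,2);(109,59,60,38);(83,24,9,71);
  (19,3,6,14);(13,5,9,2);(29,20,9,16);(23,14,1,15);(83,20,44,2);(11,8,2,5);(41,32,38,5);(41,12,12,17);(29,14,26,14);
  (19,3,11,6);(67,25,49,20);(109,22,23,29);(41,18,1,5);(151,121,77,52);(23,14,18,5);(103,32,6,47);(131,89,58,4);
  (23,17,14,9);(53,41,13,15);(79,36,72,8);(61,36,45,10);(11,4,7,7);(37,8,12,17);(67,6,53,11);(83,4,16,11);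
  (137,94,115,36);(59,53,0,9);(19,3,1,3);(17,3,6,3);(19,15,16,14);(47,14,40,26);(23,19,9,4);(23,4,1,9);(89,3,75,36);
  (23,9,3,3);(37,5,34,13);(73,23,31,16);(43,3,31,14);(37,17,27,17);(31,25,1,10);(107,8,3,11);(107,39,1,6);
  (41,20,5,23);(37,30,36,8);(47,16,0,3);(79,65,42,39);(29,14,27,4);(47,19,1,7);(67,25,5,33);(83,19,27,3);
  (37,13,30,22);(29,16,11,12);(13,7,4,6);(23,19,16,11);(97,5,84,44);(29,18,4,18);(83,31,72,62);(103,64,16,25);
  (19,7,8,14);(37,23,12,5);(59,9,34,47);(173,143,95,55);(47,8,4,18);(101,29,71,84);(109,93,89,83);(11,4,1,7);
  (19,5,17,8);(41,5,9,4);(149,110,145,54);(31,20,29,5);(89,63,33,34);(13,3,12,3);(31,26,27,5);(13,7,3,5);(23,10,7,11);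
  (37,12,5,2);(13,10,7,4);(19,11,7,2);(31,7,1,10);(113,106,46,23);(71,25,53,29);(37,8,8,8);(103,33,83,30);
  (43,34,17,12);(149,47,103,72);(23,9,2,17);(47,36,45,2);(13,7,10,5);(43,25,42,4);(29,10,8,28);(31,4,7,7);
  (31,10,16,3);(31,7,29,15);(41,9,14,27);(79,14,30,8);(47,24,8,3);(29,16,23,23);(17,8,6,3);(41,31,8,9);(43,22,14,3);
  (59,4,55,21);(61,48,18,9);(47,39,18,4);(47,16,44,3);(23,10,5,7);(11,8,0,3);(53,11,5,15);(59,12,8,44);(97,3,80,33);
  (53,7,49,12);(17,12,7,11);(37,17,29,11);(31,5,25,11);(17,8,15,8);(113,29,85,9);(37,14,15,8);(61,22,13,21);
  (17,7,16,8);(41,29,25,17);(37,4,20,21);(17,13,12,5);(11,8,9,2);(37,7,12,13);(59,16,53,13);(41,31,21,12);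
  (149,87,126,21);(79,7,36,5);(43,17,23,9);(29,14,4,18);(167,140,148,53);(101,10,55,12);(107,9,12,89);(103,35,29,37);
  (13,3,10,6);(31,11,25,14);(17,7,6,2);(23,17,3,17);(13,6,6,3);(61,58,3,17);(199,22,165,7);(31,22,9,11);(41,12,18,6);
  (29,7,21,14);(53,41,52,8);(53,26,1,28);(131,8,6,50);(97,11,22,5);(19,7,18,9);(17,14,16,2);(23,14,2,2);(53,36,6,23);
  (41,9,18,12);(19,6,5,8);(47,29,18,15);(173,67,70,117);(59,50,41,16);(29,7,16,14);(29,13,18,9);(29,10,8,5);
  (19,3,12,2);(71,41,61,28);(37,8,12,4);(71,44,54,22);(61,5,28,19);(31,14,25,3);(61,36,5,19);(17,7,3,8);(43,5,42,4);
  (43,10,0,21);(19,10,11,6);(139,16,128,39);(67,10,5,40);(23,4,9,7);(31,17,17,7);(89,38,14,14);(173,73,150,43);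
  (197,93,188,15);(43,27,3,19);(37,9,1,6);(71,19,32,30);(71,6,31,6);(271,158,41,202);(73,33,51,8);(31,28,5,2);
  (61,46,38,19);(37,33,18,9);(37,34,28,13);(31,15,6,14);(19,8,10,3);(17,9,1,10);(29,21,20,16);(29,8,26,7);(17,5,11,2);
  (37,3,26,13);(53,12,51,22);(59,3,58,22);(41,11,0,12);(101,18,1,36);(67,51,21,10);(61,45,28,11);(61,37,11,17);
  (73,4,25,12);(97,82,10,32);(37,29,10,17);(19,9,14,8);(61,10,58,27);(41,9,26,2);(29,13,1,8);(71,19,59,39);
  (89,59,37,5);(37,23,29,8);(59,29,56,9);(53,22,29,26);(47,39,12,5);(19,9,8,4);(37,10,7,23);(19,13,12,14);(19,3,4,2);
  (107,13,100,95);(31,5,4,23);(109,16,11,36);(31,21,25,14);(19,8,3,4);(11,4,6,3);(37,24,5,21);(41,15,19,17);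
  (53,14,11,15);(11,8,8,3);(43,36,42,15);(31,11,20,12);(29,17,16,23);(31,26,26,2);(101,47,44,32);(101,41,46,84);
  (47,19,12,23);(53,8,30,44);(41,33,36,11);(17,9,16,8);(181,71,97,30);(107,35,33,13);(37,4,18,13);(59,18,56,3);
  (103,7,50,30);(31,15,8,5);(59,51,9,24);(19,11,2,8);(97,9,12,43);(13,8,2,6);(199,152,147,8);(109,65,15,10);
  (61,3,37,24);(37,34,4,10);(19,8,13,7);(43,20,17,7);(89,59,33,41);(67,7,43,19);(83,21,65,62);(17,14,0,5);
  (107,3,100,40);(47,31,18,3);(17,4,0,10);(109,28,97,6);(43,40,22,6);(31,11,15,6);(59,42,32,9);(29,12,26,5);
  (41,36,0,17);(67,38,52,43);(11,8,6,3);(19,9,7,9);(179,93,92,13);(13,5,6,2);(47,6,3,3);(41,8,12,23);(13,10,1,3);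
  (47,43,13,2);(41,5,39,12);(13,6,12,2);(17,4,7,3);(43,6,23,9);(47,11,46,13);(23,14,16,3);(29,16,24,7);(11,4,6,3);
  (89,86,16,79);(19,3,12,9);(59,13,21,42);(37,29,32,17);(31,16,24,14);(71,30,56,4);(17,14,1,8);(109,44,92,43);
  (17,8,0,10);(37,7,34,8);(17,3,5,5);(29,15,4,16);(41,10,10,8)]%bin)%SEQ.

Definition exceptional_pairs : seq (nat * nat) :=
  [seq AB <- [seq (A, B) | A <- iota 2 76, B <- iota A (78 - A)]
    | (AB.1 + AB.2 <= 77 + neg_gcd AB.1 AB.2)%N & AB \notin [:: (2, 2); (3, 3)]%N].

Lemma certificate_tableP :
  all2 (fun AB c => spider_certificate AB.1 AB.2 c) exceptional_pairs certificate_table.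
Proof. by vm_compute. Qed.

Lemma spider_funC A B z : spider_fun A B z = spider_fun B A z.
Proof. by rewrite /spider_fun (addnC B); ring. Qed.

Lemma all2_exists (T : eqType) (S : Type) (r : T -> S -> bool) ps cs x :
  all2 r ps cs -> x \in ps -> exists c, r x c.
Proof.
elim: ps cs => [|p ps IHps] [|c cs] //= /andP[rpc /IHps IH].
by rewrite inE => /predU1P[->|/IH//]; exists c.
Qed.

Lemma abelian_spider_pair A B (s z : algC) : (2 <= A)%N -> (2 <= B)%N ->
  1 < s -> spider_fun A B s = 0 -> z = s + s^-1 + 2 -> generates_abelian_extension z ->
  (A, B) \in [:: (2, 2); (3, 3)]%N.
Proof.
wlog le_AB : A B / (A <= B)%N => [wl|] A2 B2 s1 Es zE abz.
  have [/wl|/ltnW/wl] := leqP A B; first by apply.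
  move/(_ B2 A2 s1); rewrite spider_funC => /(_ Es zE abz).
  by rewrite !inE !xpair_eqE ![(B == _) && _]andbC.
have [gT [K [nu [KA Kz faithful]]]] := abelian_field_of_generator abz.
have bE : s + s^-1 = z - 2 by rewrite zE addrK.
have Kb : K (s + s^-1).
  by rewrite bE; apply: (abfD KA) => //; apply: (abfN KA); apply: (abfD KA); apply: (abf1 KA).
have fb g : nu g (s + s^-1) = s + s^-1 -> g = 1%g.
  by rewrite bE rmorphB rmorph_nat => /addIr/faithful.
have le := spider_size_le A2 B2 s1 Es KA Kb fb.
have B77 : (B <= 77)%N.
  have : (neg_gcd A B <= A)%N.
    by rewrite /neg_gcd; case: ifP => // _; rewrite dvdn_leq ?dvdn_gcdl // ltnW.
  by move: le; lia.
apply: contraT => nex; exfalso.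
have exc : (A, B) \in exceptional_pairs.
  rewrite mem_filter; apply/andP; split; first by rewrite /= le nex.
  apply/allpairsPdep; exists A, B; split=> //.
    by rewrite mem_iota; lia.
  by rewrite mem_iota; lia.
have [c] := all2_exists certificate_tableP exc.
exact: (spider_certificate_sound A2 B2 s1 Es KA Kb fb).
Qed.

(** * The spectrum of the spider *)

Local Open Scope sesquilinear_scope.

Lemma rayleigh_le n (A : 'M[algC]_n) (lam : algC) (v : 'rV[algC]_n) : A \is hermsymmx ->
  (forall mu, mu \is Num.real -> eigenvalue A mu -> mu <= lam) ->
  (v *m A *m v ^t* ) 0 0 <= lam * (v *m v ^t* ) 0 0.
Proof.
move=> Ah max; have /orthomx_spectralP AE := hermitian_normalmx Ah.
have dR := hermitian_spectral_diag_real Ah.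
have PU : spectralmx A \is unitarymx by apply: spectral_unitarymx.
have Pu := spectral_unit A; move: PU Pu AE dR.
move: (spectralmx A) (spectral_diag A) => P d PU Pu AE dR.
have PA : P *m A = diag_mx d *m P by rewrite AE -!mulmxA mulKVmx.
have d_le j : d 0 j <= lam.
  apply: max; first by have /mxOverP := dR; apply.
  apply/eigenvalueP; exists (row j P); first by rewrite -row_mul PA mul_diag_mx; apply/rowP => k; rewrite !mxE.
  apply/negP => /eqP /(congr1 (fun u => u *m invmx P)); rewrite -row_mul mulmxV // mul0mx.
  by move/rowP/(_ j)/eqP; rewrite !mxE eqxx oner_eq0.
have PP : P *m P ^t* = 1%:M by apply/unitarymxP.
rewrite -[v](mulmxKV Pu); move: (v *m invmx P) => u.
have -> : u *m P *m A *m (u *m P)^t* = u *m diag_mx d *m u^t*.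
  by rewrite trmx_mul map_mxM -(mulmxA u P A) PA -!mulmxA (mulmxA P) PP mul1mx.
have -> : u *m P *m (u *m P)^t* = u *m u^t*.
  by rewrite trmx_mul map_mxM -!mulmxA (mulmxA P) PP mul1mx.
rewrite !mxE mulr_sumr; apply: ler_sum => j _.
rewrite mul_mx_diag !mxE mulrAC [leLHS]mulrC.
by apply: ler_wpM2r => //; apply: mul_conjC_ge0.
Qed.

Lemma row_adjacency n (e : rel 'I_n) (f : nat -> algC) (j : 'I_n) (L : seq nat) :
  uniq L -> (forall i, i \in L -> (i < n)%N) -> (forall i, e i j = (val i \in L)) ->
  ((\row_i f (val i)) *m adjacency e) 0 j = \sum_(i <- L) f i.
Proof.
move=> uL Ln eL; rewrite mxE.
transitivity (\sum_(i < n | val i \in L) f (val i)).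
  rewrite [RHS]big_mkcond; apply: eq_bigr => i _; rewrite !mxE eL.
  by case: ifP; rewrite ?mulr1 ?mulr0.
rewrite -(big_mkord (fun i => i \in L) f) -big_filter; apply: perm_big; apply: uniq_perm => //.
  by rewrite filter_uniq // iota_uniq.
move=> i; rewrite mem_filter mem_index_iota /=; apply/andP/idP => [[]//|iL].
by split=> //; apply: Ln.
Qed.

Section Spider.

Variables (a b : nat).
Local Notation n := (a + b + 8)%N.
Local Notation A := (adjacency (morrison_spider a b)).

Lemma spider_hermitian : A \is hermsymmx.
Proof.
apply: realsym_hermsym.
  apply/is_hermitianmxP; rewrite expr0 scale1r map_mx_id //; apply/matrixP => i j.
  by rewrite !mxE /morrison_spider orbC.
by apply/mxOverP => i j; rewrite mxE realn.
Qed.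

Definition spider_nbrs (j : nat) : seq nat :=
  match j with
  | 0 => [:: 1; 5; 6] | 1 => [:: 0; 2] | 2 => [:: 1; 3]
  | 3 => [:: 2; 4] ++ (if 0 < b then [:: 8 + a] else [::])
  | 4 => [:: 3; 5] | 5 => [:: 4; 0]
  | 6 => [:: 0; 7] ++ (if 0 < a then [:: 8] else [::])
  | 7 => [:: 6]
  | k => (if k < 8 + a then [:: if k == 8 then 6 else k.-1] ++ (if k.+1 < 8 + a then [:: k.+1] else [::])
          else [:: if k == 8 + a then 3 else k.-1] ++ (if k.+1 < 8 + a + b then [:: k.+1] else [::]))
  end%N.

Lemma spider_nbrsP (i j : nat) : (i < n)%N -> (j < n)%N ->
  spider_arc a b i j || spider_arc a b j i = (i \in spider_nbrs j).
Proof.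
case: j => [|[|[|[|[|[|[|[|j]]]]]]]]; case: i => [|[|[|[|[|[|[|[|i]]]]]]]] hi hj;
  rewrite /spider_arc /spider_nbrs /=.
all: try by case: a => [|?]; case: b => [|?].
all: rewrite ?inE /= ?andbF ?orbF ?andbT; repeat case: ifP => ?; rewrite ?inE ?in_nil /=; lia.
Qed.

Lemma spider_nbrs_uniq j : uniq (spider_nbrs j).
Proof.
case: j => [|[|[|[|[|[|[|[|j]]]]]]]] //=; repeat case: ifP => ?; rewrite /= ?inE ?in_nil /=; lia.
Qed.

Lemma spider_nbrs_lt i j : (j < n)%N -> i \in spider_nbrs j -> (i < n)%N.
Proof.
case: j => [|[|[|[|[|[|[|[|j]]]]]]]] /=; repeat case: ifP => ?; rewrite !inE ?in_nil /=; lia.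
Qed.

Lemma spider_row (f : nat -> algC) j (hj : (j < n)%N) :
  ((\row_i f (val i)) *m A) 0 (Ordinal hj) = \sum_(i <- spider_nbrs j) f i.
Proof.
apply: row_adjacency; first exact: spider_nbrs_uniq.
  by move=> i; apply: spider_nbrs_lt.
by move=> i; apply: spider_nbrsP.
Qed.

End Spider.

Lemma ord_sum_ge n m (F : nat -> algC) : (m <= n)%N -> (forall i, (m <= i)%N -> F i = 0) ->
  \sum_(i < n) F (val i) = \sum_(0 <= i < m) F i.
Proof.
move=> mn F0; rewrite -(big_mkord predT F) (big_cat_nat _ mn) //=.
rewrite [X in _ + X]big_nat_cond [X in _ + X]big1 ?addr0 // => i /andP[/andP[mi _] _].
exact: F0.
Qed.

Section PathCoefficients.
Variable t : algC.
Hypotheses (t0 : t != 0) (t1 : t - t^-1 != 0).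

Definition path_coef n := (t ^+ n - t ^- n) / (t - t^-1).

Lemma path_coef0 : path_coef 0 = 0.
Proof. by rewrite /path_coef expr0 invr1 subrr mul0r. Qed.

Lemma path_coef1 : path_coef 1 = 1.
Proof. by rewrite /path_coef expr1 divff. Qed.

Lemma path_coefSS n : path_coef n.+2 = (t + t^-1) * path_coef n.+1 - path_coef n.
Proof.
have tt : t * t - 1 != 0.
  have -> : t * t - 1 = t * (t - t^-1) by field.
  by rewrite mulf_neq0.
rewrite /path_coef !exprS; have := expf_neq0 n t0; move: (t ^+ n) => T T0.
by field; rewrite tt T0 t0.
Qed.

Lemma path_coefP (P : nat -> algC) m : P m.+1 = 0 ->
  (forall k, (k < m)%N -> (t + t^-1) * P k.+1 = P k + P k.+2) ->
  forall k, (k <= m.+1)%N -> P (m.+1 - k)%N = path_coef k * P m.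
Proof.
move=> Pm rec; elim/ltn_ind => -[|[|k]] IH le; first by rewrite subn0 Pm path_coef0 mul0r.
  by rewrite subn1 path_coef1 mul1r.
have h : (m.+1 - k.+2 < m)%N by lia.
have := rec _ h; rewrite (_ : (m.+1 - k.+2).+1 = m.+1 - k.+1)%N; last by lia.
rewrite (_ : (m.+1 - k.+1).+1 = m.+1 - k)%N; last by lia.
rewrite (IH k.+1) ?(IH k) //; try lia.
rewrite path_coefSS mulrBl => e; rewrite -[_ * path_coef k.+1 * _]mulrA e; ring.
Qed.
End PathCoefficients.

Section SpiderEigen.

Variables (a b : nat) (lam : algC).
Local Notation n := (a + b + 8)%N.
Local Notation A := (adjacency (morrison_spider a b)).

(* Rayleigh quotient of the vector equal to 1 on the hexagon and to 1/2 at v: 13 / (25/4) > 2. *)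
Lemma spider_perron_gt2 : is_perron_frobenius (morrison_spider a b) lam -> 2 < lam.
Proof.
case=> lamR _ max; pose f i : algC := nth 0 [:: 1; 1; 1; 1; 1; 1; 2^-1] i.
have f0 i : (7 <= i)%N -> f i = 0 by move=> hi; rewrite /f nth_default.
have fR i : (f i)^* = f i.
  by apply/CrealP; rewrite /f; do 7?[case: i => [|i] //=]; rewrite ?nth_nil ?real1 ?real0 // rpredV realn.
have n7 : (7 <= n)%N by lia.
have := rayleigh_le (\row_i f (val i)) (spider_hermitian a b) max.
pose g j := \sum_(i <- spider_nbrs a b j) f i.
have -> : ((\row_i f (val i)) *m A *m (map_mx Num.conj (\row_i f (val i))^T)) 0 0 = \sum_(j < n) g (val j) * f (val j).
  by rewrite mxE; apply: eq_bigr => -[j hj] _; rewrite spider_row !mxE fR.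
have -> : ((\row_(i < n) f (val i)) *m (map_mx Num.conj (\row_(i < n) f (val i))^T)) 0 0 =
    \sum_(j < n) f (val j) * f (val j).
  by rewrite mxE; apply: eq_bigr => j _; rewrite !mxE fR.
rewrite (ord_sum_ge (F := fun j => g j * f j) n7) => [|j /f0 ->]; last by rewrite mulr0.
rewrite (ord_sum_ge (F := fun j => f j * f j) n7) => [|j /f0 ->]; last by rewrite mulr0.
rewrite !big_nat_recl // !big_geq // /g /spider_nbrs !big_cat !big_cons !big_nil.
have z c k : (7 <= k)%N -> \sum_(i <- if c then [:: k] else [::]) f i = 0.
  by move=> k7; case: c; rewrite ?big_cons big_nil ?f0 ?addr0.
rewrite !z //= /f /=.
rewrite [leLHS](_ : _ = 13%:R); last by field.
rewrite [X in lam * X](_ : _ = 25%:R / 4%:R); last by field.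
rewrite mulrA ler_pdivlMr ?ltr0n // -natrM => le; rewrite real_ltNge ?realn //.
apply/negP => lam2; have := le_trans le (ler_wpM2r (ler0n _ 25) lam2).
by rewrite -natrM ler_nat.
Qed.

Variable t : algC.
Hypotheses (t1 : 1 < t) (lamE : lam = t + t^-1).
Local Notation c := (path_coef t).

Let t0 : t != 0. Proof. by rewrite gt_eqF // (lt_trans ltr01). Qed.
Let tt1 : t - t^-1 != 0.
Proof.
by rewrite gt_eqF // subr_gt0 (lt_trans _ t1) // invf_lt1 // (lt_trans ltr01).
Qed.
Let lam0 : lam != 0.
Proof. by rewrite lamE gt_eqF // addr_gt0 ?invr_gt0 // (lt_trans ltr01). Qed.

Lemma path_a_sum (f : nat -> algC) k : (k < a)%N -> \sum_(i <- spider_nbrs a b (8 + k)) f i =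
  f (if k == 0 then 6 else 7 + k)%N + (if (k.+1 < a)%N then f (8 + k.+1)%N else 0).
Proof.
move=> ka; rewrite -[(8 + k)%N]/(k.+4.+4) /spider_nbrs.
rewrite (_ : (k.+4.+4 < 8 + a)%N); last by lia.
rewrite /= big_cons (_ : (k.+4.+4.+1 < 8 + a)%N = (k.+1 < a)%N); last by lia.
congr (_ + _).
by case: ifP => _; rewrite ?big_cons big_nil ?addr0.
Qed.

Lemma path_b_sum (f : nat -> algC) k : (k < b)%N -> \sum_(i <- spider_nbrs a b (8 + a + k)) f i =
  f (if k == 0 then 3 else 7 + a + k)%N + (if (k.+1 < b)%N then f (8 + a + k.+1)%N else 0).
Proof.
move=> kb; rewrite -[(8 + a + k)%N]/((a + k).+4.+4) /spider_nbrs.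
rewrite (_ : ((a + k).+4.+4 < 8 + a)%N = false); last by lia.
rewrite /= big_cons.
rewrite (_ : ((a + k).+4.+4.+1 < 8 + a + b)%N = (k.+1 < b)%N); last by lia.
congr (_ + _); last by case: ifP => _; rewrite ?big_cons big_nil ?addr0 ?addnS.
rewrite (_ : ((a + k).+4.+4 == 8 + a)%N = (k == 0)%N) //; lia.
Qed.

Lemma spider_eigen_system (f : nat -> algC) :
  (forall j, (j < n)%N -> lam * f j = \sum_(i <- spider_nbrs a b j) f i) ->
  exists ka mu, [/\ f 6 = c a.+1 * ka, f 3 = c b.+1 * mu,
    lam * f 6 = f 0 + f 7 + c a * ka, lam * f 3 = f 2 + f 4 + c b * mu &
    ka = 0 -> mu = 0 -> forall j, (8 <= j < n)%N -> f j = 0].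
Proof.
move=> H.
pose P k := if k is k'.+1 then if (k < a.+1)%N then f (8 + k')%N else 0 else f 6.
pose Q k := if k is k'.+1 then if (k < b.+1)%N then f (8 + a + k')%N else 0 else f 3.
have PE k : (k <= a.+1)%N -> P (a.+1 - k)%N = c k * P a.
  rewrite lamE in H; apply: (path_coefP t0 tt1); first by rewrite /P ltnn.
  move=> {}k ka; rewrite {1}/P ltnS ka H; last by lia.
  rewrite path_a_sum // /P ltnS; case: k ka => [|k] ka; first by rewrite eqxx.
  by rewrite ltnS (ltnW ka) (_ : (7 + k.+1 = 8 + k)%N) //; lia.
have QE k : (k <= b.+1)%N -> Q (b.+1 - k)%N = c k * Q b.
  rewrite lamE in H; apply: (path_coefP t0 tt1); first by rewrite /Q ltnn.
  move=> {}k kb; rewrite {1}/Q ltnS kb H; last by lia.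
  rewrite path_b_sum // /Q ltnS; case: k kb => [|k] kb; first by rewrite eqxx.
  by rewrite ltnS (ltnW kb) (_ : (7 + a + k.+1 = 8 + a + k)%N) //; lia.
exists (P a), (Q b); split.
- by rewrite -PE // subnn.
- by rewrite -QE // subnn.
- rewrite H; last by lia.
  rewrite /= !big_cons addrA; congr (_ + _).
  rewrite -PE // subSnn /P; case: (a) => [|a'] /=; by rewrite ?big_cons big_nil ?addr0.
- rewrite H; last by lia.
  rewrite /= !big_cons addrA; congr (_ + _).
  rewrite -QE // subSnn /Q; case: (b) => [|b'] /=; by rewrite ?big_cons big_nil ?addr0 ?addn0.
move=> Pa0 Qb0 j /andP[j8 jn]; have [ja|ja] := ltnP j (8 + a).
  have := PE (a - (j - 8))%N; rewrite Pa0 mulr0 (_ : (a.+1 - (a - (j - 8))) = (j - 8).+1)%N; last by lia.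
  by rewrite /P ltnS (_ : (j - 8 < a)%N) ?subnKC //; last lia; apply; lia.
have := QE (b - (j - (8 + a)))%N; rewrite Qb0 mulr0.
rewrite (_ : (b.+1 - (b - (j - (8 + a)))) = (j - (8 + a)).+1)%N; last by lia.
by rewrite /Q ltnS (_ : (j - (8 + a) < b)%N) ?subnKC //; last lia; apply; lia.
Qed.

Lemma spider_eigen_root : 2 < lam -> eigenvalue A lam -> spider_fun a.+2 b.+2 (t ^+ 2) = 0.
Proof.
move=> lam2 /eigenvalueP[v vA v0].
pose f i : algC := if insub i is Some k then v 0 (k : 'I_n) else 0.
have vE : v = \row_i f (val i) by apply/rowP => i; rewrite mxE /f valK.
have H j : (j < n)%N -> lam * f j = \sum_(i <- spider_nbrs a b j) f i.
  move=> jn; rewrite -(spider_row f jn) -vE vA mxE; congr (_ * _).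
  by rewrite /f insubT.
have [ka [mu [f6 f3 e6 e3 z]]] := spider_eigen_system H.
have h j : (j < 8)%N -> lam * f j = \sum_(i <- spider_nbrs a b j) f i by move=> j8; apply: H; lia.
have h0 := h 0%N isT; have h1 := h 1%N isT; have h2 := h 2%N isT; have h4 := h 4%N isT.
have h5 := h 5%N isT; have h7 := h 7%N isT.
move: h0 h1 h2 h4 h5 h7; rewrite /= !big_cons !big_nil !addr0 => h0 h1 h2 h4 h5 h7.
have eqs : spider_fun a.+2 b.+2 (t ^+ 2) * ka = 0 /\ spider_fun a.+2 b.+2 (t ^+ 2) * mu = 0.
  have f7E : f 7 = f 6 / lam by rewrite -h7 mulrC mulKf.
  pose p0 := lam * c a.+1 - c a.+1 / lam - c a; pose p1 := lam * p0 - c a.+1.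
  pose q1 := lam * c b.+2 - 2 * c b.+1.
  have f0E : f 0 = p0 * ka.
    transitivity (lam * f 6 - f 7 - c a * ka); first by rewrite e6; ring.
    by rewrite f7E f6 /p0; ring.
  have s1 : f 1 + f 5 = p1 * ka.
    transitivity (lam * f 0 - f 6); first by rewrite h0; ring.
    by rewrite f0E f6 /p1; ring.
  have s2 : f 2 + f 4 = c b.+2 * mu.
    transitivity (lam * f 3 - c b * mu); first by rewrite e3; ring.
    by rewrite f3 path_coefSS // -lamE; ring.
  have k1 : (lam * p1 - 2 * p0) * ka = c b.+2 * mu.
    rewrite -s2; transitivity (lam * (f 1 + f 5) - 2 * f 0); first by rewrite s1 f0E; ring.
    by rewrite mulrDr h1 h5; ring.
  have k2 : p1 * ka = q1 * mu.
    rewrite -s1; transitivity (lam * (f 2 + f 4) - 2 * f 3); last by rewrite s2 f3 /q1; ring.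
    by rewrite mulrDr h2 h4; ring.
  have DE : spider_fun a.+2 b.+2 (t ^+ 2) = ((lam * p1 - 2 * p0) * q1 - c b.+2 * p1) *
      (t ^+ 8 * (t - t^-1) ^+ 2 * lam * t ^+ a * t ^+ b / (t ^+ 2 - 1)).
    have tt : t * t - 1 != 0.
      have -> : t * t - 1 = t * (t - t^-1) by field.
      by rewrite mulf_neq0.
    have tt2 : t * t + 1 != 0.
      have -> : t * t + 1 = t * lam by rewrite lamE; field.
      by rewrite mulf_neq0.
    rewrite /p1 /p0 /q1 /path_coef /spider_fun lamE !exprD -!exprM ![(2 * _)%N]mulnC !exprM !exprS.
    have := expf_neq0 a t0; have := expf_neq0 b t0; move: (t ^+ a) (t ^+ b) => X Y Y0 X0.
    by field; rewrite X0 Y0 t0 tt tt2.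
  rewrite {}DE; move: (_ / (t ^+ 2 - 1)) => k; move: (lam * p1 - 2 * p0) k1 => q k1; split.
    transitivity (k * (q1 * (q * ka) - c b.+2 * (p1 * ka))); first by ring.
    by rewrite k1 k2; ring.
  transitivity (k * (q * (q1 * mu) - p1 * (c b.+2 * mu))); first by ring.
  by rewrite -k1 -k2; ring.
apply/eqP; apply: contraNT v0 => E0; rewrite vE; apply/eqP/rowP => j; rewrite !mxE.
have [ka0 mu0] : ka = 0 /\ mu = 0.
  by case: eqs => /eqP + /eqP; rewrite !mulf_eq0 (negPf E0) => /eqP -> /eqP ->.
have lam1 : lam ^+ 2 - 1 != 0.
  by rewrite subr_eq0 gt_eqF // exprn_egt1 // (lt_trans _ lam2) // ltr1n.
have f60 : f 6 = 0 by rewrite f6 ka0 mulr0.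
have f30 : f 3 = 0 by rewrite f3 mu0 mulr0.
have f70 : f 7 = 0 by apply: (mulfI lam0); rewrite h7 f60 mulr0.
have f00 : f 0 = 0 by move: e6; rewrite f60 f70 ka0 !mulr0 !addr0 => <-.
have pair x y : lam * x = y -> lam * y = x -> x = 0 /\ y = 0.
  move=> <- e; suff -> : x = 0 by rewrite mulr0.
  by apply: (mulfI lam1); rewrite mulr0 mulrBl mul1r expr2 -mulrA e subrr.
have [f10 f20] : f 1 = 0 /\ f 2 = 0.
  by apply: pair; [rewrite h1 f00 add0r | rewrite h2 f30 addr0].
have [f40 f50] : f 4 = 0 /\ f 5 = 0.
  by apply: pair; [rewrite h4 f30 add0r | rewrite h5 f00 addr0].
have [j8|j8] := ltnP (val j) 8; last by apply: z => //; rewrite j8 ltn_ord.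
by move: (val j) j8; do 8?[case=> [//|]].
Qed.

End SpiderEigen.

Lemma trace_param (lam : algC) : 2 < lam -> exists2 t : algC, 1 < t & lam = t + t^-1.
Proof.
move=> lam2; have lam0 : 0 < lam by rewrite (lt_trans _ lam2) // ltr0n.
pose d : algC := sqrtC (lam ^+ 2 - 4%:R).
have d0 : 0 <= d.
  rewrite sqrtC_ge0 subr_ge0 -[4%:R]/((2 ^ 2)%N%:R) natrX ler_sqr ?nnegrE ?ler0n ?(ltW lam0) //.
  exact: ltW.
have t1 : 1 < (lam + d) / 2.
  by rewrite ltr_pdivlMr ?ltr0n // mul1r (lt_le_trans lam2) // lerDl.
exists ((lam + d) / 2) => //; have t0 : (lam + d) / 2 != 0 by rewrite gt_eqF // (lt_trans ltr01).
have -> : ((lam + d) / 2)^-1 = (lam - d) / 2; last by field.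
apply: (mulfI t0); rewrite divff //.
transitivity ((lam ^+ 2 - d ^+ 2) / 4%:R); last by field.
by rewrite sqrtCK; field.
Qed.

Theorem theorem1p3 (a b : nat) :
  abelian_graph (morrison_spider a b) ->
  (a = 0%N /\ b = 0%N) \/ (a = 1%N /\ b = 1%N).
Proof.
case=> lam pf abl; have lam2 := spider_perron_gt2 pf.
have [t t1 lamE] := trace_param lam2; have t0 : t != 0 by rewrite gt_eqF // (lt_trans ltr01).
have [_ lam_ev _] := pf.
have Es := spider_eigen_root t1 lamE lam2 lam_ev.
have s1 : 1 < t ^+ 2 by rewrite exprn_egt1.
have lamE2 : lam ^+ 2 = t ^+ 2 + (t ^+ 2)^-1 + 2 by rewrite lamE; field.
have := @abelian_spider_pair a.+2 b.+2 _ _ isT isT s1 Es lamE2 abl.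
by rewrite !inE !xpair_eqE !eqSS => /orP[]/andP[/eqP -> /eqP ->]; [left | right].
Qed.
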